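(* Let $\varsigma_1,\varsigma_3\in\mathcal V$ be the states $$\varsigma_1(z)=I^a_{-1}(z)I^a_{-1}(z)|0\rangle,$$ $$\varsigma_3(z)=\Big[\delta_{(ab}\delta_{cd)}I^a_{-1}(z)I^b_{-1}(z)I^c_{-1}(z)I^d_{-1}(z)+\tfrac{20}{3}f^{abc}I^a_{-2}(z)I^{b\prime}_{-1}(z)I^c_{-1}(z)+\tfrac{40}{9}I^a_{-3}(z)I^{a\prime\prime}_{-1}(z)-\tfrac{20}{3}I^{a\prime\prime}_{-2}(z)I^a_{-2}(z)+\tfrac{40}{9}I^{a\prime}_{-3}(z)I^{a\prime}_{-1}(z)-\tfrac{10}{3}I^{a\prime}_{-2}(z)I^{a\prime}_{-2}(z)-\tfrac{20}{3}I^a_{-3}(z)I^a_{-1}(z)\mathsf k'(z)\Big]|0\rangle .$$ Then there exist elements $\mathsf A_{i,j}(z,w),\mathsf B_{i,j}(z,w)\in\mathcal V_{(z,w)}$, $i,j\in\{1,3\}$, such that $$\varsigma_1(z)_{(0)}\varsigma_1(w)=(D^{(1)}_z-D^{(1)}_w)\mathsf A_{1,1}(z,w)+T\mathsf B_{1,1}(z,w),$$ $$\varsigma_1(z)_{(0)}\varsigma_3(w)=(3D^{(1)}_z-D^{(3)}_w)\mathsf A_{1,3}(z,w)+T\mathsf B_{1,3}(z,w),$$ $$\varsigma_3(z)_{(0)}\varsigma_1(w)=(D^{(3)}_z-3D^{(1)}_w)\mathsf A_{3,1}(z,w)+T\mathsf B_{3,1}(z,w),$$ $$\varsigma_3(z)_{(0)}\varsigma_3(w)=(3D^{(3)}_z-3D^{(3)}_w)\mathsf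 A_{3,3}(z,w)+T\mathsf B_{3,3}(z,w),$$ and such that each $\mathsf A_{i,j}(z,w)$, $i,j\in\{1,3\}$, is regular at $z=w$ modulo translates.
   Context: Basis of $\mathfrak{sl}_2$: $\{I^a\}_{a=1}^3$ is a basis of $\mathfrak{sl}_2(\mathbb C)$ orthonormal for $(x|y)=\mathrm{Tr}(xy)$ (trace in the defining representation), with $[I^a,I^b]=f^{abc}I^c$, $f^{abc}=i\sqrt2\,\epsilon^{abc}$. Repeated Lie algebra indices are summed. Round brackets on indices denote symmetrization with weight one, so $\delta_{(ab}\delta_{cd)}=\frac13(\delta_{ab}\delta_{cd}+\delta_{ac}\delta_{bd}+\delta_{ad}\delta_{bc})$. Lie algebra $\mathfrak L$: the complex Lie algebra with basis the formal symbols $I^{a[p]}_n(z)$, $\mathsf k^{[p]}(z)$ ($n\in\mathbb Z$, $p\in\mathbb Z_{\ge0}$, $a\in\{1,2,3\}$), with $\mathsf k^{[p]}(z)$ central and $$[I^{a[p]}_m(z),I^{b[q]}_n(z)]=-\frac{p!\,q!}{(p+q+1)!}\Big(f^{abc}I^{c[p+q+1]}_{m+n}(z)-n\,\delta^{ab}\delta_{m+n,0}\,\mathsf k^{[p+q+1]}(z)\Big).$$ A prime, double prime, or no mark denotes $[p]=[1],[2],[0]$. Let $\mathfrak L_+$ be the subalgebra generated by $I^{a[p]}_n(z)$ with $n\ge0$, and $\mathcal V=U(\mathfrak L)\otimes_{U(\mathfrak L_+)}\mathbb C|0\rangle$ the module induced from the trivial module. Two-parameter version: $\mathfrak L_{(z,w)}$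 is the Lie algebra over the ring $\mathbb C[(z-w)^{-1}]$ with generators $I^{a[p]}_n(z),I^{a[p]}_n(w),\mathsf k^{[p]}(z),\mathsf k^{[p]}(w)$, the $\mathsf k$'s central, brackets $$[I^{a[p]}_m(u),I^{b[q]}_n(u)]=-\frac{p!\,q!}{(p+q+1)!}\Big(f^{abc}I^{c[p+q+1]}_{m+n}(u)-n\,\delta^{ab}\delta_{m+n,0}\,\mathsf k^{[p+q+1]}(u)\Big)$$ among the generators with the same parameter $u$, for $u=z$ and for $u=w$, and $$[I^{a[p]}_m(z),I^{b[q]}_n(w)]=\sum_{j=0}^p(-1)^{p+1-j}\binom pj(p+q-j)!\frac{F^{[j]}(z)}{(z-w)^{p+q+1-j}}-\sum_{j=0}^q(-1)^{p+1}\binom qj(p+q-j)!\frac{F^{[j]}(w)}{(z-w)^{p+q+1-j}},$$ where $F^{[j]}(u)=f^{abc}I^{c[j]}_{m+n}(u)-n\,\delta_{m+n,0}\delta^{ab}\mathsf k^{[j]}(u)$. $\mathcal V_{(z,w)}$ is the analogous module induced from the trivial module $\mathbb C[(z-w)^{-1}]|0\rangle$ over the subalgebra generated by the $I^{a[p]}_n(z),I^{a[p]}_n(w)$ with $n\ge0$. There are two embeddings $\mathcal V\hookrightarrow\mathcal V_{(z,w)}$, written $\mathsf v\mapsto\mathsf v(z)$ and $\mathsf v\mapsto\mathsf v(w)$. Vertex algebra structure: $\mathcal V$ and $\mathcal V_{(z,w)}$ are vertex algebras with vacuum $|0\rangle$; the translation operator $T$ is given by $T|0\rangle=0$, $[T,I^{a[p]}_n(u)]=-nI^{a[p]}_{n-1}(u)$,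 $[T,\mathsf k^{[p]}(u)]=0$; the state-field map is $Y(X,x)=\sum_{n}X_{(n)}x^{-n-1}$ with $Y(I^{a[p]}_{-1}(u)|0\rangle,x)=\sum_nI^{a[p]}_n(u)x^{-n-1}$, $Y(\mathsf k^{[p]}(u)X,x)=\mathsf k^{[p]}(u)Y(X,x)$, $Y(TX,x)=\partial_xY(X,x)$, $Y(X_{(-1)}X',x)={:}Y(X,x)Y(X',x){:}$ (normal ordered product). $X_{(0)}X'$ denotes the $0$-th product. Twisted derivatives: $D^{(j)}_z=\partial_z-\frac j2\mathsf k(z)$ and $D^{(j)}_w=\partial_w-\frac j2\mathsf k(w)$, where $\partial_z$ is the derivation sending $I^{a[p]}_n(z)\mapsto I^{a[p+1]}_n(z)$, $\mathsf k^{[p]}(z)\mapsto\mathsf k^{[p+1]}(z)$, annihilating $|0\rangle$ and the generators with parameter $w$, and acting on $\mathbb C[(z-w)^{-1}]$ as the usual derivative; similarly $\partial_w$. Regularity: there is a homomorphism $\mathfrak L_{(z,w)}\to\mathfrak L((w-z))$ which is the identity on generators with parameter $z$ and sends $I^{a[p]}_m(w)\mapsto\sum_{r\ge0}\frac{(w-z)^r}{r!}I^{a[p+r]}_m(z)$, $\mathsf k^{[p]}(w)\mapsto\sum_{r\ge0}\frac{(w-z)^r}{r!}\mathsf k^{[p+r]}(z)$; it induces a map $\mathcal V_{(z,w)}\to\mathcal V((w-z))$. A state $\mathsf v\in\mathcal V_{(z,w)}$ is regular at $z=w$ modulo translates if there is $Z\in\mathcal V_{(z,w)}$ such that the image of $\mathsf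 v-TZ$ under this map has no singular terms, i.e. lies in $\mathcal V[[w-z]]$. *)

(* Defs.v *)
From HB Require Import structures.
From mathcomp Require Import all_boot all_order all_algebra.
From mathcomp Require Import generic_quotient ring_quotient finmap.
From mathcomp Require Import monalg complex.
From mathcomp Require Import boolp reals.

Set Implicit Arguments.
Unset Strict Implicit.
Unset Printing Implicit Defensive.

Import Order.TTheory GRing.Theory Num.Theory.
Local Open Scope ring_scope.
Local Open Scope quotient_scope.

Section FreeAlgebra.
Variables (K : comNzRingType) (G : choiceType).

Definition free_alg : Type := {malg K[{fmonom G}]}.
HB.instance Definition _ := GRing.Lalgebra.on free_alg.

Definition gen (g : G) : free_alg := << fmu g >>.

Fixpoint leibniz (d : G -> free_alg) (s : seq G) : free_alg :=
  if s is g :: s' then d g * \prod_(h <- s') gen h + gen g * leibniz d s'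
  else 0.

(* The derivation which is [delta] on the scalars and [d] on the generators
   ([delta] must itself be a derivation of [K]). *)
Definition derivation (delta : K -> K) (d : G -> free_alg) (f : free_alg) :
    free_alg :=
  \sum_(m <- msupp f) (delta f@_m *: << m >> + f@_m *: leibniz d m).

End FreeAlgebra.

(* Let L be the Lie algebra over K with basis G and bracket br on the basis
   (br g h is a linear combination of generators, hence a degree one element of
   the free algebra), and let L_+ be the subalgebra generated by the g with
   pos g.  Then U(L) is the free algebra on G modulo the two-sided ideal of the
   g h - h g - br g h, and the module induced from the trivial L_+-module K|0>
   is U(L) / U(L) L_+.  Since [x, y] = x y - y x in U(L), the left ideal
   U(L) L_+ is generated by the g with pos g.  So [relations] is the kernel of
   f |-> f|0> from the free algebra to the induced module. *)
Section InducedModule.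
Variables (K : comNzRingType) (G : choiceType).
Local Notation F := (free_alg K G).
Variables (br : G -> G -> F) (pos : pred G).

Inductive relations : F -> Prop :=
| relations0 : relations 0
| relationsD x y : relations x -> relations y -> relations (x + y)
| relationsM x y : relations y -> relations (x * y)
| relations_br g h (y : F) :
    relations ((gen K g * gen K h - gen K h * gen K g - br g h) * y)
| relations_pos g : pos g -> relations (gen K g).

Lemma relationsZ (c : K) x : relations x -> relations (c *: x).
Proof. by move=> rx; rewrite -[x]mul1r scalerAl; exact: relationsM. Qed.

Definition relations_pred : {pred F} := fun x => `[< relations x >].

Lemma relations_zmod_closed : zmod_closed relations_pred.
Proof.
split; first by apply/asboolP; exact: relations0.
move=> x y /asboolP rx /asboolP ry; apply/asboolP.
by rewrite -scaleN1r; apply: relationsD => //; exact: relationsZ.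
Qed.

HB.instance Definition _ :=
  GRing.isZmodClosed.Build F relations_pred relations_zmod_closed.

Definition relations_sub : zmodClosed F := GRing.ZmodClosed.clone F relations_pred _.

Definition induced : Type := Quotient.quot relations_sub.
HB.instance Definition _ := GRing.Zmodule.on induced.

(* f |-> f|0> *)
Definition state (f : F) : induced := \pi_(Quotient.quot relations_sub) f.

Definition rep (v : induced) : F := repr (v : Quotient.quot relations_sub).

Lemma repK : cancel rep state.
Proof. exact: reprK. Qed.

Lemma state_eq f g : state f = state g <-> relations (f - g).
Proof.
rewrite /state; split.
  move=> /eqP; rewrite -Quotient.idealrBE => h.
  exact/asboolP.
by move=> h; apply/eqP; rewrite -Quotient.idealrBE; exact/asboolP.
Qed.

Lemma stateD : {morph state : f g / f + g}.
Proof. by move=> f g; rewrite /state raddfD. Qed.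

Definition scale_induced (c : K) (v : induced) : induced := state (c *: rep v).

Lemma state_scale c f : scale_induced c (state f) = state (c *: f).
Proof.
apply/state_eq; rewrite -scalerBr; apply: relationsZ; apply/state_eq.
exact: repK.
Qed.

Fact scale_inducedA a b v :
  scale_induced a (scale_induced b v) = scale_induced (a * b) v.
Proof. by rewrite -(repK v) !state_scale scalerA. Qed.

Fact scale_induced1 : left_id 1 scale_induced.
Proof. by move=> v; rewrite -(repK v) state_scale scale1r. Qed.

Fact scale_inducedDr : right_distributive scale_induced +%R.
Proof.
move=> c u v; rewrite -(repK u) -(repK v) -stateD !state_scale.
by rewrite -stateD scalerDr.
Qed.

Fact scale_inducedDl v : {morph scale_induced^~ v : a b / a + b}.
Proof. by move=> a b; rewrite -(repK v) !state_scale -stateD scalerDl. Qed.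

HB.instance Definition _ := GRing.Zmodule_isLmodule.Build K induced
  scale_inducedA scale_induced1 scale_inducedDr scale_inducedDl.

Definition act (f : F) (v : induced) : induced := state (f * rep v).

Lemma actE f g : act f (state g) = state (f * g).
Proof.
apply/state_eq; rewrite -mulrBr; apply: relationsM; apply/state_eq.
exact: repK.
Qed.

Definition vac : induced := state 1.

End InducedModule.

Section VertexAlgebra.
Variables (K : comNzRingType) (V : lmodType K).

(* Y X n X' is the n-th product X_(n) X', i.e. the coefficient of x^(-n-1)
   in Y(X, x) X'. *)
Record is_vertex_algebra (vac : V) (T : V -> V) (Y : V -> int -> V -> V) :
    Prop := IsVertexAlgebra {
  va_linl : forall (c : K) X X' n v,
    Y (c *: X + X') n v = c *: Y X n v + Y X' n v;
  va_linr : forall (c : K) X n v v',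
    Y X n (c *: v + v') = c *: Y X n v + Y X n v';
  va_field : forall X v, exists N : int, forall n, N <= n -> Y X n v = 0;
  va_vacuum : forall n v, Y vac n v = if n == -1 then v else 0;
  va_creation : forall X, Y X (-1) vac = X;
  va_creation0 : forall X n, 0 <= n -> Y X n vac = 0;
  va_T_vac : T vac = 0;
  va_translation : forall X n v,
    T (Y X n v) - Y X n (T v) = - n%:~R *: Y X (n - 1) v;
  (* (x - y)^N [Y(X, x), Y(X', y)] = 0 *)
  va_locality : forall X X', exists N : nat, forall (m n : int) v,
    \sum_(j < N.+1) ((-1) ^+ j * 'C(N, j)%:R) *:
      (Y X (m + N%:Z - j%:Z) (Y X' (n + j%:Z) v)
       - Y X' (n + j%:Z) (Y X (m + N%:Z - j%:Z) v)) = 0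
}.

(* s is the sum of the series u, all but finitely many terms of which vanish *)
Definition finite_series (u : nat -> V) (s : V) : Prop :=
  exists N0 : nat, forall N, (N0 <= N)%N -> \sum_(j < N) u j = s.

(* the coefficient of x^(-n-1) in :Y(X, x) Y(X', x): v *)
Definition is_normal_ordered (Y : V -> int -> V -> V) X X' n v (s : V) : Prop :=
  exists s1 s2, [/\
    finite_series (fun j => Y X (- 1 - j%:Z) (Y X' (n + j%:Z) v)) s1,
    finite_series (fun j => Y X' (n - 1 - j%:Z) (Y X j%:Z v)) s2 &
    s = s1 + s2].

End VertexAlgebra.

(* The formal symbols I^{a[p]}_n(u) and k^{[p]}(u), for u in a set P of
   parameters; the indices a = 1, 2, 3 are represented by 'I_3. *)
Definition symb (P : choiceType) : choiceType :=
  (P * (('I_3 * nat * int) + nat))%type.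
Definition symbI (P : choiceType) (u : P) (a : 'I_3) (p : nat) (n : int) :
  symb P := (u, inl (a, p, n)).
Definition symbK (P : choiceType) (u : P) (p : nat) : symb P := (u, inr p).

Definition nonneg_mode (P : choiceType) (g : symb P) : bool :=
  if g.2 is inl (_, _, n) then 0 <= n else false.

Definition symb_pt (P Q : choiceType) (u : Q) (g : symb P) : symb Q := (u, g.2).

Definition shift (P : choiceType) (r : nat) (g : symb P) : symb P :=
  match g with
  | (u, inl (a, p, n)) => symbI u a (p + r) n
  | (u, inr p) => symbK u (p + r)
  end.

Definition levi_civita (a b c : 'I_3) : int :=
  match val a, val b, val c with
  | 0%N, 1%N, 2%N | 1%N, 2%N, 0%N | 2%N, 0%N, 1%N => 1
  | 0%N, 2%N, 1%N | 2%N, 1%N, 0%N | 1%N, 0%N, 2%N => -1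
  | _, _, _ => 0
  end.

Section Gaudin.
Variable R : realType.
Local Notation C := R[i].

Definition fabc (a b c : 'I_3) : C := 'i * sqrtC 2 * (levi_civita a b c)%:~R.

Definition delta_sym (a b c d : 'I_3) : C :=
  3^-1 * (((a == b) && (c == d))%:R + ((a == c) && (b == d))%:R
          + ((a == d) && (b == c))%:R).

Section Brackets.
Variables (K : comNzRingType) (emb : C -> K) (P : choiceType).
Local Notation F := (free_alg K (symb P)).

(* F^{[j]}(u) = f^{abc} I^{c[j]}_{m+n}(u)
                - n delta_{m+n,0} delta^{ab} k^{[j]}(u) *)
Definition bracketF (a : 'I_3) (m : int) (b : 'I_3) (n : int) (u : P)
    (j : nat) : F :=
  \sum_(c < 3) emb (fabc a b c) *: gen K (symbI u c j (m + n))
  - (n%:~R * (m + n == 0)%:R * (a == b)%:R) *: gen K (symbK u j).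

Definition bracket_same (u : P) (a : 'I_3) (p : nat) (m : int)
    (b : 'I_3) (q : nat) (n : int) : F :=
  - (emb ((p`! * q`!)%:R / (p + q + 1)`!%:R) *: bracketF a m b n u (p + q + 1)).

End Brackets.

(* The Lie algebra with a single parameter, over C. *)
Definition bracket1 (g h : symb unit) : free_alg C (symb unit) :=
  match g, h with
  | (u, inl (a, p, m)), (_, inl (b, q, n)) =>
      bracket_same id u a p m b q n
  | _, _ => 0
  end.

Definition V1 : lmodType C := induced bracket1 (@nonneg_mode unit).

(* The two-parameter Lie algebra.  The ring C[(z-w)^-1] is {poly C}, with 'X
   standing for (z-w)^-1. *)
Definition ptz : bool := false.
Definition ptw : bool := true.

Local Notation A := {poly C}.
Local Notation F2 := (free_alg A (symb bool)).

(* [I^{a[p]}_m(z), I^{b[q]}_n(w)] *)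
Definition bracket_zw (a : 'I_3) (p : nat) (m : int)
    (b : 'I_3) (q : nat) (n : int) : F2 :=
  \sum_(j < p.+1)
     ((-1) ^+ (p + 1 - j) * ('C(p, j) * (p + q - j)`!)%:R * 'X^(p + q + 1 - j))
     *: bracketF polyC a m b n ptz j
  - \sum_(j < q.+1)
     ((-1) ^+ (p + 1) * ('C(q, j) * (p + q - j)`!)%:R * 'X^(p + q + 1 - j))
     *: bracketF polyC a m b n ptw j.

Definition bracket2 (g h : symb bool) : F2 :=
  match g, h with
  | (u, inl (a, p, m)), (v, inl (b, q, n)) =>
      if u == v then bracket_same polyC u a p m b q n
      else if u == ptz then bracket_zw a p m b q n
      else - bracket_zw b q n a p m
  | _, _ => 0
  end.

Definition V2 : lmodType A := induced bracket2 (@nonneg_mode bool).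

Definition st (f : F2) : V2 := state bracket2 (@nonneg_mode bool) f.
Definition vac2 : V2 := vac bracket2 (@nonneg_mode bool).
Definition act2 (f : F2) (v : V2) : V2 := act f v.

Definition opI (u : bool) (a : 'I_3) (p : nat) (n : int) : F2 :=
  gen A (symbI u a p n).
Definition opK (u : bool) (p : nat) : F2 := gen A (symbK u p).

(* The derivations below and the map [taylor] preserve the relations of V2
   (resp. map them to relations of V1), so the choice of the representative
   [rep v] of v does not matter. *)

(* [T, g] for a generator g *)
Definition T_gen (g : symb bool) : F2 :=
  match g with
  | (u, inl (a, p, n)) => - n%:~R *: opI u a p (n - 1)
  | (_, inr _) => 0
  end.

Definition T2 (v : V2) : V2 := st (derivation (fun _ => 0) T_gen (rep v)).

(* d/du on C[(z-w)^-1]: (z-w)^-1 is mapped to -(z-w)^-2 if u = z, and to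
   (z-w)^-2 if u = w *)
Definition partial_scal (u : bool) (c : A) : A :=
  (if u == ptz then -1 else 1) * 'X^2 * c^`().

Definition partial_gen (u : bool) (g : symb bool) : F2 :=
  if g.1 == u then gen A (shift 1 g) else 0.

Definition partial (u : bool) (v : V2) : V2 :=
  st (derivation (partial_scal u) (partial_gen u) (rep v)).

(* D^{(j)}_u *)
Definition Dtw (u : bool) (j : nat) (v : V2) : V2 :=
  partial u v - (j%:R / 2%:R : C)%:P *: act2 (opK u 0) v.

(* The conditions determining the state-field map of V2: they express Y on
   every iterated product of modes of the generators applied to the vacuum. *)
Record is_state_field_map (Y : V2 -> int -> V2 -> V2) : Prop :=
    IsStateFieldMap {
  sf_vertex_algebra : is_vertex_algebra vac2 T2 Y;
  sf_gen : forall u a p n v,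
    Y (st (opI u a p (-1))) n v = act2 (opI u a p n) v;
  sf_central : forall u p X n v,
    Y (act2 (opK u p) X) n v = act2 (opK u p) (Y X n v);
  sf_derivative : forall X n v, Y (T2 X) n v = - n%:~R *: Y X (n - 1) v;
  sf_normal_ordered : forall X X' n v,
    is_normal_ordered Y X X' n v (Y (Y X (-1) X') n v)
}.

(* The homomorphism to Laurent series in t = w - z with coefficients in the
   one-parameter algebra.  [taylor_word s n] is the coefficient of t^n in the
   image of the product of the generators in s. *)
Local Notation F1 := (free_alg C (symb unit)).

Fixpoint taylor_word (s : seq (symb bool)) (n : nat) : F1 :=
  if s is g :: s' then
    if g.1 == ptz then gen C (symb_pt tt g) * taylor_word s' n
    else \sum_(r < n.+1)
      (r`!%:R^-1 : C) *: (gen C (shift r (symb_pt tt g)) * taylor_word s' (n - r))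
  else (n == 0)%:R.

(* coefficient of t^n for arbitrary n; recall (z-w)^-1 = - t^-1 *)
Definition taylor (f : F2) (n : int) : F1 :=
  \sum_(m <- msupp f) \sum_(k < size f@_m)
    ((-1) ^+ k * (f@_m)`_k) *:
      (if n + k%:Z is Posz l then taylor_word m l else 0).

Definition laurent (v : V2) (n : int) : V1 :=
  state bracket1 (@nonneg_mode unit) (taylor (rep v) n).

Definition regular_mod_translates (v : V2) : Prop :=
  exists Z : V2, forall n : int, n < 0 -> laurent (v - T2 Z) n = 0.

Definition sigma1 (u : bool) : V2 :=
  st (\sum_(a < 3) opI u a 0 (-1) * opI u a 0 (-1)).

Definition sigma3 (u : bool) : V2 :=
  st (\sum_(a < 3) \sum_(b < 3) \sum_(c < 3) \sum_(d < 3)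
        (delta_sym a b c d)%:P *:
          (opI u a 0 (-1) * opI u b 0 (-1) * opI u c 0 (-1) * opI u d 0 (-1))
    + (20%:R / 3%:R : C)%:P *: (\sum_(a < 3) \sum_(b < 3) \sum_(c < 3)
        (fabc a b c)%:P *: (opI u a 0 (-2) * opI u b 1 (-1) * opI u c 0 (-1)))
    + (40%:R / 9%:R : C)%:P *: (\sum_(a < 3) opI u a 0 (-3) * opI u a 2 (-1))
    - (20%:R / 3%:R : C)%:P *: (\sum_(a < 3) opI u a 2 (-2) * opI u a 0 (-2))
    + (40%:R / 9%:R : C)%:P *: (\sum_(a < 3) opI u a 1 (-3) * opI u a 1 (-1))
    - (10%:R / 3%:R : C)%:P *: (\sum_(a < 3) opI u a 1 (-2) * opI u a 1 (-2))
    - (20%:R / 3%:R : C)%:P *: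
        (\sum_(a < 3) opI u a 0 (-3) * opI u a 0 (-1) * opK u 1)).

End Gaudin.

(* Main.v *)
From Stdlib Require Import ZArith.
From HB Require Import structures.
Require Import Defs.
From mathcomp Require Import all_boot all_order all_algebra.
From mathcomp Require Import finmap monalg complex boolp reals.
From mathcomp Require Import ring zify ssrZ.

Set Implicit Arguments.
Unset Strict Implicit.
Unset Printing Implicit Defensive.

Import Order.TTheory GRing.Theory Num.Theory.
Local Open Scope ring_scope.

(** The states A_{i,j} exist because a finite computation finds them.  Conformal
weight and sl_2-invariance leave a finite-dimensional space of candidates for
A_{i,j} in V_(z,w), the equations modulo translates and the regularity condition
are linear in the candidate, and this linear system has a solution: it is given
by the lists [terms11], [terms13] and [terms33], with A_{3,1} obtained from
A_{1,3} by exchanging z and w.  What remains to be proved is that these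
candidates satisfy the equations and are regular, and both facts are reduced to
the evaluation of a program on integers.

Let s = i sqrt 2, so that s^2 = -2.  In terms of the generators
J^{a(p)}_m = I^{a[p]}_m / (s p!) and K^{(p)} = k^{[p]} / (s^2 p!) all brackets
have integral coefficients, twisted derivatives become
D^{(j)} = d + j K^{(0)}, and up to a rational factor the states sigma_1 and
sigma_3 have integral coefficients ([sigma1E], [sigma3E]).  States are stored as
tries of words in these generators, with coefficients in Z[x],
x = (z-w)^{-1}.  Left multiplication [lmul] straightens words by means of the
brackets; its soundness [peval_lmul] uses only that the generators act by
operators satisfying the bracket relations.  No linear independence of ordered
monomials is involved: every identity is certified by the program returning the
zero trie, whose value is zero in any module.

The modes of a state of the form g_1 ... g_n |0> are computed by recursion on n,
from the formula for normally ordered products ([mode_trie], [mode_trieE]).  The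
sums in that formula are infinite; they are cut off by a grading argument
([weight_le]).

An identity modulo the image of T is checked without deciding membership in that
image: a preimage B is produced by a division procedure about which nothing is
proved, and T B is compared with the expected value ([certified]).

For the regularity, the map to Laurent series in t = w - z must be understood on
states.  It is given on words in the free algebra, by the substitution of Taylor
series for the generators at w.  That it kills the relations of V_(z,w)
([expand_relations]) amounts to the compatibility of Taylor series with the
brackets ([taylor_bracket]): between two generators at w this is a convolution
identity for binomial coefficients ([bin_convolution]), between a generator at z
and one at w it is the alternating identity [alternating_bin].  Then the singular
coefficients of the expansion of a trie can be computed recursively
([laurent_tail]), and they turn out to be translates T b_n.  If b_n is such a
preimage at t^{-n}, then the sum Z of the (-x)^n b_n(z) satisfies the definition
of regularity modulo translates. *)

(** * Free algebras and their derivations *)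

Section LinearMaps.
Variables (K : pzRingType) (V W : lmodType K) (f : V -> W).
Hypothesis f_linear : forall c u v, f (c *: u + v) = c *: f u + f v.

Lemma linear_add u v : f (u + v) = f u + f v.
Proof. by rewrite -[u in LHS]scale1r f_linear scale1r. Qed.

Lemma linear_zero : f 0 = 0.
Proof. by apply: (addrI (f 0)); rewrite -linear_add !addr0. Qed.

Lemma linear_scale c u : f (c *: u) = c *: f u.
Proof. by rewrite -[c *: u in LHS]addr0 f_linear linear_zero addr0. Qed.

End LinearMaps.

Section MonoidAlgebra.
Variables (K : comNzRingType) (G : monomType).
Local Notation M := {malg K[G]}.

Lemma malgU_scale (a : K) (m : G) : (<< a *g m >> : M) = a *: << m >>.
Proof. by apply/malgP => n; rewrite mcoeffZ !mcoeffU mulrnAr mulr1. Qed.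

Lemma malgU_mul (m n : G) : (<< m >> : M) * << n >> = << mmul m n >>.
Proof. by rewrite malgM_def fgmulUU mulr1. Qed.

Lemma malgZr (c : K) (f g : M) : f * (c *: g) = c *: (f * g).
Proof.
rewrite [f]monalgE [g]monalgE scaler_sumr !mulr_suml scaler_sumr.
apply: eq_bigr => k _; rewrite !mulr_sumr scaler_sumr; apply: eq_bigr => l _.
have E a m : c *: (<< a *g m >> : M) = << c * a *g m >>.
  by apply/malgP => n; rewrite mcoeffZ !mcoeffU mulrnAr.
by rewrite !E !malgM_def !fgmulUU E mulrCA.
Qed.

Lemma malg_sum (f : M) : f = \sum_(m <- msupp f) f@_m *: << m >>.
Proof. by rewrite {1}[f]monalgE; apply: eq_bigr => m _; exact: malgU_scale. Qed.

End MonoidAlgebra.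

Lemma scale_addACA (K : nzRingType) (V : lmodType K) (a b c d : K) (u v : V) :
  (a + b) *: u + (c + d) *: v = (a *: u + c *: v) + (b *: u + d *: v).
Proof. by rewrite !scalerDl addrACA. Qed.

Section AbstractLeibniz.
Variables (K : comNzRingType) (F : lalgType K) (D : F -> F) (delta : K -> K).
Hypothesis scaler_mulr : forall (c : K) (f g : F), f * (c *: g) = c *: (f * g).
Hypothesis DD : {morph D : f g / f + g}.

Lemma leibniz_scale_span (I : Type) (mon : I -> F) :
  (forall a b, delta (a * b) = delta a * b + a * delta b) ->
  (forall P : F -> Prop, (forall f g, P f -> P g -> P (f + g)) ->
     (forall c f, P f -> P (c *: f)) -> (forall m, P (mon m)) ->
     forall f, P f) ->
  (forall c m, D (c *: mon m) = delta c *: mon m + c *: D (mon m)) ->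
  forall c f, D (c *: f) = delta c *: f + c *: D f.
Proof.
move=> deltaM ind Dmon c f; elim/ind: f c => [f1 f2 E1 E2|c1 f E|//] c.
- by rewrite scalerDr !DD E1 E2 !scalerDr addrACA.
- by rewrite scalerA !E deltaM scalerDl scalerDr !scalerA addrA.
Qed.

Hypothesis DZ : forall c f, D (c *: f) = delta c *: f + c *: D f.

Lemma leibniz_span (I : Type) (mon : I -> F) (a b : F) :
  (forall P : F -> Prop, (forall f g, P f -> P g -> P (f + g)) ->
     (forall c f, P f -> P (c *: f)) -> (forall m, P (mon m)) ->
     forall f, P f) ->
  (forall m, D (a * mon m) = b * mon m + a * D (mon m)) ->
  forall f, D (a * f) = b * f + a * D f.
Proof.
move=> ind Dmon f; elim/ind: f => [f1 f2 E1 E2|c f E|//].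
- by rewrite mulrDr !DD E1 E2 !mulrDr addrACA.
- by rewrite scaler_mulr !DZ E mulrDr !scaler_mulr scalerDr addrCA.
Qed.

Lemma leibniz_ind (G : Type) (gen d : G -> F) :
  D 1 = 0 -> (forall g f, D (gen g * f) = d g * f + gen g * D f) ->
  (forall P : F -> Prop, P 1 -> (forall f g, P f -> P g -> P (f + g)) ->
     (forall c f, P f -> P (c *: f)) -> (forall g f, P f -> P (gen g * f)) ->
     forall f, P f) ->
  forall f g, D (f * g) = D f * g + f * D g.
Proof.
move=> D1 Dgen ind f g; elim/ind: f => [|f1 f2 E1 E2|c f E|h f E].
- by rewrite !mul1r D1 mul0r add0r.
- by rewrite mulrDl !DD E1 E2 !mulrDl addrACA.
- by rewrite -scalerAl !DZ E mulrDl -!scalerAl scalerDr addrA.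
- by rewrite -mulrA !Dgen E mulrDr mulrDl !mulrA addrA.
Qed.

End AbstractLeibniz.

Section FreeAlgebraTheory.
Variables (K : comNzRingType) (G : choiceType).
Local Notation F := (free_alg K G).

Lemma free_algZr (c : K) (f g : F) : f * (c *: g) = c *: (f * g).
Proof. exact: malgZr. Qed.

Lemma gen_monomial (g : G) (m : {fmonom G}) :
  gen K g * (<< m >> : F) = << FMonom (g :: m) >>.
Proof.
suff -> : FMonom (g :: m) = mmul (fmu g) m by exact: malgU_mul.
by apply/eqP; rewrite fmP fmM fmU.
Qed.

Lemma free_alg_span (P : F -> Prop) :
  (forall f g, P f -> P g -> P (f + g)) -> (forall c f, P f -> P (c *: f)) ->
  (forall m : {fmonom G}, P << m >>) -> forall f, P f.
Proof.
move=> PD PZ Pm f; have P0 : P 0 by rewrite -(scale0r (<< mone >> : F)); exact: PZ.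
by rewrite [f]malg_sum; elim/big_ind: _ => // m _; exact: PZ.
Qed.

(** Every element is reached from 1 by sums, scalings and left multiplications by
generators, which is the form in which operators on modules are computed. *)
Lemma free_alg_ind (P : F -> Prop) :
  P 1 -> (forall f g, P f -> P g -> P (f + g)) ->
  (forall c f, P f -> P (c *: f)) -> (forall g f, P f -> P (gen K g * f)) ->
  forall f, P f.
Proof.
move=> P1 PD PZ PM; apply: free_alg_span => // m; rewrite -(fmK m).
have Pw (s : seq G) : P << FMonom s >>.
  elim: s => [|g s IH].
    by have <- : (1 : F) = << FMonom [::] >> by rewrite -fmoneE.
  by rewrite -[FMonom (g :: s)]/(FMonom (g :: FMonom s)) -gen_monomial; exact: PM.
exact: Pw.
Qed.

Lemma prod_gen (s : seq G) : \prod_(h <- s) gen K h = << FMonom s >> :> F.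
Proof.
elim: s => [|g s IH]; first by rewrite big_nil -fmoneE.
by rewrite big_cons IH gen_monomial.
Qed.

Section Derivation.
Variables (delta : K -> K) (d : G -> F).
Hypothesis deltaD : {morph delta : a b / a + b}.
Hypothesis deltaM : forall a b, delta (a * b) = delta a * b + a * delta b.
Local Notation D := (derivation delta d).

Let delta0 : delta 0 = 0.
Proof. by apply: (addrI (delta 0)); rewrite -deltaD !addr0. Qed.
Let delta1 : delta 1 = 0.
Proof. by apply: (addrI (delta 1)); rewrite addr0 -{3}(mulr1 1) deltaM mulr1 mul1r. Qed.

Let derivationEw (s : {fset {fmonom G}}) (f : F) : (msupp f `<=` s)%fset ->
  D f = \sum_(m <- s) (delta f@_m *: << m >> + f@_m *: leibniz d m).
Proof.
move=> le; rewrite /derivation; apply: big_fset_incl => //= m _ nm.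
by rewrite (mcoeff_outdom nm) delta0 !scale0r addr0.
Qed.

Lemma derivationD : {morph D : f g / f + g}.
Proof.
move=> f g; pose s := (msupp f `|` msupp g)%fset.
rewrite (@derivationEw s (f + g)) ?msuppD_le // (@derivationEw s f) ?fsubsetUl //.
rewrite (@derivationEw s g) ?fsubsetUr // -big_split /=; apply: eq_bigr => m _.
have -> : (f + g)@_m = f@_m + g@_m by exact: mcoeffD.
by rewrite deltaD; exact: scale_addACA.
Qed.

Let derivation0 : D 0 = 0.
Proof. by apply: (addrI (D 0)); rewrite -derivationD !addr0. Qed.

Lemma derivationN f : D (- f) = - D f.
Proof. by apply: (addrI (D f)); rewrite -derivationD !subrr derivation0. Qed.

Let derivationU c (m : {fmonom G}) :
  D (c *: << m >>) = delta c *: << m >> + c *: leibniz d m.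
Proof.
rewrite -[c *: _]malgU_scale (@derivationEw [fset m]%fset) ?msuppU_le //.
by rewrite big_seq_fset1 !mcoeffUU.
Qed.

Let derivation_monomial (m : {fmonom G}) : D << m >> = leibniz d m.
Proof. by have := derivationU 1 m; rewrite !scale1r delta1 scale0r add0r. Qed.

Lemma derivationZ c f : D (c *: f) = delta c *: f + c *: D f.
Proof.
apply: (leibniz_scale_span derivationD deltaM free_alg_span) => {}c m.
by rewrite derivation_monomial; exact: derivationU.
Qed.

Lemma derivation1 : D 1 = 0.
Proof.
by rewrite -[1]/(<< mone >> : F) derivation_monomial fm1.
Qed.

Lemma derivation_genM g f : D (gen K g * f) = d g * f + gen K g * D f.
Proof.
apply: (leibniz_span free_algZr derivationD derivationZ free_alg_span).
by move=> m; rewrite gen_monomial !derivation_monomial /= prod_gen fmK.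
Qed.

Lemma derivation_gen g : D (gen K g) = d g.
Proof. by rewrite -[gen K g]mulr1 derivation_genM derivation1 mulr0 addr0 mulr1. Qed.

Lemma derivationM f g : D (f * g) = D f * g + f * D g.
Proof.
exact: (leibniz_ind derivationD derivationZ derivation1 derivation_genM free_alg_ind).
Qed.

End Derivation.
End FreeAlgebraTheory.

(** * The action on an induced module *)

(** The image of a defining relation of the induced module under a derivation is a
combination of three such relations when the derivation respects the bracket. *)
Lemma leibniz_commutator (K : comNzRingType) (L : lalgType K) (D : L -> L)
    (b c : K) (x y z x' y' z1 z2 w : L) :
  (forall (c : K) (f g : L), f * (c *: g) = c *: (f * g)) ->
  {morph D : f g / f + g} -> (forall f g, D (f * g) = D f * g + f * D g) ->
  D x = b *: x' -> D y = c *: y' -> D z = b *: z1 + c *: z2 ->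
  D ((x * y - y * x - z) * w) =
  b *: ((x' * y - y * x' - z1) * w) + c *: ((x * y' - y' * x - z2) * w)
  + (x * y - y * x - z) * D w.
Proof.
move=> Zr DD DM Dx Dy Dz.
have DN f : D (- f) = - D f.
  have D0 : D 0 = 0 by apply: (addrI (D 0)); rewrite -DD !addr0.
  by apply: (addrI (D f)); rewrite -DD !subrr.
rewrite DM !DD !DN !DM Dx Dy Dz; congr (_ + _).
rewrite !scalerAl -mulrDl; congr (_ * _).
rewrite !Zr -!scalerAl !scalerBr !opprD !addrA.
by rewrite [LHS](ACl (1*4*5*2*3*6)).
Qed.

Section InducedModuleTheory.
Variables (K : comNzRingType) (G : choiceType).
Local Notation F := (free_alg K G).
Variables (br : G -> G -> F) (pos : pred G).
Local Notation V := (induced br pos).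
Local Notation rel := (relations br pos).
Local Notation stt := (state br pos).

Lemma state_scaleE (c : K) (f : F) : stt (c *: f) = c *: stt f.
Proof. by rewrite -state_scale. Qed.

Lemma act_linear f : linear (@act K G br pos f).
Proof.
move=> c u v.
have E : c *: u + v = stt (c *: rep u + rep v).
  by rewrite stateD state_scaleE (repK u) (repK v).
apply: etrans (congr1 (act f) E) _.
by rewrite actE mulrDr free_algZr stateD state_scaleE.
Qed.

Lemma actZr c f (v : V) : act f (c *: v) = c *: act f v.
Proof. exact: (linear_scale (act_linear f)). Qed.

Lemma actD f g (v : V) : act (f + g) v = act f v + act g v.
Proof. by rewrite -(repK v) !actE mulrDl stateD. Qed.

Lemma actZ (c : K) f (v : V) : act (c *: f) v = c *: act f v.
Proof. by rewrite -(repK v) !actE -scalerAl state_scaleE. Qed.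

Lemma act0 (v : V) : act 0 v = 0.
Proof. by apply: (addrI (act 0 v)); rewrite -actD !addr0. Qed.

Lemma act_sum (I : Type) (r : seq I) (P : pred I) (f : I -> F) (v : V) :
  act (\sum_(i <- r | P i) f i) v = \sum_(i <- r | P i) act (f i) v.
Proof. exact: (big_morph (@act K G br pos ^~ v) (fun f g => actD f g v) (act0 v)). Qed.

Lemma act_state f : act f (vac br pos) = stt f.
Proof. by rewrite actE mulr1. Qed.

Lemma state0 f : rel f -> stt f = 0.
Proof.
move=> rf; have -> : 0 = stt 0.
  by rewrite -(scale0r (1 : F)) state_scaleE scale0r.
by apply/state_eq; rewrite subr0.
Qed.

(** The defining relations of the induced module are imposed on all of U(L), hence
on every state. *)
Lemma act_bracket g h (v : V) :
  act (gen K g) (act (gen K h) v) =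
  act (gen K h) (act (gen K g) v) + act (br g h) v.
Proof.
have E k l : act (gen K k) (act (gen K l) v) = stt (gen K k * (gen K l * rep v)).
  exact: actE.
rewrite !E -[act (br g h) v]/(stt (br g h * rep v)) -stateD; apply/state_eq.
have -> : gen K g * (gen K h * rep v) - (gen K h * (gen K g * rep v) + br g h * rep v)
    = (gen K g * gen K h - gen K h * gen K g - br g h) * rep v.
  by rewrite !mulrBl !mulrA opprD addrA.
exact: relations_br.
Qed.

Lemma act_pos g : pos g -> act (gen K g) (vac br pos) = 0.
Proof. by move=> pg; rewrite act_state; apply: state0; exact: relations_pos. Qed.

(** The derivation [gen g |-> a g *: gen (sh g)] descends to the induced module
as soon as it is a derivation of the bracket. *)
Section DerivationDescends.
Variables (delta : K -> K) (d : G -> F) (a : G -> K) (sh : G -> G).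
Hypothesis deltaD : {morph delta : x y / x + y}.
Hypothesis deltaM : forall x y, delta (x * y) = delta x * y + x * delta y.
Hypothesis dE : forall g, d g = a g *: gen K (sh g).
Hypothesis d_br : forall g h,
  derivation delta d (br g h) = a g *: br (sh g) h + a h *: br g (sh h).
Hypothesis d_pos : forall g, pos g -> a g != 0 -> pos (sh g).
Local Notation D := (derivation delta d).

Lemma derivation_relations f : rel f -> rel (D f).
Proof.
elim=> [|x y _ rx _ ry|x y ry rDy|g h y|g pg].
- have -> : D 0 = 0.
    by apply: (addrI (D 0)); rewrite -(derivationD _ deltaD) !addr0.
  exact: relations0.
- by rewrite derivationD //; exact: relationsD.
- rewrite derivationM //; apply: relationsD; exact: relationsM.
- have Dgen k : D (gen K k) = a k *: gen K (sh k) by rewrite derivation_gen.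
  rewrite (leibniz_commutator _ (@free_algZr K G) (derivationD _ deltaD)
    (derivationM _ deltaD deltaM) (Dgen g) (Dgen h) (d_br g h)).
  by apply: relationsD; [apply: relationsD; apply: relationsZ|]; exact: relations_br.
have -> : D (gen K g) = a g *: gen K (sh g) by rewrite derivation_gen.
have [->|ag] := eqVneq (a g) 0.
  by rewrite scale0r; exact: relations0.
by apply: relationsZ; apply: relations_pos; exact: d_pos.
Qed.

Lemma state_derivation_rep f : stt (D (rep (stt f))) = stt (D f).
Proof.
apply/state_eq; rewrite -derivationN // -derivationD //.
by apply: derivation_relations; apply/state_eq; rewrite repK.
Qed.

Definition derive_state (v : V) : V := stt (D (rep v)).

Lemma derive_stateE f : derive_state (stt f) = stt (D f).
Proof. exact: state_derivation_rep. Qed.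

Lemma derive_stateD u v : derive_state (u + v) = derive_state u + derive_state v.
Proof.
rewrite -(repK u) -(repK v) -stateD !derive_stateE -stateD; congr (stt _).
exact: derivationD.
Qed.

Lemma derive_stateZ c v :
  derive_state (c *: v) = delta c *: v + c *: derive_state v.
Proof.
rewrite -{1 2}(repK v) -!state_scaleE derive_stateE -stateD; congr (stt _).
exact: derivationZ.
Qed.

Lemma derive_state_gen g v : derive_state (act (gen K g) v) =
  act (gen K g) (derive_state v) + a g *: act (gen K (sh g)) v.
Proof.
have E1 : derive_state (act (gen K g) v) = stt (d g * rep v + gen K g * D (rep v)).
  apply: etrans (derive_stateE (gen K g * rep v)) _; congr (stt _).
  exact: derivation_genM.
have E2 : stt (d g * rep v) = a g *: act (gen K (sh g)) v.
  by rewrite dE -scalerAl state_scaleE.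
have E3 : stt (gen K g * D (rep v)) = act (gen K g) (derive_state v).
  by rewrite /derive_state actE.
apply: etrans E1 _; apply: etrans (stateD _ _ (d g * rep v) _) _.
by apply: etrans (congr2 +%R E2 E3) _; exact: addrC.
Qed.

Lemma derive_state_vac : derive_state (vac br pos) = 0.
Proof.
rewrite /vac derive_stateE derivation1 //.
by apply: state0; exact: relations0.
Qed.

End DerivationDescends.
End InducedModuleTheory.

(** * Tries of words and their straightening *)

(** A copy of 'I_3 without proofs inside, so that programs on letters reduce fast. *)
Variant axis := Ax1 | Ax2 | Ax3.

(** [Cur u m p a] is J^{a(p)}_m(u) and [Cen u p] is K^{(p)}(u), where u is false
for z and true for w. *)
Variant letter :=
| Cur of bool & Z & nat & axis
| Cen of bool & nat.

Section Engine.
Local Open Scope Z_scope.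

Definition axis_code a : positive :=
  match a with Ax1 => 1 | Ax2 => 2 | Ax3 => 3 end.

Definition cmp_bool (a b : bool) :=
  match a, b with false, true => Lt | true, false => Gt | _, _ => Eq end.

Definition cmp_then (c d : comparison) := if c is Eq then d else c.

(** Currents with a negative mode come before those with a nonnegative mode, so
that in an ordered word the operators killing the vacuum stand on the right. *)
Definition cmp (g h : letter) : comparison :=
  match g, h with
  | Cur u m p a, Cur v n q b =>
      cmp_then (cmp_bool (0 <=? m) (0 <=? n)) (cmp_then (cmp_bool u v)
        (cmp_then (m ?= n) (cmp_then (Nat.compare p q)
          (Pos.compare (axis_code a) (axis_code b)))))
  | Cur _ _ _ _, Cen _ _ => Lt
  | Cen _ _, Cur _ _ _ _ => Gt
  | Cen u p, Cen v q => cmp_then (cmp_bool u v) (Nat.compare p q)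
  end.

(** A polynomial in letters in Horner form: [Node h t r] is h t + r, and a leaf is
the list of coefficients of the powers of x = (z-w)^{-1}.  Words with a common
prefix share it. *)
Inductive trie := Leaf of seq Z | Node of letter & trie & trie.

Definition pzero := Leaf [::].
Definition pone := Leaf [:: 1].
Definition is_pzero t := if t is Leaf [::] then true else false.

Fixpoint coef_add (s t : seq Z) : seq Z :=
  match s, t with
  | [::], _ => t
  | _, [::] => s
  | a :: s', b :: t' =>
      match a + b, coef_add s' t' with
      | 0, [::] => [::]
      | c, r => c :: r
      end
  end.

Definition coef_scale (c : Z) (e : nat) (s : seq Z) : seq Z :=
  if s is [::] then [::] else ncons e 0 [seq c * z | z <- s].

Definition node h t r := if is_pzero t then r else Node h t r.

Fixpoint padd (t : trie) : trie -> trie :=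
  match t with
  | Leaf c =>
      fix padd_leaf s :=
        match s with
        | Leaf d => Leaf (coef_add c d)
        | Node k s1 s2 => Node k s1 (padd_leaf s2)
        end
  | Node h t1 t2 =>
      fix padd_node s :=
        match s with
        | Leaf _ => Node h t1 (padd t2 s)
        | Node k s1 s2 =>
            match cmp h k with
            | Eq => node h (padd t1 s1) (padd t2 s2)
            | Lt => Node h t1 (padd t2 s)
            | Gt => Node k s1 (padd_node s2)
            end
        end
  end.

Fixpoint pmap (f : seq Z -> seq Z) t :=
  match t with
  | Leaf c => Leaf (f c)
  | Node h t1 t2 => Node h (pmap f t1) (pmap f t2)
  end.

Definition pscale (c : Z) (e : nat) t :=
  match c, e with 1, 0%N => t | _, _ => pmap (coef_scale c e) t end.

Definition psum (ts : seq trie) := foldr padd pzero ts.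

Section LeftMultiplication.
Variables (br : letter -> letter -> seq (Z * nat * letter)).
Variable kill : letter -> bool.

(** Straightening of g t: a letter is moved to the right past larger ones at the
cost of the bracket terms, and is dropped when it reaches the leaf and kills the
vacuum.  When the fuel is exhausted the word is left unsorted, which does not
change its value. *)
Fixpoint lmul (fuel : nat) (g : letter) (t : trie) : trie :=
  if fuel is fuel'.+1 then
    match t with
    | Leaf [::] => t
    | Leaf _ => if kill g then pzero else Node g t pzero
    | Node h t1 t2 =>
        if (if kill g then false else if cmp g h is Gt then false else true)
        then Node g t pzero
        else
          foldr (fun x => padd (pscale x.1.1 x.1.2 (lmul fuel' x.2 t1)))
            (padd (lmul fuel' h (lmul fuel' g t1)) (lmul fuel' g t2)) (br g h)
    end
  else Node g t pzero.

End LeftMultiplication.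

Fixpoint papply (mul : letter -> trie -> trie) o t : trie :=
  match o with
  | Leaf c =>
      (fix go i c := if c is z :: c' then padd (pscale z i t) (go i.+1 c')
                     else pzero) 0%N c
  | Node h o1 o2 => padd (mul h (papply mul o1 t)) (papply mul o2 t)
  end.

Definition pword (mul : letter -> trie -> trie) (w : seq letter) t :=
  foldr mul t w.

(** The derivation acting by [dcoef] on coefficients and by [dlet] on letters. *)
Fixpoint pderiv (mul : letter -> trie -> trie) (dcoef : seq Z -> seq Z)
    (dlet : letter -> option (Z * letter)) t :=
  match t with
  | Leaf c => Leaf (dcoef c)
  | Node g t1 t2 =>
      padd (padd (mul g (pderiv mul dcoef dlet t1))
              (if dlet g is Some (c, h) then pscale c 0 (mul h t1) else pzero))
        (pderiv mul dcoef dlet t2)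
  end.

End Engine.

Lemma cmp_eq g h : cmp g h = Eq -> g = h.
Proof.
case: g h => [u m p a|u p] [v n q b|v q] //=.
  case: (Z.leb 0 m) (Z.leb 0 n) => [] [] //=; case: u v => [] [] //=;
  case: (Z.compare_spec m n) => //= ->;
  case: (PeanoNat.Nat.compare_spec p q) => //= ->;
  by case: a b => [] [].
by case: u v => [] [] //=; case: (PeanoNat.Nat.compare_spec p q) => //= ->.
Qed.

Section Semantics.
Variables (K : comNzRingType) (V : lmodType K) (x : K) (op : letter -> V -> V).
Hypothesis op_linear : forall g c u v, op g (c *: u + v) = c *: op g u + op g v.

Definition zval (z : Z) : K := (int_of_Z z)%:~R.

Lemma zval0 : zval Z0 = 0. Proof. by []. Qed.
Lemma zval1 : zval (Zpos xH) = 1. Proof. by []. Qed.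
Lemma zvalD a b : zval (Z.add a b) = zval a + zval b.
Proof. by rewrite /zval -[Z.add a b]/(a + b)%R rmorphD rmorphD. Qed.
Lemma zvalM a b : zval (Z.mul a b) = zval a * zval b.
Proof. by rewrite /zval -[Z.mul a b]/(a * b)%R rmorphM rmorphM. Qed.
Lemma zvalN a : zval (Z.opp a) = - zval a.
Proof. by rewrite /zval -[Z.opp a]/(- a)%R rmorphN rmorphN. Qed.
Lemma zval_nat n : zval (Z.of_nat n) = n%:R.
Proof.
rewrite /zval; have -> : int_of_Z (Z.of_nat n) = n by case: n => //= n; lia.
by rewrite -pmulrn.
Qed.

Fixpoint cval (s : seq Z) : K :=
  if s is z :: s' then zval z + x * cval s' else 0.

Fixpoint peval (v : V) (t : trie) : V :=
  match t with
  | Leaf c => cval c *: v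
  | Node h t1 t2 => op h (peval v t1) + peval v t2
  end.

Definition combo (l : seq (Z * nat * letter)) (v : V) : V :=
  \sum_(t <- l) (zval t.1.1 * x ^+ t.1.2) *: op t.2 v.

Lemma opD g u v : op g (u + v) = op g u + op g v.
Proof. exact: (linear_add (op_linear g)). Qed.
Lemma op0 g : op g 0 = 0.
Proof. exact: (linear_zero (op_linear g)). Qed.
Lemma opZ g c u : op g (c *: u) = c *: op g u.
Proof. exact: (linear_scale (op_linear g)). Qed.
Lemma op_sum (I : Type) (r : seq I) (P : pred I) (F : I -> V) g :
  op g (\sum_(i <- r | P i) F i) = \sum_(i <- r | P i) op g (F i).
Proof. exact: (big_morph (op g) (opD g) (op0 g)). Qed.

Lemma cval_add s t : cval (coef_add s t) = cval s + cval t.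
Proof.
elim: s t => [|a s IH] [|b t] /=; rewrite ?add0r ?addr0 //.
have -> : zval a + x * cval s + (zval b + x * cval t)
    = zval (Z.add a b) + x * cval (coef_add s t).
  by rewrite zvalD IH mulrDr addrACA.
by case: (Z.add a b) (coef_add s t) => [|p|p] [|c r] //=; rewrite mulr0 addr0.
Qed.

Lemma cval_ncons e s : cval (ncons e Z0 s) = x ^+ e * cval s.
Proof. by elim: e => [|e /= ->]; rewrite ?mul1r // zval0 add0r exprS mulrA. Qed.

Lemma cval_scale c e s : cval (coef_scale c e s) = zval c * x ^+ e * cval s.
Proof.
case: s => [|z s]; first by rewrite /= mulr0.
rewrite /coef_scale cval_ncons mulrAC [RHS]mulrC; congr (_ * _).
by elim: {z s}(z :: s) => [|z s IH] /=; rewrite ?mulr0 // zvalM IH mulrDr mulrCA.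
Qed.

Lemma peval_zero v t : is_pzero t -> peval v t = 0.
Proof. by case: t => // -[] //= _; rewrite scale0r. Qed.

Lemma peval_node v h t r : peval v (node h t r) = op h (peval v t) + peval v r.
Proof.
rewrite /node; case: ifP => // /(peval_zero v) ->.
by rewrite op0 add0r.
Qed.

Lemma peval_add v t s : peval v (padd t s) = peval v t + peval v s.
Proof.
elim: t s => [c|h t1 IH1 t2 IH2].
  elim=> [d|k s1 _ s2 IHs] /=; first by rewrite cval_add scalerDl.
  by rewrite IHs addrCA.
elim=> [d|k s1 _ s2 IHs]; first by rewrite /= IH2 addrA.
rewrite [padd _ _]/=; case E : (cmp h k).
- by rewrite peval_node IH1 IH2 opD /= (cmp_eq E) addrACA.
- by rewrite /= IH2 /= addrA.
- by rewrite /= in IHs *; rewrite IHs addrCA.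
Qed.

Lemma peval_scale v c e t :
  peval v (pscale c e t) = (zval c * x ^+ e) *: peval v t.
Proof.
have E : peval v (pmap (coef_scale c e) t) = (zval c * x ^+ e) *: peval v t.
  by elim: t => [d|h t1 IH1 t2 IH2] /=; rewrite ?cval_scale ?scalerA // IH1 IH2 opZ scalerDr.
by case: c e E => [|[p|p|]|p] [|e] //= _; rewrite zval1 mul1r scale1r.
Qed.

Lemma peval_sum v ts : peval v (psum ts) = \sum_(t <- ts) peval v t.
Proof.
elim: ts => [|t ts IH]; first by rewrite big_nil /= scale0r.
by rewrite big_cons -IH /= peval_add.
Qed.

(** Both branches of the straightening preserve the value: the sorted one by
definition, the other by the commutation relation of the operators.  The fuel
enters only through the form of the result. *)
Lemma peval_lmul br (kill : letter -> bool) v fuel g t :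
  (forall g h u, op g (op h u) = op h (op g u) + combo (br g h) u) ->
  (forall g, kill g -> op g v = 0) ->
  peval v (lmul br kill fuel g t) = op g (peval v t).
Proof.
move=> opC op_kill.
have base h s : peval v (Node h s pzero) = op h (peval v s).
  by rewrite /= scale0r addr0.
elim: fuel g t => [|fuel IH] g t; first exact: base.
case: t => [[|z c]|h t1 t2].
- by rewrite /= scale0r op0.
- rewrite [lmul _ _ _ _ _]/=; case: ifP => [kg|_]; last exact: base.
  by rewrite [LHS]scale0r [peval _ _]/= opZ op_kill // scaler0.
rewrite [lmul _ _ _ _ _]/=; case: ifP => _; first exact: base.
have -> b l : peval v (foldr (fun y => padd (pscale y.1.1 y.1.2
    (lmul br kill fuel y.2 t1))) b l) = combo l (peval v t1) + peval v b.
  elim: l => [|y l IHl] /=; first by rewrite /combo big_nil add0r.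
  by rewrite peval_add peval_scale IH IHl /combo big_cons addrA.
rewrite peval_add !IH /= opD (opC g h) addrA; congr (_ + _).
exact: addrC.
Qed.

Lemma peval_apply mul v o t :
  (forall g t, peval v (mul g t) = op g (peval v t)) ->
  peval v (papply mul o t) = peval (peval v t) o.
Proof.
move=> mulE; elim: o => [c|h o1 IH1 o2 IH2] /=; last first.
  by rewrite peval_add mulE IH1 IH2.
have E i : peval v ((fix go i c := if c is z :: c' then padd (pscale z i t) (go i.+1 c')
    else pzero) i c) = (x ^+ i * cval c) *: peval v t.
  elim: c i => [|z c IH] i /=; first by rewrite mulr0 !scale0r.
  by rewrite peval_add peval_scale IH -scalerDl mulrDr exprSr mulrA mulrC.
by rewrite E mul1r.
Qed.

Lemma peval_word mul v w t :
  (forall g t, peval v (mul g t) = op g (peval v t)) ->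
  peval v (pword mul w t) = foldr op (peval v t) w.
Proof. by move=> mulE; elim: w => //= g w IH; rewrite mulE IH. Qed.

(** A map which commutes with the letters up to the terms prescribed by [dlet] is
determined on tries by its values on multiples of v. *)
Lemma peval_deriv mul dcoef dlet v (D : V -> V) t :
  (forall g t, peval v (mul g t) = op g (peval v t)) ->
  {morph D : u w / u + w} ->
  (forall c, D (cval c *: v) = cval (dcoef c) *: v) ->
  (forall g u, D (op g u) =
     op g (D u) + (if dlet g is Some (c, h) then zval c *: op h u else 0)) ->
  peval v (pderiv mul dcoef dlet t) = D (peval v t).
Proof.
move=> mulE DD Dleaf Dop; elim: t => [c|g t1 IH1 t2 IH2]; first by rewrite /= Dleaf.
rewrite /= !peval_add mulE IH1 IH2 DD Dop; congr (_ + _ + _).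
case: (dlet g) => [[c h]|]; last by rewrite /= scale0r.
by rewrite peval_scale mulE mulr1.
Qed.

End Semantics.

(** * Integral brackets of the normalized generators *)

Section Brackets.
Local Open Scope Z_scope.

Definition cross a b : option (Z * axis) :=
  match a, b with
  | Ax1, Ax2 => Some (1, Ax3) | Ax2, Ax3 => Some (1, Ax1)
  | Ax3, Ax1 => Some (1, Ax2)
  | Ax2, Ax1 => Some (-1, Ax3) | Ax3, Ax2 => Some (-1, Ax1)
  | Ax1, Ax3 => Some (-1, Ax2)
  | _, _ => None
  end.

(** The normalized form of c x^e F^{(j)}(u), where F is the right-hand side of
the bracket of J^{a}_m and J^{b}_n. *)
Definition contraction c e a m b n u j : seq (Z * nat * letter) :=
  match cross a b with
  | Some (s, d) => [:: (c * s, e, Cur u (m + n) j d)]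
  | None => if (m + n =? 0) then [:: (- (c * n), e, Cen u j)] else [::]
  end.

Definition zsign k : Z := if odd k then -1 else 1.
Definition zbin n k : Z := Z.of_nat 'C(n, k).

(** The normalization turns the coefficient C(p,j) (p+q-j)! of the bracket into
C(p+q-j, q), and C(q,j) (p+q-j)! into C(p+q-j, p). *)
Definition bracket_across a p m b q n : seq (Z * nat * letter) :=
  flatten [seq contraction (zsign (p + 1 - j) * zbin (p + q - j) q)
                 (p + q + 1 - j) a m b n false j | j <- iota 0 p.+1]
  ++ flatten [seq contraction (zsign p * zbin (p + q - j) p)
                 (p + q + 1 - j) a m b n true j | j <- iota 0 q.+1].

Definition bracket_two (g h : letter) : seq (Z * nat * letter) :=
  match g, h with
  | Cur u m p a, Cur v n q b =>
      match u, v with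
      | false, true => bracket_across a p m b q n
      | true, false =>
          [seq (- t.1.1, t.1.2, t.2) | t <- bracket_across b q n a p m]
      | _, _ => contraction (-1) 0 a m b n u (p + q + 1)
      end
  | _, _ => [::]
  end.

(** The bracket after identification of the two points. *)
Definition bracket_one (g h : letter) : seq (Z * nat * letter) :=
  match g, h with
  | Cur u m p a, Cur _ n q b => contraction (-1) 0 a m b n u (p + q + 1)
  | _, _ => [::]
  end.

End Brackets.

Definition ord_axis a : 'I_3 :=
  match a with
  | Ax1 => @Ordinal 3 0 isT | Ax2 => @Ordinal 3 1 isT | Ax3 => @Ordinal 3 2 isT
  end.

Lemma sum_axis (V : nmodType) (f : 'I_3 -> V) :
  \sum_(a < 3) f a = f (ord_axis Ax1) + (f (ord_axis Ax2) + f (ord_axis Ax3)).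
Proof.
rewrite !big_ord_recl big_ord0 addr0.
by congr (f _ + (f _ + f _)); apply: val_inj.
Qed.

(** The element F^{[j]}(u) with an arbitrary map psi in place of the inclusion of
the generators: with psi the action on a fixed state it describes the action of
brackets, with psi the generators it is a bracket in the free algebra. *)
Definition bracketV (R : realType) (K : comNzRingType) (emb : R[i] -> K)
    (P : choiceType) (V : lmodType K) (psi : symb P -> V) a m b n u j : V :=
  \sum_(c < 3) emb (fabc R a b c) *: psi (symbI u c j (m + n))
  - (n%:~R * (m + n == 0)%:R * (a == b)%:R) *: psi (symbK u j).

Section NormalizedLetters.
Variable R : realType.
Local Notation C := R[i].

(** The constant s such that f^{abc} = s epsilon_{abc}. *)
Definition sl2_root : C := 'i * sqrtC 2%:R.

Lemma sl2_rootK : sl2_root * sl2_root = - 2%:R.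
Proof. by rewrite /sl2_root mulrACA -!expr2 sqrCi sqrtCK mulN1r. Qed.

Lemma sl2_root_neq0 : sl2_root != 0.
Proof. by rewrite mulf_neq0 ?neq0Ci // sqrtC_eq0 pnatr_eq0. Qed.

Lemma fact_neq0 n : n`!%:R != 0 :> C.
Proof. by rewrite pnatr_eq0 -lt0n fact_gt0. Qed.

(** The letter g stands for [lscal g] times the generator [lsym g]. *)
Definition lscal (g : letter) : C :=
  match g with
  | Cur _ _ p _ => (sl2_root * p`!%:R)^-1
  | Cen _ p => (sl2_root ^+ 2 * p`!%:R)^-1
  end.

Lemma lscal_neq0 g : lscal g != 0.
Proof. by case: g => *; rewrite invr_eq0 mulf_neq0 ?expf_neq0 ?sl2_root_neq0 ?fact_neq0. Qed.

Variables (K : comNzRingType) (emb : {rmorphism C -> K}).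
Variables (P : choiceType) (pt : bool -> P) (V : lmodType K) (x : K).
Variable psi : symb P -> V.

Definition lsym (g : letter) : symb P :=
  match g with
  | Cur u m p a => symbI (pt u) (ord_axis a) p (int_of_Z m)
  | Cen u p => symbK (pt u) p
  end.

Definition lval (g : letter) : V := emb (lscal g) *: psi (lsym g).

Local Notation bracketV := (bracketV emb psi).

(** F^{[j]} is s^2 j! times an integral combination of letters: f^{abc} and the
current contribute a factor s each, the central element contributes s^2. *)
Lemma contraction_val c e a m b n u j :
  \sum_(t <- contraction c e a m b n u j) (zval K t.1.1 * x ^+ t.1.2) *: lval t.2
  = (zval K c * x ^+ e * emb (sl2_root ^+ 2 * j`!%:R)^-1)
    *: bracketV (ord_axis a) (int_of_Z m) (ord_axis b) (int_of_Z n) (pt u) j.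
Proof.
have mnE : int_of_Z (Z.add m n) = int_of_Z m + int_of_Z n.
  by rewrite -[Z.add m n]/(m + n)%R rmorphD.
have mn0 : (Z.eqb (Z.add m n) Z0) = (int_of_Z m + int_of_Z n == 0).
  by rewrite -mnE; apply/idP/eqP; lia.
have fE k : sl2_root ^+ 2 * j`!%:R != 0.
  by rewrite mulf_neq0 ?expf_neq0 ?sl2_root_neq0 ?fact_neq0.
have off d (z : Z) : (zval K (Z.mul c z) * x ^+ e) *: lval (Cur u (Z.add m n) j d)
    = (zval K c * x ^+ e * emb (sl2_root ^+ 2 * j`!%:R)^-1) *:
      (emb (sl2_root * (int_of_Z z)%:~R)
         *: psi (symbI (pt u) (ord_axis d) j (int_of_Z m + int_of_Z n))).
  rewrite /lval /= mnE !scalerA; congr (_ *: _); rewrite -[RHS]mulrA -rmorphM.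
  have -> : (sl2_root ^+ 2 * j`!%:R)^-1 * (sl2_root * (int_of_Z z)%:~R)
      = (int_of_Z z)%:~R * (sl2_root * j`!%:R)^-1.
    by field; rewrite sl2_root_neq0 fact_neq0.
  by rewrite rmorphM rmorph_int zvalM -/(zval K z); ring.
have diag : \sum_(t <- (if Z.eqb (Z.add m n) Z0 then
      [:: ((Z.opp (Z.mul c n)), e, Cen u j)] else [::]))
      (zval K t.1.1 * x ^+ t.1.2) *: lval t.2
    = (zval K c * x ^+ e * emb (sl2_root ^+ 2 * j`!%:R)^-1) *:
      - (((int_of_Z n)%:~R * (int_of_Z m + int_of_Z n == 0)%:R * 1)
         *: psi (symbK (pt u) j)).
  rewrite mn0; case: (_ == 0); last by rewrite big_nil mulr0 mul0r scale0r oppr0 scaler0.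
  rewrite big_seq1 /lval /= scalerN -scaleNr !scalerA; congr (_ *: _).
  by rewrite zvalN zvalM -/(zval K n); ring.
case: a b => [] [];
  rewrite /contraction /= /bracketV sum_axis /fabc /levi_civita /= ?big_seq1 /=
     -/sl2_root ?mulr0 ?rmorph0 ?scale0r ?add0r ?addr0 ?subr0 ?sub0r.
all: first [exact: diag | exact: (off _ (Zpos xH)) | exact: (off _ (Zneg xH))].
Qed.
Lemma contraction_same_val u a p m b q n :
  \sum_(t <- contraction (Zneg xH) 0 a m b n u (p + q + 1))
     (zval K t.1.1 * x ^+ t.1.2) *: lval t.2
  = (emb (lscal (Cur u m p a)) * emb (lscal (Cur u n q b))) *:
    - (emb ((p`! * q`!)%:R / (p + q + 1)`!%:R) *:
       bracketV (ord_axis a) (int_of_Z m) (ord_axis b) (int_of_Z n) (pt u)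
         (p + q + 1)).
Proof.
rewrite contraction_val expr0 mulr1 scalerN scalerA -scaleNr -!rmorphM.
rewrite -[zval K _]/(-1) mulN1r; congr (- emb _ *: _).
by rewrite natrM /=; field; rewrite sl2_root_neq0 !fact_neq0.
Qed.

Lemma zval_sign k : zval K (zsign k) = (-1) ^+ k.
Proof. by rewrite -signr_odd /zsign; case: odd. Qed.

(** Both halves rest on C(p+q-j, q) p! q! = C(p,j) (p+q-j)! j!. *)
Lemma bracket_across_val a p m b q n :
  \sum_(t <- bracket_across a p m b q n)
     (zval K t.1.1 * x ^+ t.1.2) *: lval t.2
  = (emb (lscal (Cur false m p a)) * emb (lscal (Cur true n q b))) *:
    (\sum_(j < p.+1)
      ((-1) ^+ (p + 1 - j) * ('C(p, j) * (p + q - j)`!)%:R * x ^+ (p + q + 1 - j))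
        *: bracketV (ord_axis a) (int_of_Z m) (ord_axis b) (int_of_Z n) (pt false) j
    - \sum_(j < q.+1)
      ((-1) ^+ (p + 1) * ('C(q, j) * (p + q - j)`!)%:R * x ^+ (p + q + 1 - j))
        *: bracketV (ord_axis a) (int_of_Z m) (ord_axis b) (int_of_Z n) (pt true) j).
Proof.
(* the change of normalization of the coefficients, for both sums at once *)
have binE r t j : (j <= r)%N ->
    ('C(r + t - j, t))%:R * emb (sl2_root ^+ 2 * j`!%:R)^-1
    = emb (sl2_root * r`!%:R)^-1 * emb (sl2_root * t`!%:R)^-1
        * ('C(r, j) * (r + t - j)`!)%:R.
  move=> le_jr; rewrite -!(rmorph_nat emb) -!rmorphM; congr (emb _).
  have E : ('C(r + t - j, t) * (r`! * t`!) = 'C(r, j) * (r + t - j)`! * j`!)%N.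
    rewrite -(bin_fact le_jr) -addnBAC //.
    by rewrite -(@bin_fact (r - j + t) t) ?leq_addl // addnK; lia.
  have := congr1 (fun n => n%:R : C) E; rewrite [LHS]natrM [RHS]natrM => E'.
  apply: (mulIf (x := sl2_root ^+ 2 * ((r`! * t`!)%:R * j`!%:R))).
    do 2?[apply: mulf_neq0]; rewrite ?expf_neq0 ?sl2_root_neq0 ?fact_neq0 // natrM.
    by apply: mulf_neq0; exact: fact_neq0.
  transitivity (('C(r + t - j, t))%:R * (r`! * t`!)%:R : C).
    by field; rewrite sl2_root_neq0 fact_neq0.
  by rewrite E' [(r`! * t`!)%:R]natrM; field; rewrite sl2_root_neq0 !fact_neq0.
rewrite /bracket_across big_cat !big_flatten !big_map.
rewrite -[iota 0 p.+1]/(index_iota 0 p.+1) -[iota 0 q.+1]/(index_iota 0 q.+1) !big_mkord.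
rewrite scalerBr !scaler_sumr -sumrN; congr (_ + _); apply: eq_bigr => j _.
  rewrite contraction_val zvalM zval_sign /zbin zval_nat scalerA; congr (_ *: _).
  transitivity ((-1) ^+ (p + 1 - j) * x ^+ (p + q + 1 - j)
      * (('C(p + q - j, q))%:R * emb (sl2_root ^+ 2 * j`!%:R)^-1)); first by ring.
  by rewrite (binE p q j (ltnSE (ltn_ord j))) mulrCA; congr (_ * _); exact: mulrAC.
rewrite contraction_val zvalM zval_sign /zbin zval_nat scalerA -scaleNr; congr (_ *: _).
transitivity ((-1) ^+ p * x ^+ (p + q + 1 - j)
    * (('C(q + p - j, p))%:R * emb (sl2_root ^+ 2 * j`!%:R)^-1)).
  by rewrite [(q + p)%N]addnC; ring.
rewrite (binE q p j (ltnSE (ltn_ord j))) [(q + p)%N]addnC mulrCA [(p + 1)%N]addn1 exprS.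
by rewrite -[RHS]mulrN [X in X * _]mulrC; congr (_ * _); rewrite mulN1r !mulNr opprK mulrAC.
Qed.

End NormalizedLetters.

(** * The normalized generators as operators *)

Definition annihilates g := if g is Cur _ m _ _ then Z.leb Z0 m else false.

Section LetterOperators.
Variable R : realType.
Local Notation C := R[i].
Variables (K : comNzRingType) (emb : {rmorphism C -> K}).
Variables (P : choiceType) (pt : bool -> P) (V : lmodType K).
Variable phi : symb P -> V -> V.
Hypothesis phi_linear : forall g c u v, phi g (c *: u + v) = c *: phi g u + phi g v.

Definition lact (g : letter) (v : V) : V := lval emb pt (phi^~ v) g.

Lemma lact_linear g c u v : lact g (c *: u + v) = c *: lact g u + lact g v.
Proof. by rewrite /lact /lval phi_linear scalerDr !scalerA mulrC. Qed.

Variables (B : symb P -> symb P -> V -> V) (x : K).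
Variable brl : letter -> letter -> seq (Z * nat * letter).
Hypothesis phi_comm : forall g h v, phi g (phi h v) = phi h (phi g v) + B g h v.
Hypothesis br_val : forall g h v,
  (emb (lscal R g) * emb (lscal R h)) *: B (lsym pt g) (lsym pt h) v
  = combo x lact (brl g h) v.

Lemma lact_comm g h v :
  lact g (lact h v) = lact h (lact g v) + combo x lact (brl g h) v.
Proof.
have phiZ k := linear_scale (phi_linear k).
rewrite -br_val /lact /lval !phiZ !scalerA phi_comm scalerDr.
by rewrite [emb (lscal R h) * _]mulrC.
Qed.

End LetterOperators.

Section TwoPoints.
Variable R : realType.
Local Notation C := R[i].
Local Notation A := {poly C}.

Definition polyCm : {rmorphism C -> A} := @polyC C.

Definition act_gen2 (g : symb bool) (v : V2 R) : V2 R := act (gen A g) v.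

Definition op2 : letter -> V2 R -> V2 R := lact polyCm id act_gen2.

Lemma op2_linear g c u v : op2 g (c *: u + v) = c *: op2 g u + op2 g v.
Proof. by apply: lact_linear => h {}c {}u {}v; exact: act_linear. Qed.

Lemma op2_kill g : annihilates g -> op2 g (vac2 R) = 0.
Proof.
case: g => //= u m p a m0.
have -> : op2 (Cur u m p a) (vac2 R) = (lscal R (Cur u m p a))%:P *: 0.
  congr (_ *: _); apply: act_pos.
  by rewrite /nonneg_mode /=; lia.
exact: scaler0.
Qed.

Definition sgen (g : letter) : free_alg A (symb bool) :=
  lval polyCm id (@gen A (symb bool)) g.

(** The lists of [bracket_two] describe the brackets already in the free algebra,
which is the form needed both for the action on states and for the Laurent
expansion. *)
Lemma letter_bracket2 g h :
  (polyCm (lscal R g) * polyCm (lscal R h)) *: bracket2 R (lsym id g) (lsym id h)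
  = \sum_(t <- bracket_two g h) (zval A t.1.1 * 'X ^+ t.1.2) *: sgen t.2.
Proof.
have nil c : c *: 0 = \sum_(t <- [::]) (zval A t.1.1 * 'X ^+ t.1.2) *: sgen t.2.
  by rewrite scaler0 big_nil.
case: g => [u m p a|u p]; last by case: h => *; exact: nil.
case: h => [w n q b|w q]; last exact: nil.
have same u' := esym (contraction_same_val polyCm id 'X (@gen A (symb bool)) u' a p m b q n).
case: u w => [] []; [exact: same| | |exact: same]; last first.
  exact/esym/(bracket_across_val polyCm id 'X (@gen A (symb bool))).
rewrite big_map mulrC.
apply: etrans (scalerN _ (bracket_zw R (ord_axis b) q (int_of_Z n) (ord_axis a) p
  (int_of_Z m))) _.
rewrite (eq_bigr (fun t => - ((zval A t.1.1 * 'X ^+ t.1.2) *: sgen t.2))); last first.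
  by move=> t _; rewrite zvalN mulNr scaleNr.
rewrite sumrN; congr (- _).
exact/esym/(bracket_across_val polyCm id 'X (@gen A (symb bool))).
Qed.

Lemma op2E g v : op2 g v = act (sgen g) v.
Proof. exact/esym/actZ. Qed.

Lemma op2_bracket g h v :
  (polyCm (lscal R g) * polyCm (lscal R h)) *:
    (act (bracket2 R (lsym id g) (lsym id h)) v : V2 R)
  = combo 'X op2 (bracket_two g h) v.
Proof.
rewrite -actZ letter_bracket2 act_sum; apply: eq_bigr => t _.
by rewrite actZ op2E.
Qed.

Lemma op2_comm g h v :
  op2 g (op2 h v) = op2 h (op2 g v) + combo 'X op2 (bracket_two g h) v.
Proof.
apply: lact_comm op2_bracket g h v => [g c u v|g h v]; first exact: act_linear.
exact: act_bracket.
Qed.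

End TwoPoints.

Section OnePoint.
Variable R : realType.
Local Notation C := R[i].
Local Notation vac1 := (vac (@bracket1 R) (@nonneg_mode unit)).

Definition act_gen1 (g : symb unit) (v : V1 R) : V1 R := act (gen C g) v.

Definition op1 : letter -> V1 R -> V1 R := lact (@idfun C) (fun=> tt) act_gen1.

Lemma op1_linear g c u v : op1 g (c *: u + v) = c *: op1 g u + op1 g v.
Proof. by apply: lact_linear => h {}c {}u {}v; exact: act_linear. Qed.

Lemma op1_kill g : annihilates g -> op1 g vac1 = 0.
Proof.
case: g => //= u m p a m0.
have -> : op1 (Cur u m p a) vac1 = lscal R (Cur u m p a) *: 0.
  congr (_ *: _); apply: act_pos.
  by rewrite /nonneg_mode /=; lia.
exact: scaler0.
Qed.

Lemma op1_comm g h v :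
  op1 g (op1 h v) = op1 h (op1 g v) + combo 0 op1 (bracket_one g h) v.
Proof.
apply: (@lact_comm _ _ _ _ _ _ act_gen1 _
  (fun g h v => act (bracket1 R g h) v)) => {g h v}[g c u v|g h v|g h v].
- exact: act_linear.
- exact: act_bracket.
have nil c : c *: (act 0 v : V1 R) = combo 0 op1 [::] v.
  by rewrite act0 scaler0 /combo big_nil.
case: g => [u m p a|u p]; last by case: h => *; exact: nil.
case: h => [w n q b|w q]; last exact: nil.
have E := contraction_same_val (@idfun C) (fun=> tt) 0 (@gen C (symb unit)) u a p m b q n.
have {}E : (lscal R (Cur u m p a) * lscal R (Cur w n q b)) *:
    bracket1 R (lsym (fun=> tt) (Cur u m p a)) (lsym (fun=> tt) (Cur w n q b)) =
    \sum_(t <- bracket_one (Cur u m p a) (Cur w n q b)) (zval C t.1.1 * 0 ^+ t.1.2)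
      *: lval (@idfun C) (fun=> tt) (@gen C (symb unit)) t.2 by exact/esym/E.
rewrite -actZ E act_sum; apply: eq_bigr => t _.
rewrite actZ; congr (_ *: _); exact: actZ.
Qed.

End OnePoint.

(** * Brackets, translation and partial derivatives *)

Section BracketDerivations.
Variables (R : realType) (P : choiceType).
Local Notation C := R[i].
Local Notation A := {poly C}.
Variables (W : lmodType A) (psi : symb P -> W) (D : W -> W) (delta : A -> A).
Hypothesis DD : {morph D : f g / f + g}.
Hypothesis DZ : forall c f, D (c *: f) = delta c *: f + c *: D f.
Hypothesis deltaC : forall c : C, delta c%:P = 0.
Local Notation bV := (bracketV (@polyC C) psi).

Let D0 : D 0 = 0.
Proof. by apply: (addrI (D 0)); rewrite -DD !addr0. Qed.

Let DN f : D (- f) = - D f.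
Proof. by apply: (addrI (D f)); rewrite -DD !subrr D0. Qed.

Let Dsum (I : Type) (r : seq I) (F : I -> W) :
  D (\sum_(i <- r) F i) = \sum_(i <- r) D (F i).
Proof. exact: (big_morph D DD D0). Qed.

Let DZC (c : C) f : D (c%:P *: f) = c%:P *: D f.
Proof. by rewrite DZ deltaC scale0r add0r. Qed.

Let bVE a m b n u j : bV a m b n u j =
  \sum_(c < 3) (fabc R a b c)%:P *: psi (symbI u c j (m + n))
  - (n%:~R * (m + n == 0)%:R * (a == b)%:R : C)%:P *: psi (symbK u j).
Proof. by rewrite /bracketV !polyCM rmorph_int !polyC_natr. Qed.

(** T lowers modes, so that the current parts agree at once; the central parts add
up to a multiple of n (m + n - 1), which vanishes where m + n = 1. *)
Lemma translate_bracketV a m b n u j :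
  (forall c m, D (psi (symbI u c j m)) = - m%:~R *: psi (symbI u c j (m - 1))) ->
  D (psi (symbK u j)) = 0 ->
  D (bV a m b n u j) = - m%:~R *: bV a (m - 1) b n u j
    + - n%:~R *: bV a m b (n - 1) u j.
Proof.
move=> DI DK; pose S k := \sum_(c < 3) (fabc R a b c)%:P *: psi (symbI u c j k).
pose kappa (m n : int) : C := n%:~R * (m + n == 0)%:R * (a == b)%:R.
have E k l : bV a k b l u j = S (k + l) - (kappa k l)%:P *: psi (symbK u j).
  exact: bVE.
have DS k : D (S k) = - k%:~R *: S (k - 1).
  rewrite /S Dsum scaler_sumr; apply: eq_bigr => c _.
  by rewrite DZC DI !scalerA mulrC.
have kappa0 : m%:~R * kappa (m - 1) n + n%:~R * kappa m (n - 1) = 0.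
  rewrite /kappa addrAC addrA; case: eqP => [mn|_]; last by rewrite !(mulr0, mul0r) addr0.
  have -> : m = 1 - n by rewrite -[RHS]addr0 -mn; ring.
  by rewrite !rmorphB /= rmorph1; ring.
have e1 : m - 1 + n = m + n - 1 by ring.
have e2 : m + (n - 1) = m + n - 1 by ring.
rewrite !E DD DN DZC DK scaler0 oppr0 addr0 DS e1 e2.
set S' := S _; set k := psi _; set k1 := (kappa (m - 1) n)%:P *: k.
set k2 := (kappa m (n - 1))%:P *: k.
transitivity (- (m%:~R *: S' + n%:~R *: S') + (m%:~R *: k1 + n%:~R *: k2)).
  have -> : m%:~R *: k1 + n%:~R *: k2 = 0.
    rewrite !scalerA -scalerDl -!(rmorph_int (polyC : {rmorphism C -> A})).
    by rewrite -!polyCM -polyCD kappa0 scale0r.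
  by rewrite addr0 -scalerDl -rmorphD scaleNr.
by rewrite !scaleNr !scalerBr !opprD !opprK addrACA.
Qed.

Lemma partial_bracketV a m b n u v j :
  (forall c m, D (psi (symbI u c j m)) = (u == v)%:R *: psi (symbI u c j.+1 m)) ->
  D (psi (symbK u j)) = (u == v)%:R *: psi (symbK u j.+1) ->
  D (bV a m b n u j) = (u == v)%:R *: bV a m b n u j.+1.
Proof.
move=> DI DK; rewrite !bVE DD DN DZC DK Dsum scalerBr scaler_sumr.
congr (_ - _); last by rewrite !scalerA mulrC.
by apply: eq_bigr => c _; rewrite DZC DI !scalerA mulrC.
Qed.

(** [zw_sum p q f g] is the bracket [I^{[p]}(z), I^{[q]}(w)] with f and g in place
of F(z) and F(w). *)
Definition zw_sum p q (f g : nat -> W) : W :=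
  \sum_(j < p.+1)
     ((-1) ^+ (p + 1 - j) * ('C(p, j) * (p + q - j)`!)%:R * 'X^(p + q + 1 - j))
     *: f j
  - \sum_(j < q.+1)
     ((-1) ^+ (p + 1) * ('C(q, j) * (p + q - j)`!)%:R * 'X^(p + q + 1 - j))
     *: g j.

(** Pascal's rule, in the form in which it raises the order p of one argument of
the bracket. *)
Lemma pascal_sum p (f : nat -> W) :
  \sum_(j < p.+2) f j *+ 'C(p.+1, j)
  = \sum_(j < p.+1) (f j + f j.+1) *+ 'C(p, j).
Proof.
under [RHS]eq_bigr do rewrite mulrnDl; rewrite big_split /=.
rewrite big_ord_recl [X in _ = X + _]big_ord_recl /= !bin0 -!addrA; congr (_ + _).
have -> : \sum_(i < p) f (bump 0 i) *+ 'C(p, bump 0 i)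
  = \sum_(j < p.+1) f j.+1 *+ 'C(p, j.+1).
  by rewrite [RHS]big_ord_recr /= bin_small // mulr0n addr0.
by rewrite -big_split; apply: eq_bigr => j _ /=; rewrite /bump add1n binS mulrnDr.
Qed.

Variable sg : A.
Hypothesis deltaM : forall a b, delta (a * b) = delta a * b + a * delta b.
Hypothesis deltaX : forall k, delta 'X^k = sg * k%:R * 'X^(k.+1).

Definition zw_coef k e : A := (-1) ^+ k * (e`!)%:R * 'X^(e.+1).

Lemma zw_coefS k e : zw_coef k.+1 e = -1 * zw_coef k e.
Proof. by rewrite /zw_coef exprS !mulrA. Qed.

Lemma delta_zw_coef k e : delta (zw_coef k e) = sg * zw_coef k e.+1.
Proof.
rewrite /zw_coef; have -> : (-1) ^+ k * (e`!)%:R = ((-1) ^+ k * (e`!)%:R : C)%:P.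
  by rewrite polyCM polyC_natr polyC_exp polyCN.
rewrite deltaM deltaC mul0r add0r deltaX polyCM polyC_natr polyC_exp polyCN.
by rewrite factS natrM; ring.
Qed.

Let zw_sumE p q (f g : nat -> W) : zw_sum p q f g =
  \sum_(j < p.+1) (zw_coef (p + 1 - j) (p + q - j) *: f j) *+ 'C(p, j)
  - \sum_(j < q.+1) (zw_coef (p + 1) (p + q - j) *: g j) *+ 'C(q, j).
Proof.
rewrite /zw_sum; congr (_ - _); apply: eq_bigr => j _;
  rewrite -scaler_nat scalerA; congr (_ *: _).
  have -> : (p + q + 1 - j = (p + q - j).+1)%N.
    by have := ltn_ord j; lia.
  by rewrite /zw_coef natrM; ring.
have -> : (p + q + 1 - j = (p + q - j).+1)%N by have := ltn_ord j; lia.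
by rewrite /zw_coef natrM; ring.
Qed.

Let DMn f n : D (f *+ n) = D f *+ n.
Proof. by elim: n => [|n IH]; rewrite ?mulr0n // !mulrS DD IH. Qed.

(** The derivative of the j-th term has a part where the coefficient is
differentiated and a part where F^{[j]} is; they recombine by Pascal's rule into
the bracket with p + 1. *)
Lemma partial_z_zw_sum p q (f g : nat -> W) :
  sg = -1 -> (forall j, D (f j) = f j.+1) -> (forall j, D (g j) = 0) ->
  D (zw_sum p q f g) = zw_sum p.+1 q f g.
Proof.
move=> sgE Df Dg; rewrite !zw_sumE DD DN !Dsum
  (pascal_sum p (fun j => zw_coef (p.+1 + 1 - j) (p.+1 + q - j) *: f j)); congr (_ - _).
  apply: eq_bigr => j _; rewrite DMn DZ Df delta_zw_coef sgE; congr (_ *+ _).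
  have le_jp := ltnSE (ltn_ord j).
  have -> : (p.+1 + 1 - j.+1 = p + 1 - j)%N by lia.
  have -> : (p.+1 + q - j.+1 = p + q - j)%N by lia.
  have -> : (p.+1 + 1 - j = (p + 1 - j).+1)%N by lia.
  have -> : (p.+1 + q - j = (p + q - j).+1)%N by lia.
  by rewrite zw_coefS.
apply: eq_bigr => j _; rewrite DMn DZ Dg delta_zw_coef sgE scaler0 addr0.
congr (_ *: _ *+ _); have le_jq := ltnSE (ltn_ord j).
have -> : (p.+1 + q - j = (p + q - j).+1)%N by lia.
by rewrite addSn zw_coefS.
Qed.

Lemma partial_w_zw_sum p q (f g : nat -> W) :
  sg = 1 -> (forall j, D (f j) = 0) -> (forall j, D (g j) = g j.+1) ->
  D (zw_sum p q f g) = zw_sum p q.+1 f g.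
Proof.
move=> sgE Df Dg; rewrite !zw_sumE DD DN !Dsum
  (pascal_sum q (fun j => zw_coef (p + 1) (p + q.+1 - j) *: g j)); congr (_ - _).
  apply: eq_bigr => j _; rewrite DMn DZ Df delta_zw_coef sgE scaler0 addr0 mul1r.
  have le_jp := ltnSE (ltn_ord j).
  by have -> : (p + q.+1 - j = (p + q - j).+1)%N by lia.
apply: eq_bigr => j _; rewrite DMn DZ Dg delta_zw_coef sgE mul1r.
have le_jq := ltnSE (ltn_ord j).
have -> : (p + q.+1 - j.+1 = p + q - j)%N by lia.
by have -> : (p + q.+1 - j = (p + q - j).+1)%N by lia.
Qed.

End BracketDerivations.

Section TwoPointBracket.
Variable R : realType.
Local Notation C := R[i].
Local Notation A := {poly C}.
Variables (W : lmodType A) (psi : symb bool -> W).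
Local Notation bV := (bracketV (@polyC C) psi).

Definition same_coef p q : C := (p`! * q`!)%:R / (p + q + 1)`!%:R.

(** The bracket of V_(z,w) with a map psi in place of the inclusion of the
generators. *)
Definition bracket2V (g h : symb bool) : W :=
  match g, h with
  | (u, inl (a, p, m)), (v, inl (b, q, n)) =>
      if u == v then - ((same_coef p q)%:P *: bV a m b n u (p + q + 1))
      else if u == ptz then
        zw_sum p q (bV a m b n ptz) (bV a m b n ptw)
      else - zw_sum q p (bV b n a m ptz) (bV b n a m ptw)
  | _, _ => 0
  end.

(** [T, g] is [T_scal g] times the generator [T_symb g]. *)
Definition T_scal (g : symb bool) : A :=
  if g is (_, inl (_, _, n)) then - n%:~R else 0.

Definition T_symb (g : symb bool) : symb bool :=
  if g is (u, inl (a, p, n)) then symbI u a p (n - 1) else g.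

Variables (D : W -> W) (delta : A -> A).
Hypothesis DD : {morph D : f g / f + g}.
Hypothesis DZ : forall c f, D (c *: f) = delta c *: f + c *: D f.

Let D0 : D 0 = 0.
Proof. by apply: (addrI (D 0)); rewrite -DD !addr0. Qed.

Let DN f : D (- f) = - D f.
Proof. by apply: (addrI (D f)); rewrite -DD !subrr D0. Qed.

Lemma zw_sum_comb p q (c d : A) (f g f1 g1 f2 g2 : nat -> W) :
  (forall k, f k = c *: f1 k + d *: f2 k) ->
  (forall k, g k = c *: g1 k + d *: g2 k) ->
  zw_sum p q f g = c *: zw_sum p q f1 g1 + d *: zw_sum p q f2 g2.
Proof.
move=> fE gE; rewrite /zw_sum !scalerBr !scaler_sumr addrACA -opprD -!big_split.
by congr (_ - _); apply: eq_bigr => j _ /=;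
  rewrite ?fE ?gE scalerDr !scalerA ![_ * c]mulrC ![_ * d]mulrC.
Qed.

Lemma translate_bracket2V g h : (forall c, delta c = 0) ->
  (forall k, D (psi k) = T_scal k *: psi (T_symb k)) ->
  D (bracket2V g h) =
  T_scal g *: bracket2V (T_symb g) h + T_scal h *: bracket2V g (T_symb h).
Proof.
move=> delta0 Dpsi.
have DZ0 c f : D (c *: f) = c *: D f by rewrite DZ delta0 scale0r add0r.
have DbV a m b n u j : D (bV a m b n u j) = - m%:~R *: bV a (m - 1) b n u j
    + - n%:~R *: bV a m b (n - 1) u j.
  apply: (@translate_bracketV _ _ _ _ _ delta) => //; first by move=> c k; rewrite Dpsi.
  by rewrite Dpsi scale0r.
have Dzw p q f g' : D (zw_sum p q f g') = zw_sum p q (D \o f) (D \o g').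
  have Dsum (I : Type) (r : seq I) (k : I -> W) :
    D (\sum_(i <- r) k i) = \sum_(i <- r) D (k i) by exact: (big_morph D DD D0).
  rewrite /zw_sum DD DN !Dsum; congr (_ - _); apply: eq_bigr => j _; exact: DZ0.
case: g => u [[[a p] m]|p]; last by case: h => v [[[b q] n]|q] /=; rewrite D0 !(scale0r, scaler0) addr0.
case: h => v [[[b q] n]|q]; last by rewrite /= D0 !(scale0r, scaler0) addr0.
rewrite /=; case: (u == v).
  rewrite DN DZ0 DbV scalerDr opprD !scalerN !scalerA.
  by rewrite ![_ * (same_coef p q)%:P]mulrC.
case: (u == ptz).
  by rewrite Dzw; apply: zw_sum_comb => k /=; rewrite DbV.
rewrite DN Dzw !scalerN -opprD; congr (- _); rewrite addrC.
by apply: zw_sum_comb => k /=; rewrite DbV.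
Qed.

Variable u0 : bool.
Hypothesis deltaC : forall c : C, delta c%:P = 0.
Hypothesis deltaM : forall a b, delta (a * b) = delta a * b + a * delta b.
Hypothesis deltaX : forall k,
  delta 'X^k = (if u0 == ptz then -1 else 1) * k%:R * 'X^(k.+1).

(** At a single point both arguments are differentiated and the claim is
p!q!/(p+q+1)! = (p+1)!q!/(p+q+2)! + p!(q+1)!/(p+q+2)!.  At two points it is
[partial_z_zw_sum] or [partial_w_zw_sum]. *)
Lemma partial_bracket2V g h :
  (forall k, D (psi k) = (k.1 == u0)%:R *: psi (shift 1 k)) ->
  D (bracket2V g h) = (g.1 == u0)%:R *: bracket2V (shift 1 g) h
                    + (h.1 == u0)%:R *: bracket2V g (shift 1 h).
Proof.
move=> Dpsi.
have DbV a m b n u j : D (bV a m b n u j) = (u == u0)%:R *: bV a m b n u j.+1.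
  apply: (@partial_bracketV _ _ _ _ _ delta) => // [c k|]; by rewrite Dpsi /= addn1.
have sameE p q : same_coef p q = same_coef p.+1 q + same_coef p q.+1.
  rewrite /same_coef !addn1 addSn addnS -mulrDl.
  have -> : ((p + q).+2`! = (p.+1 + q.+1) * (p + q).+1`!)%N.
    by rewrite factS addSn addnS.
  rewrite !factS !natrM !natrD; field.
  by rewrite (fact_neq0 R) -[p%:R + q%:R]natrD !nat1r -natrD !pnatr_eq0.
case: g => u [[[a p] m]|p]; last by case: h => v [[[b q] n]|q] /=; rewrite D0 !(scale0r, scaler0) addr0.
case: h => v [[[b q] n]|q]; last by rewrite /= D0 !(scale0r, scaler0) addr0.
rewrite /= !addn1; case: eqVneq => [<-|ne_uv].
  rewrite DN DZ deltaC scale0r add0r DbV sameE polyCD ?addSn ?addnS.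
  set bv := bV _ _ _ _ _ _; rewrite scalerDl opprD.
  by rewrite !scalerN !scalerA ![_ * (u == u0)%:R]mulrC.
have zwD p' q' f g' : (forall j, D (f j) = (ptz == u0)%:R *: f j.+1) ->
   (forall j, D (g' j) = (ptw == u0)%:R *: g' j.+1) ->
   D (zw_sum p' q' f g') = (ptz == u0)%:R *: zw_sum p'.+1 q' f g'
     + (ptw == u0)%:R *: zw_sum p' q'.+1 f g'.
  move=> Df Dg; case: u0 deltaX Df Dg => dX Df Dg.
    rewrite scale0r add0r scale1r; apply: (partial_w_zw_sum DD DZ deltaC deltaM dX) => // j.
      by rewrite Df scale0r.
    by rewrite Dg scale1r.
  rewrite scale0r addr0 scale1r; apply: (partial_z_zw_sum DD DZ deltaC deltaM dX) => // j.
    by rewrite Df scale1r.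
  by rewrite Dg scale0r.
case: u v ne_uv => [] [] //= _.
  rewrite DN (zwD _ _ _ _ (fun j => DbV _ _ _ _ ptz j) (fun j => DbV _ _ _ _ ptw j)).
  by rewrite opprD !scalerN addrC.
exact: (zwD _ _ _ _ (fun j => DbV _ _ _ _ ptz j) (fun j => DbV _ _ _ _ ptw j)).
Qed.

End TwoPointBracket.

(** * The operators T and d/dz, d/dw on states of the two-point module *)

Section TwoPointDerivations.
Variable R : realType.
Local Notation C := R[i].
Local Notation A := {poly C}.
Local Notation F2 := (free_alg A (symb bool)).
Local Notation G2 := (@gen A (symb bool)).

Lemma bracket2E g h : bracket2 R g h = bracket2V G2 g h.
Proof. by case: g h => [u [[[a p] m]|p]] [v [[[b q] n]|q]]. Qed.

Lemma T_genE g : T_gen R g = T_scal R g *: G2 (T_symb g).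
Proof. by case: g => u [[[a p] n]|p] //=; rewrite scale0r. Qed.

Lemma partial_genE u g : partial_gen R u g = (g.1 == u)%:R *: G2 (shift 1 g).
Proof. by rewrite /partial_gen; case: eqP => _; rewrite ?scale1r ?scale0r. Qed.

Let zeroD : {morph (fun _ : A => 0 : A) : x y / x + y}.
Proof. by move=> x y; rewrite addr0. Qed.

Let zeroM (x y : A) : 0 = 0 * y + x * 0 :> A.
Proof. by rewrite mul0r mulr0 addr0. Qed.

Lemma T_bracket2 g h : derivation (fun=> 0) (@T_gen R) (bracket2 R g h) =
  T_scal R g *: bracket2 R (T_symb g) h + T_scal R h *: bracket2 R g (T_symb h).
Proof.
rewrite !bracket2E.
apply: (translate_bracket2V (D := derivation (fun=> 0) (@T_gen R))
  (derivationD _ zeroD) (derivationZ _ zeroD zeroM)) => // k.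
by rewrite derivation_gen // T_genE.
Qed.

Lemma T_nonneg g : nonneg_mode g -> T_scal R g != 0 -> nonneg_mode (T_symb g).
Proof.
case: g => u [[[a p] n]|p] //; rewrite /nonneg_mode /= oppr_eq0.
by case: (eqVneq n 0) => [->|n0 n1 _]; [rewrite mulr0z eqxx|lia].
Qed.

Lemma T2D v w : T2 (v + w) = T2 v + T2 w :> V2 R.
Proof.
exact: (derive_stateD zeroD zeroM T_genE T_bracket2 T_nonneg).
Qed.

Lemma T2Z c v : T2 (c *: v) = c *: T2 v :> V2 R.
Proof.
have := derive_stateZ zeroD zeroM T_genE T_bracket2 T_nonneg c v.
by rewrite scale0r add0r.
Qed.

Lemma T2_act_gen g v : T2 (act_gen2 g v) =
  act_gen2 g (T2 v) + T_scal R g *: act_gen2 (T_symb g) v.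
Proof.
exact: (derive_state_gen zeroD zeroM T_genE T_bracket2 T_nonneg).
Qed.

Lemma T2_vac : T2 (vac2 R) = 0.
Proof. exact: (derive_state_vac zeroD zeroM T_genE T_bracket2 T_nonneg). Qed.

Section Partial.
Variable u : bool.
Local Notation delta := (@partial_scal R u).
Local Notation sg := (if u == ptz then -1 else 1 : A).

Lemma partial_scalD : {morph delta : x y / x + y}.
Proof. by move=> x y; rewrite /partial_scal derivD mulrDr. Qed.

Lemma partial_scalM x y : delta (x * y) = delta x * y + x * delta y.
Proof. by rewrite /partial_scal derivM; ring. Qed.

Lemma partial_scalC (c : C) : delta c%:P = 0.
Proof. by rewrite /partial_scal derivC mulr0. Qed.

Lemma partial_scalX k : delta 'X^k = sg * k%:R * 'X^(k.+1).
Proof.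
rewrite /partial_scal derivXn -mulr_natr -!mulrA; congr (_ * _).
case: k => [|k]; first by rewrite !(mulr0, mul0r).
have e2 : 'X^(k.+2) = 'X * ('X * 'X^k) :> A by rewrite !exprS.
by rewrite /= e2; ring.
Qed.

Lemma partial_bracket2 g h : derivation delta (partial_gen R u) (bracket2 R g h) =
  (g.1 == u)%:R *: bracket2 R (shift 1 g) h
  + (h.1 == u)%:R *: bracket2 R g (shift 1 h).
Proof.
rewrite !bracket2E.
apply: (partial_bracket2V (D := derivation delta (partial_gen R u))
  (derivationD _ partial_scalD) (derivationZ _ partial_scalD partial_scalM)
  partial_scalC partial_scalM partial_scalX) => k.
by rewrite derivation_gen ?partial_genE //; [exact: partial_scalD|exact: partial_scalM].
Qed.

Lemma shift_nonneg (g : symb bool) :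
  nonneg_mode g -> (g.1 == u)%:R != 0 :> A -> nonneg_mode (shift 1 g).
Proof. by case: g => v [[[a p] n]|p]. Qed.

Lemma partialD v w : partial u (v + w) = partial u v + partial u w :> V2 R.
Proof.
exact: (derive_stateD partial_scalD partial_scalM (partial_genE u)
  partial_bracket2 shift_nonneg).
Qed.

Lemma partialZ c v : partial u (c *: v) = delta c *: v + c *: partial u v :> V2 R.
Proof.
exact: (derive_stateZ partial_scalD partial_scalM (partial_genE u)
  partial_bracket2 shift_nonneg).
Qed.

Lemma partial_act_gen g v : partial u (act_gen2 g v) =
  act_gen2 g (partial u v) + (g.1 == u)%:R *: act_gen2 (R := R) (shift 1 g) v.
Proof.
exact: (derive_state_gen partial_scalD partial_scalM (partial_genE u)
  partial_bracket2 shift_nonneg).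
Qed.

Lemma partial_vac : partial u (vac2 R) = 0.
Proof.
exact: (derive_state_vac partial_scalD partial_scalM (partial_genE u)
  partial_bracket2 shift_nonneg).
Qed.

End Partial.
End TwoPointDerivations.

(** * Binomial identities *)

Lemma hockey_stick p t : (\sum_(r < t.+1) 'C(p + r, r) = 'C(p + 1 + t, t))%N.
Proof.
elim: t => [|t IH]; first by rewrite big_ord_recl big_ord0 !bin0.
by rewrite big_ord_recr /= IH addn1 !addSn !addnS [RHS]binS addnC.
Qed.

(** The Vandermonde convolution for multisets, that is the coefficient of y^t in
(1-y)^{-p-1} (1-y)^{-q-1} = (1-y)^{-p-q-2}. *)
Lemma bin_convolution p q t :
  (\sum_(r < t.+1) 'C(p + r, r) * 'C(q + (t - r), t - r) = 'C(p + q + 1 + t, t))%N.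
Proof.
elim: q t => [|q IHq] t.
  rewrite addn0 -hockey_stick; apply: eq_bigr => r _.
  by rewrite add0n binn muln1.
elim: t => [|t IHt]; first by rewrite big_ord_recl big_ord0 !bin0.
have -> : (p + q.+1 + 1 + t.+1 = (p + q + 1 + t.+1).+1)%N by lia.
rewrite binS -IHq addnC -[X in ('C(X, t))%N](_ : p + q.+1 + 1 + t = _)%N; last lia.
rewrite -IHt [RHS]addnC [LHS]big_ord_recr [X in _ = (X + _)%N]big_ord_recr /=.
rewrite !subnn !bin0 addnAC -big_split /=; congr (_ + _)%N.
apply: eq_bigr => r _; have le_rt := ltnSE (ltn_ord r).
by rewrite subSn // -mulnDr !addSn addnS binS.
Qed.

(** By induction on k: Pascal's rule gives the same recursion in k and q for both
sides, and at k = p the two expressions on the right take over from each other. *)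
Lemma alternating_bin p q k :
  \sum_(j < q.+1) (-1) ^+ (q - j) * ('C(p + q - j, p) * 'C(k, j))%:R
  = if (k <= p)%N then (-1) ^+ q * ('C(p + q - k, q))%:R
    else ('C(k - p.+1, q))%:R :> int.
Proof.
elim: k q => [|k IH] q.
  rewrite leq0n subn0 big_ord_recl big1 ?addr0 /= => [|i _]; last first.
    by rewrite bin0n muln0 mulr0.
  by rewrite !subn0 bin0 muln1 -(bin_sub (leq_addr q p)) addKn.
case: q => [|q].
  by rewrite big_ord_recl big_ord0 addr0 /= !subn0 addn0 !bin0 binn; case: ifP.
transitivity ((\sum_(j < q.+2) (-1) ^+ (q.+1 - j) * ('C(p + q.+1 - j, p) * 'C(k, j))%:R)
  + \sum_(j < q.+1) (-1) ^+ (q - j) * ('C(p + q - j, p) * 'C(k, j))%:R : int).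
  rewrite big_ord_recl [X in _ = X + _]big_ord_recl /= !bin0 -addrA; congr (_ + _).
  rewrite -big_split; apply: eq_bigr => j _ /=.
  by rewrite /bump /= add1n binS mulnDr natrD mulrDr addnS !subSS.
rewrite !IH; case: (ltngtP k p) => [lt_kp|lt_pk|->].
- have -> : (p + q.+1 - k = (p + q - k).+1)%N by lia.
  have -> : (p + q.+1 - k.+1 = (p + q - k))%N by lia.
  by rewrite binS natrD exprS; ring.
- have -> : (k.+1 - p.+1 = (k - p.+1).+1)%N by lia.
  by rewrite binS natrD.
- by rewrite subnn !addKn !binn bin0n exprS !mulr1 mulN1r addNr.
Qed.

(** * Taylor series of operators *)

Definition letter_point g := match g with Cur u _ _ _ => u | Cen u _ => u end.
Definition letter_order g := match g with Cur _ _ p _ => p | Cen _ p => p end.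
Definition letter_shift r g :=
  match g with
  | Cur u m p a => Cur u m (p + r) a
  | Cen u p => Cen u (p + r)
  end.

(** Summation of a finitely supported double series by total degree. *)
Lemma sum_diagonals (V : nmodType) N (F : nat -> nat -> V) :
  (forall r s, (N <= r + s)%N -> F r s = 0) ->
  \sum_(r < N) \sum_(s < N) F r s = \sum_(t < N) \sum_(r < t.+1) F r (t - r)%N.
Proof.
move=> F0.
transitivity (\sum_(r < N) \sum_(s < N) \sum_(t < N | t == (r + s)%N :> nat) F r s).
  apply: eq_bigr => r _; apply: eq_bigr => s _.
  have [lt|ge] := ltnP (r + s) N.
    by rewrite (big_pred1 (Ordinal lt)) // => t; rewrite /= -val_eqE.
  by rewrite (F0 _ _ ge) big1.
under eq_bigr do rewrite (exchange_big_dep xpredT) //=.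
rewrite (exchange_big_dep xpredT) //=; apply: eq_bigr => t _.
rewrite (big_ord_widen N (fun r => F r (t - r)%N) (ltn_ord t)) [RHS]big_mkcond /=.
apply: eq_bigr => r _; rewrite ltnS; case: leqP => [le_rt|lt_tr].
  have lt : (t - r < N)%N by rewrite (leq_ltn_trans (leq_subr _ _)).
  by rewrite (big_pred1 (Ordinal lt)) // => s; rewrite /= -val_eqE /=; apply/eqP/eqP; lia.
by rewrite big_pred0 // => s; apply/negbTE; lia.
Qed.

Section TaylorBracket.
Variables (K : comNzRingType) (V : lmodType K) (op : letter -> V -> V).
Hypothesis op_linear : forall g c u v, op g (c *: u + v) = c *: op g u + op g v.
Hypothesis op_comm : forall g h v,
  op g (op h v) = op h (op g v) + combo 0 op (bracket_one g h) v.
Hypothesis op_pointJ : forall m p a v, op (Cur true m p a) v = op (Cur false m p a) v.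
Hypothesis op_pointK : forall p v, op (Cen true p) v = op (Cen false p) v.

Let opD := opD op_linear.
Let op0 := op0 op_linear.
Let opZ := opZ op_linear.
Let op_sum := op_sum op_linear.

(** F^{(k)} acting at the common point. *)
Definition current a m b n k v : V :=
  match cross a b with
  | Some (s, d) => zval K s *: op (Cur false (Z.add m n) k d) v
  | None => if Z.eqb (Z.add m n) Z0 then zval K (Z.opp n) *: op (Cen false k) v
            else 0
  end.

Variable B : nat.

Definition tail_bounded (phi : int -> V) := forall n : int, n < - B%:Z -> phi n = 0.

(** The action of a letter on a Laurent series phi in t: a letter at w acts through
its Taylor series sum_r C(p+r, r) t^r J^{(p+r)}(z).  The series phi vanishes
below the exponent -B, so the sum over r is finite; the bound B only fixes where
it is cut. *)
Definition taylor_act g (phi : int -> V) (n : int) : V :=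
  if letter_point g then
    \sum_(r < (absz (n + B%:Z)).+1)
      ('C(letter_order g + r, r))%:R *: op (letter_shift r g) (phi (n - r%:Z))
  else op g (phi n).

Lemma taylor_act_large g phi (n : int) N : tail_bounded phi ->
  letter_point g -> n + B%:Z < N%:Z ->
  taylor_act g phi n = \sum_(r < N)
    ('C(letter_order g + r, r))%:R *: op (letter_shift r g) (phi (n - r%:Z)).
Proof.
move=> phiB gw ltN; rewrite /taylor_act gw.
pose f r := ('C(letter_order g + r, r))%:R *: op (letter_shift r g) (phi (n - r%:Z)).
(* all summation bounds beyond n + B give the same sum *)
suff E M1 M2 : n + B%:Z < M1%:Z -> n + B%:Z < M2%:Z -> (M1 <= M2)%N ->
    \sum_(r < M1) f r = \sum_(r < M2) f r.
  have lt0 : n + B%:Z < (absz (n + B%:Z)).+1%:Z by lia.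
  by case: (leqP (absz (n + B%:Z)).+1 N) => [le|/ltnW le]; [|symmetry]; exact: E.
move=> lt1 lt2 le12; rewrite (big_ord_widen M2 f le12) [RHS](bigID (fun r : 'I_M2 => (r < M1)%N)) /=.
rewrite [X in _ = _ + X]big1 ?addr0 // => r; rewrite -leqNgt => leM1.
by rewrite /f phiB ?op0 ?scaler0 //; lia.
Qed.

Lemma taylor_act_bounded g phi : tail_bounded phi -> tail_bounded (taylor_act g phi).
Proof.
move=> phiB n nB; rewrite /taylor_act; case: (letter_point g); last by rewrite phiB // op0.
by rewrite big1 // => r _; rewrite phiB ?op0 ?scaler0 //; lia.
Qed.

Lemma taylor_contraction c e a m b n u j phi (k : int) N : tail_bounded phi ->
  k + e%:Z + B%:Z < N%:Z ->
  \sum_(t <- contraction c e a m b n u j)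
    (zval K t.1.1 * (-1) ^+ t.1.2) *: taylor_act t.2 phi (k + t.1.2%:Z)
  = (zval K c * (-1) ^+ e) *:
    if u then \sum_(r < N) ('C(j + r, r))%:R *:
                current a m b n (j + r) (phi (k + e%:Z - r%:Z))
    else current a m b n j (phi (k + e%:Z)).
Proof.
move=> phiB ltN; rewrite /contraction /current.
case: (cross a b) => [[s d]|].
  rewrite big_seq1 /= zvalM; case: u.
    rewrite (taylor_act_large phiB _ ltN) //= mulrAC -[LHS]scalerA; congr (_ *: _).
    rewrite scaler_sumr; apply: eq_bigr => r _.
    by rewrite op_pointJ !scalerA mulrC.
  by rewrite /taylor_act /= mulrAC scalerA.
case: (Z.eqb _ _); last first.
  rewrite big_nil; case: u; last by rewrite scaler0.
  by rewrite big1 ?scaler0 // => r _; rewrite scaler0.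
rewrite big_seq1 /=; have -> : zval K (Z.opp (Z.mul c n)) = zval K c * zval K (Z.opp n).
  by rewrite !zvalN zvalM mulrN.
case: u.
  rewrite (taylor_act_large phiB _ ltN) //= mulrAC -[LHS]scalerA; congr (_ *: _).
  rewrite scaler_sumr; apply: eq_bigr => r _.
  by rewrite op_pointK !scalerA mulrC.
by rewrite /taylor_act /= mulrAC scalerA.
Qed.

Lemma combo_contraction c a m b n u k v :
  combo 0 op (contraction c 0 a m b n u k) v = zval K c *: current a m b n k v.
Proof.
have opu m' p a' : op (Cur u m' p a') v = op (Cur false m' p a') v.
  by case: (u); [exact: op_pointJ|].
have opk p : op (Cen u p) v = op (Cen false p) v by case: (u); [exact: op_pointK|].
rewrite /combo /contraction /current; case: (cross a b) => [[s d]|].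
  by rewrite big_seq1 /= expr0 mulr1 opu zvalM scalerA.
case: (Z.eqb _ _); last by rewrite big_nil scaler0.
by rewrite big_seq1 /= expr0 mulr1 opk !zvalN zvalM scalerA mulrN.
Qed.

Lemma op_cur_comm u m p a v n q b w :
  op (Cur u m p a) (op (Cur v n q b) w) =
  op (Cur v n q b) (op (Cur u m p a) w) - current a m b n (p + q + 1) w.
Proof. by rewrite op_comm combo_contraction -[zval K _]/(-1) scaleN1r. Qed.

Lemma op_cen_comm u p g w : op (Cen u p) (op g w) = op g (op (Cen u p) w).
Proof. by rewrite op_comm /combo big_nil addr0. Qed.

Lemma taylor_act_act phi (k : int) N g h : tail_bounded phi ->
  k + B%:Z < N%:Z -> letter_point g -> letter_point h ->
  taylor_act g (taylor_act h phi) k = \sum_(r < N) \sum_(s < N)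
    ('C(letter_order g + r, r) * 'C(letter_order h + s, s))%:R *:
    op (letter_shift r g) (op (letter_shift s h) (phi (k - r%:Z - s%:Z))).
Proof.
move=> phiB ltN gw hw.
have ltNr (r : nat) : k - r%:Z + B%:Z < N%:Z by lia.
rewrite (taylor_act_large (taylor_act_bounded h phiB) gw ltN).
apply: eq_bigr => r _; rewrite (taylor_act_large phiB hw (ltNr r)) op_sum scaler_sumr.
by apply: eq_bigr => s _; rewrite opZ scalerA natrM.
Qed.

Lemma taylor_act_central u p f phi (k : int) : tail_bounded phi ->
  taylor_act (Cen u p) (taylor_act f phi) k
  = taylor_act f (taylor_act (Cen u p) phi) k.
Proof.
move=> phiB; pose N := (absz (k + B%:Z)).+1.
have ltN : k + B%:Z < N%:Z by rewrite /N; lia.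
have z g psi : ~~ letter_point g -> taylor_act g psi k = op g (psi k).
  by rewrite /taylor_act => /negbTE ->.
case: u; case fw: (letter_point f).
- rewrite !(taylor_act_act phiB ltN) // exchange_big; apply: eq_bigr => r _.
  apply: eq_bigr => s _; rewrite mulnC op_cen_comm.
  by rewrite [k - s%:Z - r%:Z]addrAC.
- rewrite (z f) ?fw // !(taylor_act_large _ _ ltN) //; last exact: taylor_act_bounded.
  rewrite op_sum; apply: eq_bigr => r _; rewrite opZ -op_cen_comm.
  by rewrite /taylor_act fw.
- rewrite (z (Cen false p)) // !(taylor_act_large _ _ ltN) //; last exact: taylor_act_bounded.
  by rewrite op_sum; apply: eq_bigr => r _; rewrite opZ op_cen_comm.
by rewrite !z ?fw // op_cen_comm.
Qed.

(** Collecting the products of two Taylor series by total degree gives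
[bin_convolution]. *)
Lemma taylor_bracket_ww m p a n q b phi (k : int) : tail_bounded phi ->
  taylor_act (Cur true m p a) (taylor_act (Cur true n q b) phi) k
  = taylor_act (Cur true n q b) (taylor_act (Cur true m p a) phi) k
  + \sum_(t <- contraction (Zneg xH) 0 a m b n true (p + q + 1))
    (zval K t.1.1 * (-1) ^+ t.1.2) *: taylor_act t.2 phi (k + t.1.2%:Z).
Proof.
move=> phiB; pose N := (absz (k + B%:Z)).+1.
have ltN : k + B%:Z < N%:Z by rewrite /N; lia.
have E := taylor_act_act phiB ltN.
rewrite !E // (@taylor_contraction _ _ _ _ _ _ _ _ phi _ (N)%N phiB); last by rewrite addr0.
rewrite expr0 mulr1 addr0 -[zval K _]/(-1) scaleN1r [X in _ = X + _]exchange_big /=.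
pose F r s : V := ('C(p + r, r) * 'C(q + s, s))%:R *:
  current a m b n (p + q + 1 + (r + s)) (phi (k - (r + s)%N%:Z)).
transitivity (\sum_(r < N) \sum_(s < N) (('C(q + s, s) * 'C(p + r, r))%:R *:
  op (Cur true n (q + s) b) (op (Cur true m (p + r) a) (phi (k - s%:Z - r%:Z))) - F r s)).
  apply: eq_bigr => r _; apply: eq_bigr => s _.
  rewrite op_cur_comm scalerBr mulnC [k - s%:Z - r%:Z]addrAC; congr (_ - _ *: _).
    by rewrite mulnC.
  by congr (current _ _ _ _ _ (phi _)); lia.
rewrite (eq_bigr _ (fun r _ => sumrB _ _ _ _)) sumrB; congr (_ - _).
rewrite sum_diagonals; last first.
  move=> r s leN; rewrite /F phiB; last by lia.
  have -> : current a m b n (p + q + 1 + (r + s)) 0 = 0.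
    rewrite /current; case: (cross a b) => [[? ?]|]; first by rewrite op0 scaler0.
    by case: ifP => // _; rewrite op0 scaler0.
  by rewrite scaler0.
apply: eq_bigr => t _; rewrite -bin_convolution natr_sum scaler_suml.
apply: eq_bigr => r _; rewrite /F subnKC //; exact: ltnSE (ltn_ord r).
Qed.

(** Comparing the coefficients of F^{(i)} on the two sides gives the identity
[alternating_bin] for each i: the first sum of [bracket_across] accounts for
i <= p, its second sum is a Taylor expansion, and the commutator with the Taylor
series of the letter at w starts at i = p + 1. *)
Lemma taylor_bracket_zw m p a n q b phi (k : int) : tail_bounded phi ->
  taylor_act (Cur false m p a) (taylor_act (Cur true n q b) phi) k
  = taylor_act (Cur true n q b) (taylor_act (Cur false m p a) phi) k
  + \sum_(t <- bracket_across a p m b q n)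
    (zval K t.1.1 * (-1) ^+ t.1.2) *: taylor_act t.2 phi (k + t.1.2%:Z).
Proof.
move=> phiB; pose N := (absz (k + B%:Z) + (p + q + 1)).+1.
have current0 j : current a m b n j 0 = 0.
  rewrite /current; case: (cross a b) => [[? ?]|]; first by rewrite op0 scaler0.
  by case: ifP => // _; rewrite op0 scaler0.
(* the coefficient of F^{(i)} involves phi only at the exponent M - i *)
pose M := k + (p + q + 1)%N%:Z.
pose G i : V := current a m b n i (phi (M - i%:Z)).
have G0 i : (N <= i)%N -> G i = 0.
  by move=> leN; rewrite /G phiB ?current0 //; rewrite /M; lia.
have left : taylor_act (Cur false m p a) (taylor_act (Cur true n q b) phi) k
    = taylor_act (Cur true n q b) (taylor_act (Cur false m p a) phi) k
      - \sum_(i < N) ((p < i)%N%:R * ('C(i - p.+1, q))%:R) *: G i.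
  pose N' := (absz (k + B%:Z)).+1.
  have ltN : k + B%:Z < N'%:Z by rewrite /N'; lia.
  rewrite (@taylor_act_large (Cur true n q b) _ k N'
    (taylor_act_bounded (Cur false m p a) phiB) isT ltN).
  have -> psi : taylor_act (Cur false m p a) psi k = op (Cur false m p a) (psi k) by [].
  rewrite (taylor_act_large phiB _ ltN) // op_sum.
  have -> : \sum_(i < N) ((p < i)%N%:R * ('C(i - p.+1, q))%:R) *: G i
      = \sum_(r < N') ('C(q + r, r))%:R *: G (p + q + 1 + r).
    have -> : N = ((p + q + 1) + N')%N by rewrite /N /N'; lia.
    rewrite big_split_ord /= [X in X + _]big1 ?add0r => [|i _]; last first.
      case: (ltnP p i) => lt; last by rewrite mul0r scale0r.
      by rewrite bin_small ?mulr0 ?scale0r //; have := ltn_ord i; lia.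
    apply: eq_bigr => r _; have -> : (p < p + q + 1 + r)%N by lia.
    have -> : (p + q + 1 + r - p.+1 = q + r)%N by lia.
    by rewrite mul1r -(bin_sub (leq_addl q r)) addnK.
  rewrite -sumrB; apply: eq_bigr => r _ /=.
  rewrite opZ op_cur_comm scalerBr /taylor_act /=; congr (_ - _ *: _).
  rewrite /G; congr (current _ _ _ _ _ (phi _)); [lia|rewrite /M; lia].
rewrite left; congr (_ + _); rewrite /bracket_across big_cat !big_flatten !big_map.
rewrite -[iota 0 p.+1]/(index_iota 0 p.+1) -[iota 0 q.+1]/(index_iota 0 q.+1) !big_mkord.
have sgnE j : zval K (zsign j) = (-1) ^+ j by rewrite -signr_odd /zsign; case: odd.
have binE i j : zval K (zbin i j) = ('C(i, j))%:R by exact: zval_nat.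
have cast i j : ((-1) ^+ i * j%:R : int)%:~R = (-1) ^+ i * j%:R :> K.
  by rewrite rmorphM rmorphXn rmorphN1 rmorph_nat.
have first : \sum_(j < p.+1) \sum_(t <- contraction (Z.mul (zsign (p + 1 - j)) (zbin (p + q - j) q))
      (p + q + 1 - j) a m b n false j)
    (zval K t.1.1 * (-1) ^+ t.1.2) *: taylor_act t.2 phi (k + t.1.2%:Z)
  = \sum_(i < N) ((i <= p)%N%:R * ((-1) ^+ q * ('C(p + q - i, q))%:R)) *: G i.
  have -> : N = (p.+1 + (N - p.+1))%N by rewrite /N; lia.
  rewrite big_split_ord /= [X in _ = _ + X]big1 ?addr0 => [|i _]; last first.
    by rewrite leqNgt ltnS leq_addr mul0r scale0r.
  apply: eq_bigr => j _; have le_jp := ltnSE (ltn_ord j).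
  rewrite (@taylor_contraction _ _ _ _ _ _ _ _ phi _ (N)%N phiB); last by rewrite /N; lia.
  rewrite zvalM sgnE binE le_jp mul1r /G; congr (_ *: current _ _ _ _ _ (phi _)); last by rewrite /M; lia.
  rewrite mulrAC -exprD; congr (_ * _).
  have -> : (p + 1 - j + (p + q + 1 - j) = q + (p + 1 - j) * 2)%N by lia.
  by rewrite exprD exprM sqrr_sign mulr1.
have second : \sum_(j < q.+1) \sum_(t <- contraction (Z.mul (zsign p) (zbin (p + q - j) p))
      (p + q + 1 - j) a m b n true j)
    (zval K t.1.1 * (-1) ^+ t.1.2) *: taylor_act t.2 phi (k + t.1.2%:Z)
  = \sum_(i < N) (\sum_(j < q.+1)
      (-1) ^+ (q + 1 - j) * ('C(p + q - j, p) * 'C(i, j))%:R) *: G i.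
  under [RHS]eq_bigr do rewrite scaler_suml.
  rewrite exchange_big; apply: eq_bigr => j _ /=; have le_jq := ltnSE (ltn_ord j).
  have [N2 NE ltN2] : exists2 N2, N = (j + N2)%N &
      k + (p + q + 1 - j)%N%:Z + B%:Z < N2%:Z.
    by exists (N - j)%N; rewrite /N; lia.
  rewrite (@taylor_contraction _ _ _ _ _ _ _ _ phi _ N2 phiB ltN2) zvalM sgnE binE scaler_sumr NE.
  rewrite big_split_ord /= [X in _ = X + _]big1 ?add0r => [|i _]; last first.
    by rewrite [X in (_ * X)%N]bin_small // muln0 mulr0 scale0r.
  apply: eq_bigr => r _; rewrite scalerA /G; congr (_ *: current _ _ _ _ _ (phi _)).
    rewrite natrM -(bin_sub (leq_addr r j)) addKn mulrA; congr (_ * _).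
    rewrite mulrAC -exprD; congr (_ * _).
    have -> : (p + (p + q + 1 - j) = q + 1 - j + p * 2)%N by lia.
    by rewrite exprD exprM sqrr_sign mulr1.
  by rewrite /M; lia.
rewrite first second -[RHS]big_split -sumrN; apply: eq_bigr => i _ /=.
rewrite -scalerDl -scaleNr; congr (_ *: _).
have -> : \sum_(j < q.+1) (-1) ^+ (q + 1 - j) * ('C(p + q - j, p) * 'C(i, j))%:R
  = - (\sum_(j < q.+1) (-1) ^+ (q - j) * ('C(p + q - j, p) * 'C(i, j))%:R : int)%:~R :> K.
  rewrite rmorph_sum -sumrN; apply: eq_bigr => j _; have le_jq := ltnSE (ltn_ord j).
  rewrite [X in _ = - X]cast -mulNr; congr (_ * _).
  by rewrite addn1 subSn // exprS mulN1r.
rewrite alternating_bin ltnNge; case: leqP => _.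
  by rewrite mul0r oppr0 mul1r cast subrr.
by rewrite mul1r mul0r add0r rmorph_nat.
Qed.

(** Since x = (z-w)^{-1} = -1/t, multiplication by x^e is the shift of exponents
by e with the sign (-1)^e. *)
Lemma taylor_bracket g h phi (k : int) : tail_bounded phi ->
  taylor_act g (taylor_act h phi) k = taylor_act h (taylor_act g phi) k
  + \sum_(t <- bracket_two g h)
    (zval K t.1.1 * (-1) ^+ t.1.2) *: taylor_act t.2 phi (k + t.1.2%:Z).
Proof.
move=> phiB; have cen u p f := taylor_act_central u p f k phiB.
case: g h => [u m p a|u p] [v n q b|v q].
- case: u v => [] [] /=; [exact: taylor_bracket_ww| |exact: taylor_bracket_zw|].
    rewrite big_map [in RHS]taylor_bracket_zw // -addrA.
    rewrite [X in _ + X](_ : _ = 0) ?addr0 // -big_split big1 // => t _ /=.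
    by rewrite zvalN mulNr scaleNr addrN.
  rewrite (@taylor_contraction _ _ _ _ _ _ _ _ phi _ (absz (k + B%:Z)).+1 phiB); last by lia.
  rewrite /taylor_act /= op_cur_comm expr0 mulr1 addr0 -[zval K _]/(-1).
  by rewrite scaleN1r.
- by rewrite cen /= big_nil addr0.
- by rewrite cen /= big_nil addr0.
- by rewrite cen /= big_nil addr0.
Qed.

End TaylorBracket.

(** * Laurent expansion of elements of the free algebra *)

Section WordExpansion.
Variables (C : comNzRingType) (G : choiceType) (V : lmodType C).
Local Notation A := {poly C}.
Local Notation F := (free_alg A G).
Variable lw : seq G -> int -> V.

(** The coefficient of t^n in c phi, for c in C[(z-w)^{-1}] with (z-w)^{-1} = -1/t. *)
Definition poly_expand (c : A) (phi : int -> V) (n : int) : V :=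
  \sum_(k < size c) ((-1) ^+ k * c`_k) *: phi (n + k%:Z).

Lemma poly_expandE (c : A) phi n N : (size c <= N)%N ->
  poly_expand c phi n = \sum_(k < N) ((-1) ^+ k * c`_k) *: phi (n + k%:Z).
Proof.
move=> le; rewrite /poly_expand.
rewrite (big_ord_widen N (fun k => ((-1) ^+ k * c`_k) *: phi (n + k%:Z)) le).
rewrite big_mkcond /=; apply: eq_bigr => k _; case: ltnP => // le_ck.
by rewrite nth_default // mulr0 scale0r.
Qed.

Lemma poly_expandD (c d : A) phi n :
  poly_expand (c + d) phi n = poly_expand c phi n + poly_expand d phi n.
Proof.
pose N := maxn (size c) (size d).
rewrite (@poly_expandE _ _ _ N) ?size_polyD // (@poly_expandE c _ _ N) ?leq_maxl //.
rewrite (@poly_expandE d _ _ N) ?leq_maxr // -big_split; apply: eq_bigr => k _ /=.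
by rewrite coefD mulrDr scalerDl.
Qed.

Lemma poly_expand0 phi n : poly_expand 0 phi n = 0.
Proof. by rewrite /poly_expand size_poly0 big_ord0. Qed.

Lemma poly_expand_polyC a phi n : poly_expand a%:P phi n = a *: phi n.
Proof.
rewrite (@poly_expandE _ _ _ 1) ?size_polyC_leq1 // big_ord_recl big_ord0 addr0.
by rewrite expr0 mul1r coefC /= addr0.
Qed.

Lemma poly_expandX (c : A) phi n :
  poly_expand (c * 'X) phi n = - poly_expand c phi (n + 1).
Proof.
rewrite (@poly_expandE _ _ _ (size c).+1); last first.
  by rewrite (leq_trans (size_polyMleq _ _)) // size_polyX addn2.
rewrite big_ord_recl coefMX mulr0 scale0r add0r /poly_expand -sumrN.
apply: eq_bigr => k _; rewrite coefMX /= exprS mulN1r mulNr scaleNr.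
by congr (- (_ *: phi _)); rewrite -addrA -intS.
Qed.

Lemma poly_expandM (c d : A) phi n :
  poly_expand (c * d) phi n = poly_expand c (poly_expand d phi) n.
Proof.
elim/poly_ind: c n => [|c a IH] n; first by rewrite mul0r !poly_expand0.
rewrite mulrDl !poly_expandD mulrAC !poly_expandX IH poly_expand_polyC.
congr (_ + _); rewrite mul_polyC (@poly_expandE _ _ _ (size d)) ?size_scale_leq //.
rewrite /poly_expand scaler_sumr; apply: eq_bigr => k _.
by rewrite coefZ scalerA mulrCA.
Qed.

Definition expand (f : F) (n : int) : V :=
  \sum_(m <- msupp f) poly_expand f@_m (lw m) n.

Lemma expandEw (s : {fset {fmonom G}}) (f : F) n : (msupp f `<=` s)%fset ->
  expand f n = \sum_(m <- s) poly_expand f@_m (lw m) n.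
Proof.
move=> le; rewrite /expand; apply: big_fset_incl => //= m _ nm.
by rewrite (mcoeff_outdom nm) poly_expand0.
Qed.

Lemma expandD f g n : expand (f + g) n = expand f n + expand g n.
Proof.
pose s := (msupp f `|` msupp g)%fset.
rewrite (@expandEw s (f + g)) ?msuppD_le // (@expandEw s f) ?fsubsetUl //.
rewrite (@expandEw s g) ?fsubsetUr // -big_split /=; apply: eq_bigr => m _.
have -> : (f + g)@_m = f@_m + g@_m by exact: mcoeffD.
exact: poly_expandD.
Qed.

Lemma expandZ c f n : expand (c *: f) n = poly_expand c (expand f) n.
Proof.
rewrite (@expandEw (msupp f) (c *: f)) ?msuppZ_le //.
transitivity (\sum_(m <- msupp f) poly_expand c (poly_expand f@_m (lw m)) n).
  apply: eq_bigr => m _; have -> : (c *: f)@_m = c * f@_m by exact: mcoeffZ.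
  exact: poly_expandM.
by rewrite /poly_expand exchange_big; apply: eq_bigr => k _; rewrite scaler_sumr.
Qed.

Lemma expandU (m : {fmonom G}) n : expand << m >> n = lw m n.
Proof.
rewrite (@expandEw [fset m]%fset) ?msuppU_le // big_seq_fset1 mcoeffUU.
by rewrite -[1]/(1%:P) poly_expand_polyC scale1r.
Qed.

Lemma expand_sum (I : Type) (r : seq I) (f : I -> F) n :
  expand (\sum_(i <- r) f i) n = \sum_(i <- r) expand (f i) n.
Proof.
apply: (big_morph (expand ^~ n)) => [g h|]; first exact: expandD.
by have := expandZ 0 0 n; rewrite scale0r poly_expand0.
Qed.

Lemma expand_genM g f n :
  expand (gen A g * f) n =
  \sum_(m <- msupp f) poly_expand f@_m (lw (g :: m)) n.
Proof.
have -> : gen A g * f = \sum_(m <- msupp f) f@_m *: (<< FMonom (g :: m) >> : F).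
  rewrite {1}[f]malg_sum mulr_sumr; apply: eq_bigr => m _.
  by rewrite free_algZr gen_monomial.
rewrite expand_sum; apply: eq_bigr => m _; rewrite expandZ.
by apply: eq_bigr => k _; rewrite expandU.
Qed.

End WordExpansion.

Section AbstractTaylor.
Variable R : realType.
Local Notation C := R[i].
Local Notation A := {poly C}.
Local Notation F := (free_alg A (symb bool)).
Variables (V : lmodType C) (phi : symb unit -> V -> V).
Hypothesis phi_linear : forall g c u v, phi g (c *: u + v) = c *: phi g u + phi g v.
Variable vac : V.
Local Notation op := (lact (@idfun C) (fun=> tt) phi).

(** The recursion of [taylor_word] for operators acting on a module. *)
Fixpoint word_laurent (s : seq (symb bool)) (n : nat) : V :=
  if s is g :: s' then
    if g.1 == ptz then phi (symb_pt tt g) (word_laurent s' n)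
    else \sum_(r < n.+1)
      (r`!%:R^-1 : C) *: phi (shift r (symb_pt tt g)) (word_laurent s' (n - r))
  else (n == 0%N)%:R *: vac.

Definition word_laurentz (s : seq (symb bool)) (n : int) : V :=
  if n is Posz l then word_laurent s l else 0.

Local Notation expand := (expand word_laurentz).

Let op_linear g c u v : op g (c *: u + v) = c *: op g u + op g v.
Proof. exact: lact_linear. Qed.
Let op0 := op0 op_linear.
Let opZ := opZ op_linear.
Let op_sum := op_sum op_linear.

(** The normalization turns the factor 1/r! of the Taylor series into a binomial
coefficient. *)
Lemma lscal_shift g r :
  lscal R g * r`!%:R^-1 = ('C(letter_order g + r, r))%:R * lscal R (letter_shift r g).
Proof.
have E p : ('C(p + r, r) * (r`! * p`!) = (p + r)`!)%N.
  by rewrite -(@bin_fact (p + r) r) ?leq_addl // addnK.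
have E' p := congr1 (fun n => n%:R : C) (E p).
have binN p : ('C(p + r, r))%:R != 0 :> C by rewrite pnatr_eq0 -lt0n bin_gt0 leq_addl.
case: g => [u m p a|u p] /=; rewrite -E !natrM; field;
  by rewrite !(fact_neq0 R) (sl2_root_neq0 R) binN.
Qed.

Lemma word_laurentz_neg s (n : int) : n < 0 -> word_laurentz s n = 0.
Proof. by case: n. Qed.

Lemma word_laurentz_cons g s (n : int) N : n < N%:Z ->
  lscal R g *: word_laurentz (lsym id g :: s) n =
  if letter_point g then
    \sum_(r < N) ('C(letter_order g + r, r))%:R
       *: op (letter_shift r g) (word_laurentz s (n - r%:Z))
  else op g (word_laurentz s n).
Proof.
have gpt : (lsym id g).1 = letter_point g by case: g.
move=> ltN; have [n0|] := ltrP n 0.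
  rewrite !word_laurentz_neg // scaler0; case: (letter_point g); last by rewrite op0.
  by rewrite big1 // => r _; rewrite word_laurentz_neg ?op0 ?scaler0 //; lia.
case: n ltN => // n ltN _.
rewrite /= gpt; case gp : (letter_point g) => /=; last first.
  by case: g gpt gp => [u m p a|u p] /= _ ->.
have {ltN} ltN : (n.+1 <= N)%N by lia.
rewrite (big_ord_widen N (fun r => (r`!%:R^-1 : C) *:
  phi (shift r (symb_pt tt (lsym id g))) (word_laurent s (n - r))) ltN) scaler_sumr big_mkcond.
apply: eq_bigr => r _; case: ltnP => [le_rn|lt_nr]; last first.
  by rewrite word_laurentz_neg ?op0 ?scaler0 //; lia.
have -> : word_laurentz s (n%:Z - r%:Z) = word_laurent s (n - r).
  by rewrite subzn // -ltnS.
rewrite scalerA lscal_shift -scalerA; congr (_ *: _).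
by case: g {gpt gp} => [u m p a|u p].
Qed.

Lemma expand_bounded f : exists B : nat, tail_bounded B (expand f).
Proof.
(* only powers of (z-w)^{-1} produce negative exponents of t *)
exists (\max_(m <- msupp f) size f@_m)%N => n nB.
rewrite /expand big_seq big1 // => m fm; rewrite /poly_expand big1 // => k _.
rewrite word_laurentz_neg ?scaler0 //.
have : (size f@_m <= \max_(m <- msupp f) size f@_m)%N by exact: leq_bigmax_seq.
by have := ltn_ord k; lia.
Qed.

(** Left multiplication by a letter expands to its action on series, since the
Taylor series of the letter does not depend on the word it multiplies. *)
Lemma expand_sgenM B g f n : tail_bounded B (expand f) ->
  expand (sgen R g * f) n = taylor_act op B g (expand f) n.
Proof.
move=> fB.
pose S := (\max_(m <- msupp f) size f@_m)%N.
pose N := (absz (n + B%:Z) + absz (n + S%:Z)).+1.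
rewrite -scalerAl expandZ poly_expand_polyC expand_genM scaler_sumr.
have step m : m \in msupp f ->
    lscal R g *: poly_expand f@_m (word_laurentz (lsym id g :: m)) n =
    if letter_point g then
      \sum_(r < N) ('C(letter_order g + r, r))%:R *:
         op (letter_shift r g) (poly_expand f@_m (word_laurentz m) (n - r%:Z))
    else op g (poly_expand f@_m (word_laurentz m) n).
  move=> fm; have leS : (size f@_m <= S)%N by exact: leq_bigmax_seq.
  rewrite /poly_expand scaler_sumr.
  transitivity (\sum_(k < size f@_m) ((-1) ^+ k * f@_m`_k) *:
      if letter_point g then
        \sum_(r < N) ('C(letter_order g + r, r))%:R *:
           op (letter_shift r g) (word_laurentz m (n + k%:Z - r%:Z))
      else op g (word_laurentz m (n + k%:Z))).
    apply: eq_bigr => k _; rewrite scalerA [lscal R g * _]mulrC -[LHS]scalerA; congr (_ *: _).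
    by apply: word_laurentz_cons; have := ltn_ord k; rewrite /N; lia.
  case: (letter_point g); last by rewrite op_sum; apply: eq_bigr => k _; rewrite opZ.
  under [LHS]eq_bigr do rewrite scaler_sumr.
  rewrite exchange_big; apply: eq_bigr => r _; rewrite op_sum scaler_sumr.
  apply: eq_bigr => k _; rewrite opZ [LHS]scalerA [RHS]scalerA [n + _ - _]addrAC.
  by congr (_ *: _); exact: mulrC.
rewrite big_seq (eq_bigr _ step) -big_seq /=.
case gp : (letter_point g); last by rewrite /taylor_act gp op_sum.
rewrite (taylor_act_large op_linear (N := N) fB gp); last by rewrite /N; lia.
rewrite exchange_big; apply: eq_bigr => r _; rewrite op_sum scaler_sumr.
by [].
Qed.

End AbstractTaylor.

Definition axis_of (a : 'I_3) : axis :=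
  match val a with 0%N => Ax1 | 1%N => Ax2 | _ => Ax3 end.

Lemma axis_ofK : cancel axis_of ord_axis.
Proof. by case=> [[|[|[|]]] //= lt]; apply: val_inj. Qed.

Lemma lsym_surj (g : symb bool) : exists l, lsym id l = g.
Proof.
case: g => u [[[a p] n]|p]; last by exists (Cen u p).
by exists (Cur u (Z_of_int n) p (axis_of a)); rewrite /= axis_ofK Z_of_intK.
Qed.

Lemma additive_commutator (L : pzRingType) (W : zmodType) (ex : L -> W) a b c y :
  {morph ex : f g / f + g} ->
  ex ((a * b - b * a - c) * y) = ex (a * (b * y)) - ex (b * (a * y)) - ex (c * y).
Proof.
move=> exD; have exN f : ex (- f) = - ex f.
  have ex0 : ex 0 = 0 by apply: (addrI (ex 0)); rewrite -exD !addr0.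
  by apply: (addrI (ex f)); rewrite -exD !subrr.
by rewrite !mulrBl !exD !exN !mulrA.
Qed.

Lemma scaled_commutator (K : comNzRingType) (L : lalgType K) (b c d : K) (g h br s : L) :
  (forall (c : K) (f g : L), f * (c *: g) = c *: (f * g)) ->
  (b * c) *: br = s -> d * (b * c) = 1 ->
  g * h - h * g - br = d *: ((b *: g) * (c *: h) - (c *: h) * (b *: g) - s).
Proof.
move=> Zr <- dE; rewrite !Zr -!scalerAl !scalerA [c * b]mulrC -!scalerBr scalerA dE.
by rewrite scale1r.
Qed.

Section AbstractTaylor.
Variable R : realType.
Local Notation C := R[i].
Local Notation A := {poly C}.
Local Notation F := (free_alg A (symb bool)).
Variables (V : lmodType C) (phi : symb unit -> V -> V).
Hypothesis phi_linear : forall g c u v, phi g (c *: u + v) = c *: phi g u + phi g v.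
Variable vac : V.
Local Notation op := (lact (@idfun C) (fun=> tt) phi).
Hypothesis op_comm : forall g h v,
  op g (op h v) = op h (op g v) + combo 0 op (bracket_one g h) v.
Hypothesis phi_vac : forall g, nonneg_mode g -> phi g vac = 0.
Local Notation lw := (word_laurentz phi vac).
Local Notation expand := (expand lw).

Let op_linear g c u v : op g (c *: u + v) = c *: op g u + op g v.
Proof. exact: lact_linear. Qed.
Let op0 := op0 op_linear.

Let expand0 n : expand 0 n = 0.
Proof. by apply: (addrI (expand 0 n)); rewrite -expandD !addr0. Qed.

Lemma expand_vanish_scale c f : (forall n, expand f n = 0) -> forall n, expand (c *: f) n = 0.
Proof.
move=> f0 n; rewrite expandZ /poly_expand big1 // => k _.
by rewrite f0 scaler0.
Qed.

Lemma gen_sgen (g : symb bool) : exists c l, gen A g = c *: sgen R l.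
Proof.
have [l <-] := lsym_surj g; exists (lscal R l)^-1%:P, l.
rewrite /sgen /lval scalerA.
have -> : (lscal R l)^-1%:P * polyCm R (lscal R l) = 1.
  by rewrite -[polyCm _ _]/((lscal R l)%:P) -polyCM mulVf ?lscal_neq0.
by rewrite scale1r.
Qed.

Lemma expand_bracket g h y n :
  expand ((sgen R g * sgen R h - sgen R h * sgen R g
    - \sum_(t <- bracket_two g h) (zval A t.1.1 * 'X ^+ t.1.2) *: sgen R t.2) * y) n = 0.
Proof.
have [B yB] := expand_bounded phi vac y.
have sB l : tail_bounded B (expand (sgen R l * y)).
  by move=> k kB; rewrite (expand_sgenM phi_linear l k yB) taylor_act_bounded.
apply: (etrans (additive_commutator (sgen R g) (sgen R h) _ y
  (fun f f' => expandD lw f f' n))).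
have E l l' : expand (sgen R l * (sgen R l' * y)) n =
    taylor_act op B l (taylor_act op B l' (expand y)) n.
  rewrite (expand_sgenM phi_linear l n (sB l')) /taylor_act.
  case: (letter_point l).
    apply: eq_bigr => r _; congr (_ *: lact _ _ _ _ _).
    exact: (expand_sgenM phi_linear l' _ yB).
  congr (lact _ _ _ _ _); exact: (expand_sgenM phi_linear l' _ yB).
have bal (a b c a' b' c' : V) : a = a' -> b = b' -> c = c' -> a' = b' + c' -> a - b - c = 0.
  by move=> -> -> -> ->; rewrite [b' + c']addrC addrK subrr.
apply: (bal _ _ _ _ _ _ (E g h) (E h g) _
  (@taylor_bracket C V op op_linear op_comm _ _ B g h (expand y) n yB)) => //.
rewrite mulr_suml; apply: etrans (expand_sum _ _ _ _) _.
apply: eq_bigr => t _; rewrite -scalerAl; apply: etrans (expandZ _ _ _ _) _.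
have -> : zval A t.1.1 * 'X ^+ t.1.2 = (zval C t.1.1)%:P * 'X ^+ t.1.2.
  by rewrite /zval rmorph_int.
apply: etrans (poly_expandM _ _ _ _) _.
apply: etrans (poly_expand_polyC _ _ _) _; rewrite -[RHS]scalerA; congr (_ *: _).
have -> : expand (sgen R t.2 * y) = taylor_act op B t.2 (expand y).
  by apply/funext => k; exact: expand_sgenM.
elim: (t.1.2) n {E} => [|k IH] n.
  by rewrite expr0 -[1]/(1%:P) poly_expand_polyC addr0 scale1r.
rewrite exprSr poly_expandX IH exprS mulN1r scaleNr.
by congr (- (_ *: taylor_act _ _ _ _ _)); lia.
Qed.

(** For the bracket relations this is [expand_bracket]; the other relations are
immediate because shifting the order p does not change the mode of a generator. *)
Lemma expand_relations f :
  relations (bracket2 R) (@nonneg_mode bool) f -> forall n, expand f n = 0.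
Proof.
elim=> [|x y _ x0 _ y0|x y _ y0|g h y|g pg] n.
- exact: expand0.
- by rewrite expandD x0 y0 addr0.
- elim/free_alg_ind: x n => [|x x' E E'|c x E|g x E] n.
  + by rewrite mul1r.
  + apply: etrans (congr1 (expand^~ n) (mulrDl x x' y)) _.
    apply: etrans (expandD _ _ _ _) _.
    exact: etrans (congr2 +%R (E n) (E' n)) (addr0 0).
  + by rewrite -scalerAl expand_vanish_scale.
  have [c [l ->]] := gen_sgen g; rewrite -mulrA -scalerAl.
  apply: expand_vanish_scale => {}n.
  rewrite (@expand_sgenM _ _ _ phi_linear vac 0); last by move=> k _.
  rewrite /taylor_act E; case: (letter_point l); last by rewrite op0.
  by rewrite big1 // => r _; rewrite E op0 scaler0.
- have [l lg] := lsym_surj g; have [k kh] := lsym_surj h.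
  have dE : ((lscal R l * lscal R k)^-1)%:P * (polyCm R (lscal R l) * polyCm R (lscal R k)) = 1.
    by rewrite -rmorphM -rmorphM mulVf ?mulf_neq0 ?lscal_neq0 // rmorph1.
  have := scaled_commutator (gen A (lsym id l)) (gen A (lsym id k)) (@free_algZr A (symb bool))
    (letter_bracket2 R l k) dE.
  rewrite -lg -kh => ->; rewrite -scalerAl; apply: expand_vanish_scale.
  exact: expand_bracket.
have E : expand (gen A g) n = lw (fmu g) n by exact: expandU.
rewrite {}E fmU; case: n => [n|n]; last by [].
have phiZ h := linear_scale (phi_linear h).
have pos r : nonneg_mode (shift r (symb_pt tt g)) by case: g pg => u [[[a p] m]|p].
rewrite /=; case: ifP => _.
  by rewrite phiZ phi_vac ?scaler0 //; case: g pg {pos} => u [[[a p] m]|p].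
by rewrite big1 // => r _; rewrite phiZ phi_vac ?scaler0 ?pos.
Qed.
End AbstractTaylor.

(** * Laurent expansion of states *)

Section TaylorMorphism.
Variables (R : realType) (V : lmodType R[i]) (phi : symb unit -> V -> V).
Variable ex : free_alg R[i] (symb unit) -> V.
Hypothesis exD : {morph ex : f g / f + g}.
Hypothesis exZ : forall c f, ex (c *: f) = c *: ex f.
Hypothesis ex_genM : forall g f, ex (gen R[i] g * f) = phi g (ex f).

Let ex0 : ex 0 = 0.
Proof. by apply: (addrI (ex 0)); rewrite -exD !addr0. Qed.

Let ex_sum (I : Type) (r : seq I) (F : I -> free_alg R[i] (symb unit)) :
  ex (\sum_(i <- r) F i) = \sum_(i <- r) ex (F i).
Proof. exact: (big_morph _ exD ex0). Qed.

Lemma morph_taylor_word s n : ex (taylor_word R s n) = word_laurent phi (ex 1) s n.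
Proof.
elim: s n => [|g s IH] n.
  by rewrite /=; case: eqP; rewrite ?scale1r ?scale0r.
rewrite /=; case: ifP => _; first by rewrite ex_genM IH.
by rewrite ex_sum; apply: eq_bigr => r _; rewrite exZ ex_genM IH.
Qed.

Lemma morph_taylor f n : ex (taylor f n) = expand (word_laurentz phi (ex 1)) f n.
Proof.
rewrite /taylor ex_sum; apply: eq_bigr => m _; rewrite ex_sum; apply: eq_bigr => k _.
rewrite exZ; congr (_ *: _); case: (n + k%:Z) => l /=; [exact: morph_taylor_word|exact: ex0].
Qed.

End TaylorMorphism.

Section Laurent.
Variable R : realType.
Local Notation C := R[i].
Local Notation A := {poly C}.
Local Notation stt1 := (state (@bracket1 R) (@nonneg_mode unit)).
Local Notation vac1 := (vac (@bracket1 R) (@nonneg_mode unit)).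
Local Notation lw := (word_laurentz (@act_gen1 R) vac1).

Lemma act_gen1_linear g c u v :
  act_gen1 (R := R) g (c *: u + v) = c *: act_gen1 g u + act_gen1 g v.
Proof. exact: act_linear. Qed.

Lemma state_taylor f n : (stt1 (taylor f n) : V1 R) = expand lw f n.
Proof.
apply: (@morph_taylor R (V1 R) (@act_gen1 R) (stt1 : _ -> V1 R)) => [g h|c g|g h].
- exact: stateD.
- exact: state_scaleE.
exact/esym/actE.
Qed.

(** The expansion vanishes on relations, so it may be computed on any
representative. *)
Lemma laurent_state f n : laurent (st f : V2 R) n = expand lw f n.
Proof.
apply: etrans (state_taylor _ _) _.
have rel0 : relations (bracket2 R) (@nonneg_mode bool) (rep (st f) - f).
  by apply/state_eq; exact: repK.
have f0 : expand lw (rep (st f) - f) n = 0.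
  apply: (expand_relations act_gen1_linear (@op1_comm R) _ rel0) => g; exact: act_pos.
have := expandD lw (rep (st f) - f) f n.
have -> : rep (st f) - f + f = rep (st f) by exact: subrK.
by move=> ->; rewrite f0 add0r.
Qed.

Lemma laurentE (v : V2 R) n : laurent v n = expand lw (rep v) n.
Proof. by rewrite -laurent_state /st repK. Qed.

Lemma laurentD (u v : V2 R) n : laurent (u + v) n = laurent u n + laurent v n.
Proof.
have -> : u + v = st (rep u + rep v).
  by rewrite /st stateD; congr (_ + _); exact/esym/repK.
by rewrite laurent_state !laurentE expandD.
Qed.

Lemma laurentZ c (v : V2 R) n : laurent (c *: v) n = poly_expand c (laurent v) n.
Proof.
have -> : c *: v = st (c *: rep v).
  by rewrite /st state_scaleE; congr (_ *: _); exact/esym/repK.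
rewrite laurent_state expandZ; congr (poly_expand _ _ _).
by apply/funext => k; rewrite laurentE.
Qed.

Lemma laurent_op2 B g (v : V2 R) n : tail_bounded B (laurent v) ->
  laurent (op2 g v) n = taylor_act (@op1 R) B g (laurent v) n.
Proof.
have E : laurent v = expand lw (rep v) by apply/funext => k; exact: laurentE.
rewrite E op2E => vB.
have -> : act (sgen R g) v = st (sgen R g * rep v) by [].
by rewrite laurent_state; exact: (expand_sgenM act_gen1_linear).
Qed.

Lemma laurent_vac n : laurent (vac2 R) n = (n == 0)%:R *: vac1.
Proof.
rewrite [vac2 R]/(st 1) laurent_state.
have -> : expand lw 1 n = lw [::] n.
  by rewrite -[1]/(<< mone >>) expandU fm1.
by case: n => [[|n]|n] //=; rewrite ?scale0r.
Qed.

End Laurent.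

(** * Singular part of the expansion of a trie *)

(** In the one-point module the letters at z and at w act in the same way; mapping
them all to z makes equal words comparable. *)
Definition letter_to_z g :=
  match g with Cur _ m p a => Cur false m p a | Cen _ p => Cen false p end.

Definition pconst (z : Z) : trie := if z is Z0 then pzero else Leaf [:: z].

(** The coefficient at index i of the action of g, where index i of a list of
length E stands for the exponent i - E. *)
Definition taylor_coef (mul : letter -> trie -> trie) g (l : seq trie) i : trie :=
  if letter_point g then
    psum [seq pscale (zbin (letter_order g + r) r) 0
                (mul (letter_to_z (letter_shift r g)) (nth pzero l (i - r)))
         | r <- iota 0 i.+1]
  else mul (letter_to_z g) (nth pzero l i).

(** The coefficients of t^{-E}, ..., t^{-1} in the expansion, provided that no power
of (z-w)^{-1} beyond the E-th occurs; then nothing lies below t^{-E}. *)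
Fixpoint laurent_tail (mul : letter -> trie -> trie) E t : seq trie :=
  match t with
  | Leaf c => mkseq (fun i => pconst (Z.mul (zsign (E - i)) (nth Z0 c (E - i)))) E
  | Node g t1 t2 =>
      let l1 := laurent_tail mul E t1 in
      let l2 := laurent_tail mul E t2 in
      mkseq (fun i => padd (taylor_coef mul g l1 i) (nth pzero l2 i)) E
  end.

Fixpoint pole_bounded E t :=
  match t with
  | Leaf c => (size c <= E.+1)%N
  | Node _ t1 t2 => pole_bounded E t1 && pole_bounded E t2
  end.

Section LaurentTail.
Variables (C : comNzRingType) (V : lmodType C) (W : lmodType {poly C}).
Variables (op : letter -> V -> V) (opW : letter -> W -> W) (vac : V) (vacW : W).
Variable lau : W -> int -> V.
Hypothesis op_linear : forall g c u v, op g (c *: u + v) = c *: op g u + op g v.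
Hypothesis op_z : forall g v, op (letter_to_z g) v = op g v.
Hypothesis lauD : forall u v n, lau (u + v) n = lau u n + lau v n.
Hypothesis lauZ : forall c v n, lau (c *: v) n = poly_expand c (lau v) n.
Hypothesis lau_vac : forall n, lau vacW n = (n == 0)%:R *: vac.
Hypothesis lau_op : forall B g v n, tail_bounded B (lau v) ->
  lau (opW g v) n = taylor_act op B g (lau v) n.
Variable mul : letter -> trie -> trie.
Hypothesis mulE : forall g t, peval 0 op vac (mul g t) = op g (peval 0 op vac t).

Local Notation evalW := (peval 'X opW vacW).
Local Notation eval := (peval 0 op vac).

Lemma poly_expand_cval c n : poly_expand (cval 'X c) (lau vacW) n =
  (if n <= 0 then (-1) ^+ absz n * zval C (nth Z0 c (absz n)) else 0) *: vac.
Proof.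
elim: c n => [|z c IH] n /=.
  by rewrite poly_expand0 nth_nil mulr0 if_same scale0r.
rewrite poly_expandD [_ * cval _ _]mulrC poly_expandX IH.
have -> : zval {poly C} z = (zval C z)%:P by rewrite /zval rmorph_int.
rewrite poly_expand_polyC lau_vac -scaleNr scalerA -scalerDl; congr (_ *: _).
have [->|n0] := eqVneq n 0; first by rewrite /= oppr0 addr0 mulr1 expr0 mul1r.
rewrite mulr0 add0r; case: (lerP n 0) => [le_n0|gt_n0].
  have -> : n + 1 <= 0 by lia.
  have -> : absz n = (absz (n + 1)).+1 by lia.
  by rewrite exprS mulN1r mulNr.
have -> : (n + 1 <= 0) = false by lia. 
exact: oppr0.
Qed.

Lemma laurent_tail_size E t : size (laurent_tail mul E t) = E.
Proof. by case: t => *; rewrite /= size_mkseq. Qed.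

Lemma pconstE z : eval (pconst z) = zval C z *: vac.
Proof. by case: z => [|p|p] /=; rewrite ?mul0r ?addr0. Qed.

Lemma laurent_tail_eval E t : pole_bounded E t ->
  tail_bounded E (lau (evalW t)) /\
  forall i, (i < E)%N -> lau (evalW t) (i%:Z - E%:Z) = eval (nth pzero (laurent_tail mul E t) i).
Proof.
elim: t => [c|g t1 IH1 t2 IH2] /=.
  move=> le_cE; split => [n nB|i ltiE]; rewrite lauZ poly_expand_cval.
    by case: ifP => _; rewrite ?nth_default ?mulr0 ?scale0r //; lia.
  rewrite nth_mkseq // pconstE zvalM zval_sign; have -> : i%:Z - E%:Z <= 0 by lia.
  by have -> : absz (i%:Z - E%:Z) = (E - i)%N by lia.
case/andP=> /IH1 [B1 E1] /IH2 [B2 E2]; split => [n nB|i ltiE].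
  by rewrite lauD (lau_op _ _ B1) (taylor_act_bounded op_linear g B1) // B2 // addr0.
rewrite nth_mkseq // lauD (lau_op _ _ B1) (peval_add 0 op_linear) -E2 //; congr (_ + _).
rewrite /taylor_coef; case gp: (letter_point g); last by rewrite /taylor_act gp mulE op_z E1.
rewrite (@taylor_act_large _ _ _ op_linear _ _ _ _ i.+1 B1 gp); last by lia.
rewrite (peval_sum 0 op_linear) big_map -[iota 0 i.+1]/(index_iota 0 i.+1) big_mkord.
apply: eq_bigr => r _; have le_ri := ltnSE (ltn_ord r).
rewrite (peval_scale 0 op_linear) mulE op_z expr0 mulr1 /zbin zval_nat -E1; last by lia.
by congr (_ *: op _ (lau _ _)); lia.
Qed.

End LaurentTail.

(** * Modes of states *)

(** A series known to be finite may be cut at any index after which its terms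
vanish. *)
Lemma finite_series_trunc (K : comNzRingType) (V : lmodType K) (u : nat -> V) s N :
  finite_series u s -> (forall j, (N <= j)%N -> u j = 0) -> s = \sum_(j < N) u j.
Proof.
case=> N0 sE u0; rewrite -(sE (maxn N0 N) (leq_maxl _ _)).
rewrite (big_ord_widen (maxn N0 N) u (leq_maxr _ _)) [RHS]big_mkcond /=.
by apply: eq_bigr => j _; case: ltnP => // /u0.
Qed.

Lemma sum_iota (V : nmodType) N (F : nat -> V) :
  \sum_(j <- iota 0 N) F j = \sum_(j < N) F j.
Proof. by rewrite -[N in iota 0 N]subn0 -/(index_iota 0 N) big_mkord. Qed.

Definition letter_mode g : Z := if g is Cur _ m _ _ then m else Z0.
Definition word_mode (w : seq letter) : Z :=
  foldr (fun g m => Z.add (letter_mode g) m) Z0 w.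

Lemma word_mode_cat s t : word_mode (s ++ t) = Z.add (word_mode s) (word_mode t).
Proof. by elim: s => //= g s ->; lia. Qed.

Lemma bracket_two_mode g h :
  all (fun t => Z.eqb (letter_mode t.2) (Z.add (letter_mode g) (letter_mode h)))
    (bracket_two g h).
Proof.
have contr c e a m b n u j :
    all (fun t => Z.eqb (letter_mode t.2) (Z.add m n)) (contraction c e a m b n u j).
  rewrite /contraction; case: (cross a b) => [[s d]|] /=; first by rewrite Z.eqb_refl.
  by case: (Z.eqb_spec (Z.add m n) Z0) => //= ->.
have flat (I : Type) (r : seq I) z F : (forall i, all (fun t => Z.eqb (letter_mode t.2) z) (F i)) ->
    all (fun t : Z * nat * letter => Z.eqb (letter_mode t.2) z) (flatten [seq F i | i <- r]).
  by move=> aF; elim: r => //= i r IH; rewrite all_cat aF.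
have across a p m b q n :
    all (fun t => Z.eqb (letter_mode t.2) (Z.add m n)) (bracket_across a p m b q n).
  by rewrite all_cat !flat.
case: g h => [u m p a|u p] [v n q b|v q] //.
case: u v => [] []; [exact: contr| |exact: across|exact: contr].
by rewrite all_map Z.add_comm; exact: across.
Qed.

Section OperatorPolynomial.
Local Open Scope Z_scope.
Variable mul : letter -> trie -> trie.

(** An operator polynomial for the n-th mode of the state w|0>, valid on states of
weight at most d.  With k = -m-1, the field of J_m|0> is 1/k! times the k-th
derivative of a current, whose modes are those of the current times C(k+j, k)
(creation part) or (-1)^k C(j, k) (annihilation part), and the two sums are those of the normally ordered product;
their ranges are cut where the terms vanish for reasons of weight. *)
Fixpoint mode_trie (w : seq letter) (n d : Z) : trie :=
  match w with
  | [::] => if n =? -1 then pone else pzero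
  | Cen u p :: w' => mul (Cen u p) (mode_trie w' n d)
  | Cur u m p a :: w' =>
      let k := Z.to_nat (- m - 1) in
      padd
        (psum [seq pscale (zbin (k + j) k) 0
                 (mul (Cur u (m - Z.of_nat j) p a) (mode_trie w' (n + Z.of_nat j) d))
              | j <- iota 0 (Z.to_nat (d - word_mode w' - n))])
        (psum [seq let l := Z.of_nat j + m + 1 in
                 pscale (zsign k * zbin j k) 0
                   (papply mul (mode_trie w' (n - 1 - Z.of_nat j) (d - l))
                      (Node (Cur u l p a) pone pzero))
              | j <- iota 0 (Z.to_nat (d - m))])
  end.

End OperatorPolynomial.

Section Weights.
Variables (K : comNzRingType) (V : lmodType K) (x : K) (op : letter -> V -> V).
Variable vac : V.
Hypothesis op_linear : forall g c u v, op g (c *: u + v) = c *: op g u + op g v.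
Hypothesis op_comm : forall g h v,
  op g (op h v) = op h (op g v) + combo x op (bracket_two g h) v.
Hypothesis op_kill : forall g, annihilates g -> op g vac = 0.
Let op0 := op0 op_linear.
Let opD := opD op_linear.
Let opZ := opZ op_linear.

Local Notation word w v := (foldr op v w).

(** Operators of total mode larger than d lower the weight below zero.  This
substitute for the grading needs no construction of graded components. *)
Definition weight_le (d : Z) v := forall w, Z.lt d (word_mode w) -> word w v = 0.

Let word_linear w c u v : word w (c *: u + v) = c *: word w u + word w v.
Proof. by elim: w => //= g w ->; rewrite op_linear. Qed.

Lemma weight_le_linear d c u v :
  weight_le d u -> weight_le d v -> weight_le d (c *: u + v).
Proof. by move=> du dv w lt; rewrite word_linear du ?dv // scaler0 addr0. Qed.

Lemma weight_le0 d : weight_le d 0.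
Proof. by move=> w _; elim: w => //= g w ->; exact: op0. Qed.

Lemma weight_leD d u v : weight_le d u -> weight_le d v -> weight_le d (u + v).
Proof. by move=> du dv; rewrite -[u]scale1r; exact: weight_le_linear. Qed.

Lemma weight_leZ d c u : weight_le d u -> weight_le d (c *: u).
Proof. by move=> du; rewrite -[_ *: _]addr0; apply: weight_le_linear => //; exact: weight_le0. Qed.

Lemma weight_le_sum d (I : Type) (r : seq I) (F : I -> V) :
  (forall i, weight_le d (F i)) -> weight_le d (\sum_(i <- r) F i).
Proof. by move=> dF; elim/big_ind: _ => [|u v|i _] //; [exact: weight_le0|exact: weight_leD]. Qed.

Lemma weight_leW d e v : weight_le d v -> Z.le d e -> weight_le e v.
Proof. by move=> dv le w lt; apply: dv; lia. Qed.

Lemma weight_le_op d g v : weight_le d v -> weight_le (Z.sub d (letter_mode g)) (op g v).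
Proof.
move=> dv w lt; rewrite -[op g v]/(word [:: g] v) -foldr_cat; apply: dv.
by rewrite word_mode_cat /=; lia.
Qed.

Lemma weight_lt0 d v : weight_le d v -> Z.lt d Z0 -> v = 0.
Proof. by move=> dv lt; exact: (dv [::]). Qed.

(** A word of positive total mode contains a letter of positive mode; moving it to
the right until it kills the vacuum produces shorter words of the same total
mode. *)
Lemma weight_le_vac : weight_le Z0 vac.
Proof.
move=> w; have [n] := ubnP (size w); elim: n w => // n IH w size_w pos.
(* a letter of positive mode exists because the total mode is positive *)
have [s1 [g [s2 [wE gpos]]]] :
    exists s1 g s2, w = s1 ++ g :: s2 /\ Z.lt Z0 (letter_mode g).
  elim: w pos {size_w} => [|h w IHw] /=; first by lia.
  case: (Z.ltb_spec Z0 (letter_mode h)) => [lt _|le pos].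
    by exists [::], h, w.
  by have [|s1 [g [s2 [-> gpos]]]] := IHw; [lia|exists (h :: s1), g, s2].
rewrite {}wE in size_w pos *.
elim: s2 s1 size_w pos => [|h s2 IH2] s1 size_w pos.
  rewrite foldr_cat /= op_kill; last by case: g gpos {size_w pos} => //= u m p a; lia.
  by elim: (s1) => //= k s ->; exact: op0.
have zero s t : (size (s ++ t :: s2) < n)%N ->
    word_mode (s ++ t :: s2) = word_mode (s1 ++ g :: h :: s2) -> word (s ++ t :: s2) vac = 0.
  by move=> lt E; apply: IH => //; rewrite E.
have -> : word (s1 ++ g :: h :: s2) vac =
    word ((s1 ++ [:: h]) ++ g :: s2) vac
    + word s1 (combo x op (bracket_two g h) (word s2 vac)).
  rewrite -catA !foldr_cat /= op_comm; move: (op h _) (combo _ _ _ _) => y z.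
  by rewrite -[y]scale1r word_linear !scale1r.
rewrite IH2; first last.
- by move: pos; rewrite !word_mode_cat /=; lia.
- by move: size_w; rewrite !size_cat /=; lia.
rewrite add0r /combo; have := bracket_two_mode g h.
elim: (bracket_two g h) => [|t l IHl] /=.
  by move=> _; rewrite big_nil; elim: (s1) => //= k s ->; exact: op0.
case/andP=> /Z.eqb_spec tE /IHl {IHl} l0; rewrite big_cons word_linear l0 addr0.
have := @zero s1 t.2; rewrite foldr_cat /= => ->; first exact: scaler0.
  by move: size_w; rewrite !size_cat /=; lia.
by rewrite !word_mode_cat /= tE; lia.
Qed.

Lemma weight_le_word w : weight_le (Z.opp (word_mode w)) (word w vac).
Proof.
move=> s lt; rewrite -foldr_cat; apply: weight_le_vac.
by rewrite word_mode_cat; lia.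
Qed.

Definition creates g := if g is Cur _ m _ _ then Z.ltb m Z0 else true.

Variables (T : V -> V) (Y : V -> Z -> V -> V).
Hypothesis natr_inj : forall n (u v : V), n.+1%:R *: u = n.+1%:R *: v -> u = v.
Hypothesis T_vac : T vac = 0.
Hypothesis T_cur : forall u m p a v,
  T (op (Cur u m p a) v) = op (Cur u m p a) (T v)
    + zval K (Z.opp m) *: op (Cur u (Z.pred m) p a) v.
Hypothesis YZ : forall c X n v, Y (c *: X) n v = c *: Y X n v.
Hypothesis YvZ : forall c X n v, Y X n (c *: v) = c *: Y X n v.
Hypothesis Y_vac : forall n v, Y vac n v = if Z.eqb n (Zneg xH) then v else 0.
Hypothesis Y_cur : forall u p a n v,
  Y (op (Cur u (Zneg xH) p a) vac) n v = op (Cur u n p a) v.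
Hypothesis Y_cen : forall u p X n v, Y (op (Cen u p) X) n v = op (Cen u p) (Y X n v).
Hypothesis Y_T : forall X n v, Y (T X) n v = zval K (Z.opp n) *: Y X (Z.pred n) v.
Hypothesis Y_normal : forall X X' n v, exists s1 s2, [/\
  finite_series (fun j => Y X (Z.sub (Zneg xH) (Z.of_nat j)) (Y X' (Z.add n (Z.of_nat j)) v)) s1,
  finite_series (fun j => Y X' (Z.sub (Z.sub n (Zpos xH)) (Z.of_nat j)) (Y X (Z.of_nat j) v)) s2 &
  Y (Y X (Zneg xH) X') n v = s1 + s2].

Local Notation cur_state u k p a := (op (Cur u (Z.sub (Zneg xH) (Z.of_nat k)) p a) vac).

(** T maps J_{-1-k}|0> to (k+1) J_{-2-k}|0>, so the modes of the latter are
determined by those of the former. *)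
Lemma Y_cur_state_shift u k p a n v :
  k.+1%:R *: Y (cur_state u k.+1 p a) n v =
  zval K (Z.opp n) *: Y (cur_state u k p a) (Z.pred n) v.
Proof.
rewrite -Y_T T_cur T_vac op0 add0r YZ -zval_nat; congr (zval K _ *: Y (op (Cur u _ p a) _) n v); lia.
Qed.

Lemma Y_cur_state_neg u k p a j v :
  Y (cur_state u k p a) (Z.sub (Zneg xH) (Z.of_nat j)) v =
  ('C(k + j, k))%:R *: op (Cur u (Z.sub (Z.sub (Zneg xH) (Z.of_nat k)) (Z.of_nat j)) p a) v.
Proof.
elim: k j => [|k IH] j; first by rewrite bin0 scale1r Y_cur.
apply: (@natr_inj k); rewrite Y_cur_state_shift.
have -> : Z.pred (Z.sub (Zneg xH) (Z.of_nat j)) = Z.sub (Zneg xH) (Z.of_nat j.+1) by lia.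
have -> : Z.opp (Z.sub (Zneg xH) (Z.of_nat j)) = Z.of_nat j.+1 by lia.
rewrite IH zval_nat !scalerA -!natrM; congr (_%:R *: op (Cur u _ p a) v); last by lia.
by rewrite mul_bin_left addSnnS addKn.
Qed.

Lemma Y_cur_state_nat u k p a j v :
  Y (cur_state u k p a) (Z.of_nat j) v =
  zval K (Z.mul (zsign k) (zbin j k)) *:
    op (Cur u (Z.sub (Z.of_nat j) (Z.of_nat k)) p a) v.
Proof.
elim: k j => [|k IH] j.
  by rewrite /zbin bin0 scale1r Y_cur; congr (op (Cur u _ p a) v); lia.
apply: (@natr_inj k); rewrite Y_cur_state_shift.
case: j => [|j]; first by rewrite /zbin bin0n /= Z.mul_0_r !scale0r scaler0.
have -> : Z.pred (Z.of_nat j.+1) = Z.of_nat j by lia.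
rewrite IH !scalerA -zval_nat -!zvalM; congr (zval K _ *: op (Cur u _ p a) v); last by lia.
have -> : zsign k.+1 = Z.opp (zsign k) by rewrite /zsign /=; case: odd.
have := congr1 (fun i => Z.mul (zsign k) (Z.of_nat i)) (mul_bin_diag j.+1 k).
rewrite /zbin [_.-1]/= !Nat2Z.inj_mul; move: (zsign k) (Z.of_nat 'C(_, _)) (Z.of_nat 'C(_, _)).
by move: (Z.of_nat k.+1) (Z.of_nat j.+1) => k1 j1 s b c; lia.
Qed.

Section CreationOperator.
Variables (u : bool) (m : Z) (p : nat) (a : axis).
Hypothesis m_neg : creates (Cur u m p a).
Let k := Z.to_nat (Z.sub (Z.opp m) (Zpos xH)).
Let mE : m = Z.sub (Zneg xH) (Z.of_nat k).
Proof. by move: m_neg; rewrite /creates /k; lia. Qed.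

Lemma Y_cur_neg j v : Y (op (Cur u m p a) vac) (Z.sub (Zneg xH) (Z.of_nat j)) v =
  zval K (zbin (k + j) k) *: op (Cur u (Z.sub m (Z.of_nat j)) p a) v.
Proof. by rewrite {1}mE Y_cur_state_neg -mE /zbin zval_nat. Qed.

Lemma Y_cur_nat j v : Y (op (Cur u m p a) vac) (Z.of_nat j) v =
  zval K (Z.mul (zsign k) (zbin j k)) *:
    op (Cur u (Z.add (Z.add (Z.of_nat j) m) (Zpos xH)) p a) v.
Proof. by rewrite {1}mE Y_cur_state_nat; congr (_ *: op (Cur u _ p a) v); lia. Qed.

(** The (-1)-st mode of the state J_m|0> is J_m itself, so every word is an iterated
normally ordered product. *)
Lemma op_cur_Y X : op (Cur u m p a) X = Y (op (Cur u m p a) vac) (Zneg xH) X.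
Proof.
have := Y_cur_neg 0 X; rewrite /zbin addn0 binn scale1r.
by rewrite !Z.sub_0_r => <-.
Qed.

End CreationOperator.

(** The n-th product with a state of weight h changes the weight by h - n - 1. *)
Lemma Y_weight w d n v : all creates w -> weight_le d v ->
  weight_le (Z.sub (Z.sub d (word_mode w)) (Z.add n (Zpos xH))) (Y (word w vac) n v).
Proof.
elim: w d n v => [|[u m p a|u p] w IH] d n v /=.
- move=> _ dv; rewrite Y_vac; case: Z.eqb_spec => [->|_]; last exact: weight_le0.
  by apply: (weight_leW dv); lia.
- case/andP=> m0 wc dv; rewrite (op_cur_Y m0).
  have [s1 [s2 [[N1 E1] [N2 E2] ->]]] := Y_normal (op (Cur u m p a) vac) (word w vac) n v.
  rewrite -(E1 N1) // -(E2 N2) //; apply: weight_leD; apply: weight_le_sum => j.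
    rewrite (Y_cur_neg m0); apply: weight_leZ.
    by apply: (weight_leW (weight_le_op (IH _ _ _ wc dv))) => /=; lia.
  rewrite (Y_cur_nat m0) YvZ; apply: weight_leZ.
  by apply: (weight_leW (IH _ _ _ wc (weight_le_op dv))) => /=; lia.
- move=> wc dv; rewrite Y_cen.
  by apply: (weight_leW (weight_le_op (IH _ _ _ wc dv))) => /=; lia.
Qed.

Variable mul : letter -> trie -> trie.
Hypothesis mulE : forall v g t, peval x op v (mul g t) = op g (peval x op v t).

Lemma mode_trieE w n d v : all creates w -> weight_le d v ->
  Y (word w vac) n v = peval x op v (mode_trie mul w n d).
Proof.
elim: w n d v => [|[u m p a|u p] w IH] n d v.
- move=> _ _; rewrite /= Y_vac; case: Z.eqb => /=; last by rewrite scale0r.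
  by rewrite zval1 mulr0 addr0 scale1r.
- case/andP=> m0 wc dv; rewrite [word (_ :: _) _]/= (op_cur_Y m0).
  have [s1 [s2 [/finite_series_trunc E1 /finite_series_trunc E2 ->]]] :=
    Y_normal (op (Cur u m p a) vac) (word w vac) n v.
  rewrite [mode_trie _ _ _ _]/= (peval_add x op_linear) !(peval_sum x op_linear) !big_map.
  rewrite !sum_iota.
  rewrite (E1 (Z.to_nat (Z.sub (Z.sub d (word_mode w)) n))); last first.
    move=> j lt; have -> : Y (word w vac) (Z.add n (Z.of_nat j)) v = 0.
      by apply: (weight_lt0 (Y_weight wc dv)); lia.
    by rewrite (Y_cur_neg m0) op0 scaler0.
  rewrite (E2 (Z.to_nat (Z.sub d m))); last first.
    move=> j lt; rewrite (Y_cur_nat m0) [X in _ *: X](_ : _ = 0).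
      by rewrite scaler0 -[X in Y _ _ X](scale0r 0) YvZ scale0r.
    by apply: (weight_lt0 (weight_le_op dv)) => /=; lia.
  congr (_ + _); apply: eq_bigr => j _.
    by rewrite (peval_scale x op_linear) mulE -(IH _ d) // (Y_cur_neg m0) mulr1.
  rewrite (peval_scale x op_linear) (peval_apply op_linear) // mulr1 (Y_cur_nat m0).
  rewrite [peval _ _ _ (Node _ _ _)]/= scale0r addr0 zval1 mulr0 addr0 scale1r.
  set l := Z.add _ _; rewrite YvZ; congr (_ *: _); apply: IH => //.
  exact: (@weight_le_op _ (Cur u l p a) _ dv).
- move=> wc dv; rewrite [word (_ :: _) _]/= Y_cen (IH _ d) //.
  by rewrite [mode_trie _ _ _ _]/= mulE.
Qed.
End Weights.

(** * The invariant states and their certificates *)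

Section Words.
Local Open Scope Z_scope.

Definition axes := [:: Ax1; Ax2; Ax3].

(** Mode numbers are given by their opposites, as only creation operators occur. *)
Definition mode n u p a := Cur u (- Z.of_nat n) p a.

Definition epsilon : seq (Z * (axis * axis * axis)) :=
  [:: (1, (Ax1, Ax2, Ax3)); (1, (Ax2, Ax3, Ax1)); (1, (Ax3, Ax1, Ax2));
      (-1, (Ax2, Ax1, Ax3)); (-1, (Ax3, Ax2, Ax1)); (-1, (Ax1, Ax3, Ax2))].

Definition quadratic_words u : seq (Z * seq letter) :=
  [seq (1, [:: mode 1 u 0 a; mode 1 u 0 a]) | a <- axes].

(** The state sigma_3 divided by 4/9, whose quartic part is the sum over a and b of
three times the words aabb, abab and abba. *)
Definition quartic_words u : seq (Z * seq letter) :=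
  flatten [seq flatten [seq
      [:: (3, [:: mode 1 u 0 a; mode 1 u 0 a; mode 1 u 0 b; mode 1 u 0 b]);
          (3, [:: mode 1 u 0 a; mode 1 u 0 b; mode 1 u 0 a; mode 1 u 0 b]);
          (3, [:: mode 1 u 0 a; mode 1 u 0 b; mode 1 u 0 b; mode 1 u 0 a])]
    | b <- axes] | a <- axes]
  ++ [seq (60 * t.1, [:: mode 2 u 0 t.2.1.1; mode 1 u 1 t.2.1.2; mode 1 u 0 t.2.2])
     | t <- epsilon]
  ++ flatten [seq
      [:: (-40, [:: mode 3 u 0 a; mode 1 u 2 a]); (60, [:: mode 2 u 2 a; mode 2 u 0 a]);
          (-20, [:: mode 3 u 1 a; mode 1 u 1 a]); (15, [:: mode 2 u 1 a; mode 2 u 1 a]);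
          (-60, [:: mode 3 u 0 a; mode 1 u 0 a; Cen u 1])]
    | a <- axes].

(** Large enough for the words sorted here; the fuel bounds the depth of the
recursion and not the number of steps. *)
Definition fuel := 1000%N.
(** Operator polynomials are applied to varying states, so no letter may be
dropped on the right end of a word. *)
Definition mul_op := lmul bracket_two (fun=> false) fuel.
Definition mul2 := lmul bracket_two annihilates fuel.
Definition mul1 := lmul bracket_one annihilates fuel.

Definition trie_of_words (mul : letter -> trie -> trie) (ws : seq (Z * seq letter)) t :=
  psum [seq pscale cw.1 0 (pword mul cw.2 t) | cw <- ws].

Definition mode_trie_of_words (ws : seq (Z * seq letter)) n d :=
  psum [seq pscale cw.1 0 (mode_trie mul_op cw.2 n d) | cw <- ws].

Definition ptranslate (mul : letter -> trie -> trie) :=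
  pderiv mul (fun=> [::])
    (fun g => if g is Cur u m p a then Some (- m, Cur u (m - 1) p a) else None).

Fixpoint strip (s : seq Z) :=
  if s is z :: s' then
    match z, strip s' with 0, [::] => [::] | _, r => z :: r end
  else [::].

(** The coefficients of sg (i + x d/dx).  With i = 0 and one more factor x this is
the derivative with respect to z or w, which maps x to -x^2 or x^2. *)
Fixpoint euler_coefs (sg : Z) (i : nat) (s : seq Z) :=
  if s is z :: s' then sg * Z.of_nat i * z :: euler_coefs sg i.+1 s' else [::].

Definition ppartial u :=
  pderiv mul2 (fun s => strip (0 :: euler_coefs (if u then 1 else -1) 0 s))
    (fun g => if letter_point g == u
              then Some (Z.of_nat (letter_order g).+1, letter_shift 1 g) else None).

Definition ptwisted u j t := padd (ppartial u t) (pscale (Z.of_nat j) 0 (mul2 (Cen u 0) t)).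

Definition psub s t := padd s (pscale (-1) 0 t).

End Words.

Section Contractions.

(** [Jz n p] and [Jw n p] stand for J^{(p)}_{-n} at z and at w, with an adjoint
index to be contracted. *)
Definition Jz n p : nat * bool * nat := (n, false, p).
Definition Jw n p : nat * bool * nat := (n, true, p).
Definition Kz p : bool * nat := (false, p).
Definition Kw p : bool * nat := (true, p).

Definition invariant_term := (Z * nat * seq (nat * bool * nat) * seq (bool * nat))%type.
(** [Inv c e js ks] is c x^e times the contraction of the currents js, times the
central elements ks.  Consecutive currents are contracted in pairs, after a
contraction of the first three with epsilon if their number is odd. *)
Definition Inv c e ls ks : invariant_term := (c, e, ls, ks).

Fixpoint pairings fuel (ls : seq (nat * bool * nat)) : seq (seq letter) :=
  match fuel, ls with
  | fuel'.+1, l :: l' :: ls' =>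
      flatten [seq [seq mode l.1.1 l.1.2 l.2 a :: mode l'.1.1 l'.1.2 l'.2 a :: w
                   | w <- pairings fuel' ls'] | a <- axes]
  | _, _ => [:: [::]]
  end.

Definition contracted_words (ls : seq (nat * bool * nat)) : seq (Z * seq letter) :=
  let n := size ls in
  match odd n, ls with
  | true, l :: l1 :: l2 :: ls' =>
      flatten [seq [seq (t.1, mode l.1.1 l.1.2 l.2 t.2.1.1 :: mode l1.1.1 l1.1.2 l1.2 t.2.1.2
                              :: mode l2.1.1 l2.1.2 l2.2 t.2.2 :: w)
                   | w <- pairings n ls'] | t <- epsilon]
  | _, _ => [seq (Zpos xH, w) | w <- pairings n ls]
  end.

Definition trie_of_term (t : invariant_term) : trie :=
  let: (c, e, ls, ks) := t in
  trie_of_words mul2 (contracted_words ls)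
    (pword mul2 [seq Cen k.1 k.2 | k <- ks] (Leaf (ncons e Z0 [:: c]))).

(** Exchange of z and w changes the sign of x. *)
Definition swap_term (t : invariant_term) : invariant_term :=
  let: (c, e, ls, ks) := t in
  (Z.mul (zsign e) c, e, [seq (l.1.1, ~~ l.1.2, l.2) | l <- ls],
   [seq (~~ k.1, k.2) | k <- ks]).

Definition trie_of_terms ts := psum [seq trie_of_term t | t <- ts].

End Contractions.

(** Given a state in the image of T, [primitive] returns a preimage.  Among words
with a fixed number of currents, T raises one mode at a time, and modulo lower
words the leading word with first letter J_{m-1} comes from the one with J_m;
words with the largest number of currents are treated first, because
straightening produces only shorter ones.  Nothing is proved about this
procedure: its results are checked by applying T to them. *)
Section Primitive.
Local Open Scope Z_scope.
Variable mul : letter -> trie -> trie.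

Fixpoint split_length k t : trie * trie :=
  match t with
  | Leaf c => if k is 0%N then (t, pzero) else (pzero, t)
  | Node h t1 t2 =>
      let r2 := split_length k t2 in
      match h, k with
      | Cur _ _ _ _, 0%N => (r2.1, Node h t1 r2.2)
      | Cur _ _ _ _, k'.+1 =>
          let r1 := split_length k' t1 in (node h r1.1 r2.1, node h r1.2 r2.2)
      | _, _ => let r1 := split_length k t1 in (node h r1.1 r2.1, node h r1.2 r2.2)
      end
  end.

Fixpoint leading t : option (seq letter * seq Z) :=
  match t with
  | Leaf [::] => None
  | Leaf c => Some ([::], c)
  | Node h t1 _ => if leading t1 is Some (w, c) then Some (h :: w, c) else None
  end.

Definition monomial w c := foldr (fun h t => Node h t pzero) (Leaf c) w.

Fixpoint multiplicity g (w : seq letter) : Z :=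
  if w is h :: w' then if cmp g h is Eq then 1 + multiplicity g w' else 0 else 0.

(** The word from which w arises as leading word under T, with its coefficient
there. *)
Definition lowered w : option (Z * seq letter) :=
  if w is Cur u m p a :: w' then
    let g := Cur u (m + 1) p a in
    if (m <=? -2) && (if w' is h :: _ then if cmp g h is Gt then false else true else true)
    then Some (- (m + 1) * (1 + multiplicity g w'), g :: w') else None
  else None.

Fixpoint primitive_step fuel k cur low acc : trie * trie :=
  if fuel is fuel'.+1 then
    if leading cur is Some (w, c) then
      if lowered w is Some (q, w') then
        let m := monomial w' [seq z / q | z <- c] in
        let r := split_length k (ptranslate mul m) in
        primitive_step fuel' k (psub cur r.1) (psub low r.2) (padd acc m)
      else primitive_step fuel' k (psub cur (monomial w c)) low acc
    else (low, acc)
  else (low, acc).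

Fixpoint primitive fuel k t acc : trie :=
  let r := split_length k t in
  let s := primitive_step fuel k r.1 r.2 acc in
  if k is k'.+1 then primitive fuel k' s.1 s.2 else s.2.

End Primitive.

Section Data.

(** The candidates below are the solutions of a linear system; they are normalized
to have integral coefficients. *)
Definition terms11 : seq invariant_term := [:: Inv (-4) 1 [:: Jz 2 0; Jw 1 0] [::]].

Definition terms13 : seq invariant_term := [::
  Inv 336 2 [:: Jw 3 0; Jw 2 1] [::];
  Inv (-80) 1 [:: Jz 3 0; Jw 2 2] [::];
  Inv (-136) 2 [:: Jz 3 0; Jw 2 1] [::];
  Inv 192 3 [:: Jz 3 0; Jw 2 0] [::];
  Inv (-240) 1 [:: Jz 3 0; Jw 2 0] [:: Kw 1];
  Inv (-72) 1 [:: Jw 2 1; Jw 2 0; Jz 1 0] [::];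
  Inv (-120) 1 [:: Jw 2 1; Jz 2 0; Jw 1 0] [::];
  Inv 240 1 [:: Jw 2 0; Jz 2 0; Jw 1 1] [::];
  Inv 24 2 [:: Jw 2 0; Jz 2 0; Jw 1 0] [::];
  Inv 144 1 [:: Jw 1 0; Jz 1 0; Jw 2 0; Jw 1 0] [::];
  Inv 72 1 [:: Jw 1 0; Jw 1 0; Jw 2 0; Jz 1 0] [::]].

Definition terms33 : seq invariant_term := [::
  Inv 670760 5 [:: Jz 4 0; Jw 3 0] [::];
  Inv (-150976) 3 [:: Jz 4 1; Jw 3 1] [::];
  Inv (-506144) 4 [:: Jz 4 1; Jw 3 0] [::];
  Inv (-34480) 1 [:: Jz 4 2; Jw 3 2] [::];
  Inv 76932 2 [:: Jz 4 2; Jw 3 1] [::];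
  Inv 20080 3 [:: Jz 4 2; Jw 3 0] [::];
  Inv (-32640) 4 [:: Jw 3 0; Jz 3 0; Jw 1 0] [::];
  Inv 167880 4 [:: Jw 3 0; Jw 2 0; Jz 2 0] [::];
  Inv 51420 2 [:: Jw 3 1; Jw 3 0; Jz 1 1] [::];
  Inv 59040 3 [:: Jw 3 1; Jw 3 0; Jz 1 0] [::];
  Inv (-305680) 1 [:: Jw 3 1; Jz 3 1; Jw 1 1] [::];
  Inv (-37340) 2 [:: Jw 3 1; Jz 3 1; Jw 1 0] [::];
  Inv 305680 1 [:: Jw 3 1; Jz 3 1; Jz 1 1] [::];
  Inv (-30480) 3 [:: Jw 3 1; Jz 3 0; Jw 1 0] [::];
  Inv (-58840) 2 [:: Jw 3 1; Jz 3 0; Jz 1 1] [::];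
  Inv (-7720) 3 [:: Jw 3 1; Jz 3 0; Jz 1 0] [::];
  Inv 10440 3 [:: Jw 3 0; Jz 3 0; Jw 1 1] [::];
  Inv (-112500) 2 [:: Jw 3 0; Jw 2 1; Jz 2 1] [::];
  Inv 103800 3 [:: Jw 3 0; Jw 2 1; Jz 2 0] [::];
  Inv (-94920) 3 [:: Jw 3 0; Jw 2 0; Jz 2 1] [::];
  Inv 51660 2 [:: Jz 3 1; Jw 2 1; Jw 2 0] [::];
  Inv 37680 3 [:: Jz 3 1; Jw 2 0; Jz 2 0] [::];
  Inv (-24600) 1 [:: Jw 3 2; Jz 3 1; Jz 1 0] [::];
  Inv 57600 1 [:: Jw 3 2; Jz 3 0; Jz 1 1] [::];
  Inv 29480 2 [:: Jw 3 2; Jz 3 0; Jz 1 0] [::];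
  Inv 4560 2 [:: Jw 3 0; Jw 2 0; Jz 2 2] [::];
  Inv 48120 1 [:: Jz 3 2; Jw 2 1; Jw 2 0] [::];
  Inv 61200 3 [:: Jw 1 0; Jz 1 0; Jw 3 0; Jw 2 0] [::];
  Inv (-39600) 3 [:: Jw 2 0; Jz 1 0; Jw 3 0; Jw 1 0] [::];
  Inv (-26880) 3 [:: Jw 2 0; Jw 1 0; Jw 3 0; Jz 1 0] [::];
  Inv (-68760) 3 [:: Jz 1 0; Jz 1 0; Jw 3 0; Jw 2 0] [::];
  Inv 43800 3 [:: Jw 2 0; Jz 1 0; Jw 3 0; Jz 1 0] [::];
  Inv (-18120) 3 [:: Jw 1 0; Jw 1 0; Jz 3 0; Jw 2 0] [::];
  Inv (-13560) 3 [:: Jw 2 0; Jw 1 0; Jz 3 0; Jw 1 0] [::];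
  Inv 11040 3 [:: Jw 1 0; Jz 1 0; Jz 3 0; Jw 2 0] [::];
  Inv (-9000) 3 [:: Jw 2 0; Jz 1 0; Jz 3 0; Jw 1 0] [::];
  Inv 4680 3 [:: Jw 2 0; Jw 1 0; Jz 3 0; Jz 1 0] [::];
  Inv 17760 3 [:: Jz 1 0; Jz 1 0; Jz 3 0; Jw 2 0] [::];
  Inv (-15120) 2 [:: Jz 1 0; Jz 1 0; Jw 3 0; Jw 2 1] [::];
  Inv 23760 2 [:: Jw 2 1; Jz 1 0; Jw 3 0; Jz 1 0] [::];
  Inv (-720) 2 [:: Jw 1 0; Jz 1 1; Jw 3 0; Jw 2 0] [::];
  Inv (-6840) 2 [:: Jw 2 0; Jz 1 1; Jw 3 0; Jw 1 0] [::];
  Inv 7560 2 [:: Jw 2 0; Jw 1 0; Jw 3 0; Jz 1 1] [::];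
  Inv 35040 2 [:: Jz 1 1; Jz 1 0; Jw 3 0; Jw 2 0] [::];
  Inv (-4560) 2 [:: Jw 2 0; Jz 1 0; Jw 3 0; Jz 1 1] [::];
  Inv (-4560) 2 [:: Jw 2 0; Jz 1 1; Jw 3 0; Jz 1 0] [::];
  Inv (-13560) 1 [:: Jw 1 0; Jz 1 0; Jz 3 1; Jw 2 1] [::];
  Inv 13560 1 [:: Jw 2 1; Jz 1 0; Jz 3 1; Jw 1 0] [::];
  Inv (-16800) 1 [:: Jw 1 1; Jz 1 0; Jz 3 1; Jw 2 0] [::];
  Inv 16800 1 [:: Jw 2 0; Jz 1 0; Jz 3 1; Jw 1 1] [::];
  Inv (-10200) 2 [:: Jw 1 0; Jw 1 0; Jz 3 1; Jw 2 0] [::];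
  Inv 9480 2 [:: Jw 2 0; Jw 1 0; Jz 3 1; Jw 1 0] [::];
  Inv 21960 2 [:: Jw 1 0; Jz 1 0; Jz 3 1; Jw 2 0] [::];
  Inv (-25920) 2 [:: Jw 2 0; Jz 1 0; Jz 3 1; Jw 1 0] [::];
  Inv 1080 2 [:: Jw 2 0; Jw 1 0; Jz 3 1; Jz 1 0] [::];
  Inv 62400 1 [:: Jw 1 0; Jz 1 1; Jz 3 0; Jw 2 1] [::];
  Inv (-62400) 1 [:: Jw 2 1; Jz 1 1; Jz 3 0; Jw 1 0] [::];
  Inv 44520 2 [:: Jw 1 0; Jz 1 0; Jz 3 0; Jw 2 1] [::];
  Inv (-39960) 2 [:: Jw 2 1; Jz 1 0; Jz 3 0; Jw 1 0] [::];
  Inv (-17520) 2 [:: Jw 2 1; Jw 1 0; Jz 3 0; Jz 1 0] [::];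
  Inv (-7200) 2 [:: Jz 1 0; Jz 1 0; Jz 3 0; Jw 2 1] [::];
  Inv (-24000) 1 [:: Jw 1 1; Jz 1 1; Jz 3 0; Jw 2 0] [::];
  Inv 24000 1 [:: Jw 2 0; Jz 1 1; Jz 3 0; Jw 1 1] [::];
  Inv (-8400) 2 [:: Jw 1 1; Jz 1 0; Jz 3 0; Jw 2 0] [::];
  Inv 12960 2 [:: Jw 2 0; Jz 1 0; Jz 3 0; Jw 1 1] [::];
  Inv (-17520) 2 [:: Jw 2 0; Jw 1 1; Jz 3 0; Jz 1 0] [::];
  Inv 33840 2 [:: Jw 1 0; Jz 1 1; Jz 3 0; Jw 2 0] [::];
  Inv (-71280) 2 [:: Jw 2 0; Jw 1 0; Jz 3 0; Jz 1 1] [::];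
  Inv 38880 1 [:: Jw 2 0; Jz 1 0; Jw 2 1; Jz 2 1] [::];
  Inv (-38880) 1 [:: Jw 2 0; Jz 2 1; Jw 2 1; Jz 1 0] [::];
  Inv (-5640) 1 [:: Jw 1 0; Jw 1 0; Jz 3 2; Jw 2 0] [::];
  Inv 2760 1 [:: Jw 2 0; Jw 1 0; Jz 3 2; Jw 1 0] [::];
  Inv (-2160) 2 [:: Jw 2 0; Jw 1 0; Jz 1 0; Jw 2 0; Jz 1 0] [::];
  Inv (-9360) 2 [:: Jz 2 0; Jw 1 0; Jz 1 0; Jw 2 0; Jw 1 0] [::];
  Inv 4320 2 [:: Jw 2 0; Jw 1 0; Jz 1 0; Jz 2 0; Jw 1 0] [::];
  Inv (-720) 2 [:: Jw 2 0; Jz 2 0; Jz 1 0; Jw 1 0; Jw 1 0] [::];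
  Inv (-1080) 1 [:: Jw 2 1; Jw 2 0; Jz 1 0; Jz 1 0; Jz 1 0] [::];
  Inv (-2520) 1 [:: Jz 2 0; Jw 1 0; Jz 1 0; Jw 2 1; Jz 1 0] [::];
  Inv 7560 1 [:: Jw 2 1; Jw 1 0; Jz 1 0; Jz 2 0; Jz 1 0] [::];
  Inv (-2520) 1 [:: Jw 2 1; Jz 2 0; Jz 1 0; Jw 1 0; Jz 1 0] [::];
  Inv 7200 1 [:: Jz 2 0; Jw 1 1; Jz 1 0; Jw 2 0; Jz 1 0] [::];
  Inv (-21600) 1 [:: Jw 2 0; Jw 1 1; Jz 1 0; Jz 2 0; Jz 1 0] [::];
  Inv 7200 1 [:: Jw 2 0; Jz 2 0; Jz 1 0; Jw 1 1; Jz 1 0] [::];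
  Inv 2160 1 [:: Jz 1 0; Jz 1 0; Jw 1 0; Jz 1 0; Jw 2 0; Jw 1 0] [::];
  Inv 1080 1 [:: Jz 1 0; Jz 1 0; Jw 1 0; Jw 1 0; Jw 2 0; Jz 1 0] [::];
  Inv 51840 4 [:: Jz 4 0; Jw 3 0] [:: Kz 0];
  Inv 4080 3 [:: Jz 4 0; Jw 3 0] [:: Kz 1];
  Inv 6240 2 [:: Jz 4 1; Jw 3 1] [:: Kz 0];
  Inv 4128 3 [:: Jz 4 1; Jw 3 0] [:: Kz 0];
  Inv (-8520) 3 [:: Jz 4 1; Jw 3 0] [:: Kw 0];
  Inv (-38400) 2 [:: Jz 4 1; Jw 3 0] [:: Kw 1];
  Inv (-14400) 1 [:: Jz 4 2; Jw 3 0] [:: Kw 1];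
  Inv (-720) 3 [:: Jw 3 0; Jz 3 0; Jw 1 0] [:: Kz 0];
  Inv (-24000) 2 [:: Jw 3 0; Jz 3 0; Jw 1 0] [:: Kz 1];
  Inv 3600 3 [:: Jw 3 0; Jw 2 0; Jz 2 0] [:: Kz 0];
  Inv 2880 3 [:: Jw 3 0; Jw 2 0; Jz 2 0] [:: Kw 0];
  Inv 134400 1 [:: Jw 3 1; Jz 3 0; Jw 1 0] [:: Kz 1];
  Inv 2880 2 [:: Jw 3 1; Jz 3 0; Jz 1 0] [:: Kz 0];
  Inv (-144000) 1 [:: Jw 3 0; Jz 3 1; Jz 1 0] [:: Kw 1];
  Inv 48000 1 [:: Jw 3 0; Jz 3 0; Jw 1 1] [:: Kz 1];
  Inv 28800 1 [:: Jw 3 0; Jw 2 1; Jz 2 0] [:: Kz 1];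
  Inv (-2880) 2 [:: Jw 3 0; Jw 2 0; Jz 2 1] [:: Kw 0];
  Inv (-28800) 1 [:: Jz 3 1; Jw 2 0; Jz 2 0] [:: Kw 1];
  Inv 10080 2 [:: Jz 1 0; Jz 1 0; Jw 3 0; Jw 2 0] [:: Kw 0];
  Inv 5760 2 [:: Jw 2 0; Jz 1 0; Jw 3 0; Jz 1 0] [:: Kw 0];
  Inv (-7200) 1 [:: Jw 1 0; Jw 1 0; Jz 3 0; Jw 2 0] [:: Kz 1];
  Inv (-14400) 1 [:: Jw 2 0; Jw 1 0; Jz 3 0; Jw 1 0] [:: Kz 1];
  Inv (-2880) 2 [:: Jw 1 0; Jz 1 0; Jz 3 0; Jw 2 0] [:: Kz 0];
  Inv (-2880) 2 [:: Jw 2 0; Jz 1 0; Jz 3 0; Jw 1 0] [:: Kz 0];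
  Inv (-10080) 2 [:: Jw 2 0; Jw 1 0; Jz 3 0; Jz 1 0] [:: Kz 0];
  Inv (-2160) 3 [:: Jz 4 0; Jw 3 0] [:: Kz 0; Kz 0];
  Inv 2160 3 [:: Jz 4 0; Jw 3 0] [:: Kz 0; Kw 0];
  Inv (-36000) 1 [:: Jz 4 0; Jw 3 0] [:: Kz 1; Kw 1]].

End Data.

Section Certificates.
Local Open Scope Z_scope.

(** m times the 0-th product of the two states minus the twisted derivatives of the
candidate a. *)
Definition defect ws ws' d k1 j1 k2 j2 m a :=
  psub
    (pscale m 0 (papply mul2 (mode_trie_of_words ws 0 d) (trie_of_words mul2 ws' pone)))
    (psub (pscale (Z.of_nat k1) 0 (ptwisted false j1 a))
       (pscale (Z.of_nat k2) 0 (ptwisted true j2 a))).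

(** The factor 60 clears the denominators arising from the division by modes; words
have at most 7 currents because 4 + 4 - 1 = 7 is the weight of the 0-th product of
two states of weight 4. *)
Definition defect_primitive ws ws' d k1 j1 k2 j2 m a :=
  primitive mul2 30000 7 (pscale 60 0 (defect ws ws' d k1 j1 k2 j2 m a)) pzero.

(** The state (-x)^n b(z) expands to b t^{-n}, which makes it a primitive of the
coefficient of t^{-n} as soon as b is one. *)
Definition polar_primitive E a :=
  let l := laurent_tail mul1 E a in
  psum [seq pscale (zsign (E - i)) (E - i)
              (primitive mul1 30000 7 (pscale 60 0 (nth pzero l i)) pzero)
       | i <- iota 0 E].

(** The first condition says that 60 times the defect is the translate of b, the
second that 60 a minus the translate of z has no singular part. *)
Definition certified ws ws' d k1 j1 k2 j2 m E a b z :=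
  is_pzero (psub (pscale 60 0 (defect ws ws' d k1 j1 k2 j2 m a)) (ptranslate mul2 b))
  && (let t := psub (pscale 60 0 a) (ptranslate mul2 z) in
      pole_bounded E t && all is_pzero (laurent_tail mul1 E t)).

Local Notation s1 := quadratic_words.
Local Notation s3 := quartic_words.

(** The results of the search are stored in evaluated form, so that checking the
certificates does not repeat it. *)
Definition A11 := Eval vm_compute in trie_of_terms terms11.
Definition A13 := Eval vm_compute in trie_of_terms terms13.
Definition A31 := Eval vm_compute in trie_of_terms [seq swap_term t | t <- terms13].
Definition A33 := Eval vm_compute in
  trie_of_terms (terms33 ++ [seq swap_term t | t <- terms33]).

Definition B11 := Eval vm_compute in
  defect_primitive (s1 false) (s1 true) 2 1 1 1 1 1 A11.
Definition B13 := Eval vm_compute in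
  defect_primitive (s1 false) (s3 true) 4 3 1 1 3 3 A13.
Definition B31 := Eval vm_compute in
  defect_primitive (s3 false) (s1 true) 2 1 3 3 1 3 A31.
Definition B33 := Eval vm_compute in
  defect_primitive (s3 false) (s3 true) 4 3 3 3 3 15 A33.

Definition Z11 := Eval vm_compute in polar_primitive 1 A11.
Definition Z13 := Eval vm_compute in polar_primitive 3 A13.
Definition Z31 := Eval vm_compute in polar_primitive 3 A31.
Definition Z33 := Eval vm_compute in polar_primitive 5 A33.

Lemma certified11 : certified (s1 false) (s1 true) 2 1 1 1 1 (Z.of_nat 1) 1 A11 B11 Z11.
Proof. by vm_compute. Qed.

Lemma certified13 : certified (s1 false) (s3 true) 4 3 1 1 3 (Z.of_nat 3) 3 A13 B13 Z13.
Proof. by vm_compute. Qed.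

Lemma certified31 : certified (s3 false) (s1 true) 2 1 3 3 1 (Z.of_nat 3) 3 A31 B31 Z31.
Proof. by vm_compute. Qed.

Lemma certified33 : certified (s3 false) (s3 true) 4 3 3 3 3 (Z.of_nat 15) 5 A33 B33 Z33.
Proof. by vm_compute. Qed.

End Certificates.

(** * Derivations of tries *)

Lemma scalel_congr (K : pzRingType) (V : lmodType K) (a b : K) (v : V) :
  a = b -> a *: v = b *: v.
Proof. by move=> ->. Qed.

Section EngineInV2.
Variable R : realType.
Local Notation C := R[i].
Local Notation A := {poly C}.
Local Notation op2 := (@op2 R).
Local Notation eval := (peval 'X op2 (vac2 R)).

Lemma mul2E g t : eval (mul2 g t) = op2 g (eval t).
Proof. by apply: peval_lmul; [exact: op2_linear|exact: op2_comm|exact: op2_kill]. Qed.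

Lemma mul_opE v g t : peval 'X op2 v (mul_op g t) = op2 g (peval 'X op2 v t).
Proof. by apply: peval_lmul; [exact: op2_linear|exact: op2_comm|]. Qed.

Lemma T2_op2 g v : T2 (op2 g v) = op2 g (T2 v) +
  (if g is Cur u m p a then zval A (Z.opp m) *: op2 (Cur u (Z.sub m (Zpos xH)) p a) v else 0).
Proof.
apply: etrans (T2Z (polyCm R (lscal R g)) (act_gen2 (lsym id g) v)) _.
apply: etrans (congr1 _ (T2_act_gen (lsym id g) v)) _.
apply: etrans (scalerDr _ _ _) _; congr (_ + _).
case: g => [u m p a|u p]; last by apply: etrans (congr1 _ (scale0r _)) _; exact: scaler0.
apply: etrans (scalerA _ _ _) _; apply: etrans _ (esym (scalerA _ _ _)).
have modeE : int_of_Z (Z.sub m (Zpos xH)) = int_of_Z m - 1 by lia.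
have -> : T_scal R (lsym id (Cur u m p a)) = zval A (Z.opp m) by rewrite zvalN.
by rewrite [lsym id (Cur u (Z.sub _ _) p a)]/= modeE mulrC.
Qed.

(** The factor p+1 in d J^{(p)} = (p+1) J^{(p+1)}. *)
Lemma lscal_shift1 g : lscal R g = (letter_order g).+1%:R * lscal R (letter_shift 1 g).
Proof.
by have := lscal_shift R g 1; rewrite bin1 addn1 invr1 mulr1.
Qed.

Lemma partial_op2 u g v : partial u (op2 g v) = op2 g (partial u v) +
  (if letter_point g == u then zval A (Z.of_nat (letter_order g).+1) *: op2 (letter_shift 1 g) v
   else 0).
Proof.
apply: etrans (partialZ u (polyCm R (lscal R g)) (act_gen2 (lsym id g) v)) _.
have -> : partial_scal u (polyCm R (lscal R g)) = 0 by exact: partial_scalC.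
apply: etrans (congr1 (+%R^~ _) (scale0r _)) _; apply: etrans (add0r _) _.
apply: etrans (congr1 _ (partial_act_gen u (lsym id g) v)) _.
apply: etrans (scalerDr _ _ _) _; congr (_ + _).
have -> : (lsym id g).1 = letter_point g by case: g.
case: eqP => _; last by apply: etrans (congr1 _ (scale0r _)) _; exact: scaler0.
apply: etrans (congr1 _ (scale1r _)) _; apply: etrans _ (esym (scalerA _ _ _)).
rewrite zval_nat -(rmorph_nat (polyCm R)) -rmorphM -lscal_shift1.
by congr (_ *: act_gen2 _ v); case: (g).
Qed.

Lemma ptranslateE t : eval (ptranslate mul2 t) = T2 (eval t).
Proof.
apply: (peval_deriv (@op2_linear R) _ mul2E) => [u v|c|g v].
- exact: T2D.
- by rewrite T2Z T2_vac /= scale0r scaler0.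
by rewrite T2_op2; case: g.
Qed.

Lemma cval_strip (x : A) s : cval x (strip s) = cval x s.
Proof.
elim: s => //= z s <-; case: z => [|z|z] //; case: (strip s) => //=.
by rewrite mulr0 addr0.
Qed.

Lemma cval_deriv sg i s :
  cval ('X : A) (euler_coefs sg i s) = zval A sg * ('X * (cval 'X s)^`() + i%:R * cval 'X s).
Proof.
elim: s i => [|z s IH] i /=; first by rewrite deriv0 !mulr0 addr0 mulr0.
rewrite IH derivD derivM derivX mul1r !zvalM zval_nat.
have -> : (zval A z)^`() = 0.
  by have -> : zval A z = (zval C z)%:P; [rewrite /zval rmorph_int|exact: derivC].
by rewrite -[i.+1]addn1 natrD; ring.
Qed.

Lemma ppartialE u t : eval (ppartial u t) = partial u (eval t).
Proof.
apply: (peval_deriv (@op2_linear R) _ mul2E) => [v w|c|g v].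
- exact: partialD.
- apply: etrans (partialZ u _ _) _; rewrite partial_vac.
  apply: etrans (congr1 _ (scaler0 _ _)) _; apply: etrans (addr0 _) _.
  apply: scalel_congr.
  rewrite cval_strip /= cval_deriv.
  rewrite /partial_scal -[zval A Z0]/0; case: u => /=; rewrite ?zval1 ?zvalN; ring.
by rewrite partial_op2; case: ifP.
Qed.

(** k = s^2 K = -2 K turns -(j/2) k into + j K. *)
Lemma ptwistedE u j t : eval (ptwisted u j t) = Dtw u j (eval t).
Proof.
rewrite /ptwisted (peval_add 'X (@op2_linear R)) ppartialE /Dtw; congr (_ + _).
rewrite (peval_scale 'X (@op2_linear R)) mul2E mulr1 zval_nat.
apply: etrans (scalerA _ _ _) _; apply: etrans _ (scaleNr _ _).
apply: scalel_congr.
rewrite -(rmorph_nat (polyCm R)) -rmorphM -rmorphN; congr (polyCm R _).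
rewrite /= expr2 sl2_rootK mulr1 -mulrN; congr (_ * _).
by rewrite invrN.
Qed.

Lemma psubE s t : eval (psub s t) = eval s - eval t.
Proof.
rewrite (peval_add 'X (@op2_linear R)) (peval_scale 'X (@op2_linear R)).
by rewrite mulr1 -[zval A _]/(-1) scaleN1r.
Qed.

End EngineInV2.

(** * The state-field map on tries *)

Section Products.
Variable R : realType.
Local Notation C := R[i].
Local Notation A := {poly C}.
Local Notation op2 := (@op2 R).
Local Notation eval := (peval 'X op2 (vac2 R)).
Variable Y : V2 R -> int -> V2 R -> V2 R.
Hypothesis HY : is_state_field_map Y.
Let va := sf_vertex_algebra HY.

Let YZ c X n v : Y (c *: X) n v = c *: Y X n v.
Proof. exact: (linear_scale (fun c X X' => va_linl va c X X' n v)). Qed.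

Let YvZ c X n v : Y X n (c *: v) = c *: Y X n v.
Proof. exact: (linear_scale (fun c v v' => va_linr va c X n v v')). Qed.

Let YD X X' n v : Y (X + X') n v = Y X n v + Y X' n v.
Proof. exact: (linear_add (fun c X X' => va_linl va c X X' n v)). Qed.

Let natr_inj n (u v : V2 R) : n.+1%:R *: u = n.+1%:R *: v -> u = v.
Proof.
move=> /(congr1 (fun w => (n.+1%:R^-1 : C)%:P *: w)).
have E : (n.+1%:R^-1 : C)%:P * n.+1%:R = 1 :> A.
  by rewrite -(rmorph_nat (polyCm R)) -rmorphM mulVf ?rmorph1 ?pnatr_eq0.
move=> H; rewrite -[u]scale1r -[v]scale1r -E.
by apply: etrans (esym (scalerA _ _ _)) _; apply: etrans H _; exact: scalerA.
Qed.

Local Notation YZ' := (fun X n v => Y X (int_of_Z n) v).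

Let T_cur u m p a v : T2 (op2 (Cur u m p a) v) = op2 (Cur u m p a) (T2 v)
    + zval A (Z.opp m) *: op2 (Cur u (Z.pred m) p a) v.
Proof. exact: T2_op2. Qed.

Let Y_vac n v : YZ' (vac2 R) n v = if Z.eqb n (Zneg xH) then v else 0.
Proof.
apply: etrans (va_vacuum va _ _) _.
have -> : (int_of_Z n == -1) = Z.eqb n (Zneg xH) by apply/eqP/idP; lia.
by [].
Qed.

Let Y_cur u p a n v : YZ' (op2 (Cur u (Zneg xH) p a) (vac2 R)) n v = op2 (Cur u n p a) v.
Proof.
have E : op2 (Cur u (Zneg xH) p a) (vac2 R) =
    polyCm R (lscal R (Cur u (Zneg xH) p a)) *: st (opI R u (ord_axis a) p (-1)).
  by rewrite /op2 /lact /lval; apply: etrans (congr1 _ (act_state _ _ _)) _.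
rewrite E; apply: etrans (YZ _ _ _ _) _.
exact: (congr1 (fun w => _ *: w) (sf_gen HY _ _ _ _ _)).
Qed.

Let Y_cen u p X n v : YZ' (op2 (Cen u p) X) n v = op2 (Cen u p) (YZ' X n v).
Proof. by apply: etrans (YZ _ _ _ _) _; apply: etrans (congr1 _ (sf_central HY _ _ _ _ _)) _. Qed.

Let Y_T X n v : YZ' (T2 X) n v = zval A (Z.opp n) *: YZ' X (Z.pred n) v.
Proof.
apply: etrans (sf_derivative HY _ _ _) _; rewrite zvalN.
by have -> : int_of_Z (Z.pred n) = int_of_Z n - 1 by lia.
Qed.

Let Y_normal X X' n v : exists s1 s2, [/\
  finite_series (fun j => YZ' X (Z.sub (Zneg xH) (Z.of_nat j)) (YZ' X' (Z.add n (Z.of_nat j)) v)) s1,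
  finite_series (fun j => YZ' X' (Z.sub (Z.sub n (Zpos xH)) (Z.of_nat j)) (YZ' X (Z.of_nat j) v)) s2 &
  YZ' (YZ' X (Zneg xH) X') n v = s1 + s2].
Proof.
have [s1 [s2 [E1 E2 E]]] := sf_normal_ordered HY X X' (int_of_Z n) v.
exists s1, s2; split => //.
  apply: (eq_ind _ (fun u => finite_series u s1) E1); apply/funext => j.
  by congr (Y _ _ (Y _ _ _)); lia.
apply: (eq_ind _ (fun u => finite_series u s2) E2); apply/funext => j.
by congr (Y _ _ (Y _ _ _)); lia.
Qed.

(** The state-field map is characterized by the conditions used in [mode_trieE];
they are transported from integer to binary mode numbers. *)
Lemma mode_trie_op2 w d v : all creates w -> weight_le op2 d v ->
  Y (foldr op2 (vac2 R) w) 0 v = peval 'X op2 v (mode_trie mul_op w Z0 d).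
Proof.
move=> wc dv.
exact: (@mode_trieE A (V2 R) 'X op2 (vac2 R) (@op2_linear R) (@T2 R) YZ' natr_inj (T2_vac R)
  T_cur (fun c X n v => YZ c X (int_of_Z n) v) (fun c X n v => YvZ c X (int_of_Z n) v) Y_vac Y_cur Y_cen Y_T
  Y_normal mul_op (@mul_opE R) w Z0 d v wc dv).
Qed.
End Products.

(** * From certificates to the equations *)

Definition words_ok (d : Z) (ws : seq (Z * seq letter)) :=
  all (fun cw => all creates cw.2 && Z.leb (Z.opp (word_mode cw.2)) d) ws.

Section Words.
Variables (K : comNzRingType) (V : lmodType K) (x : K) (op : letter -> V -> V).
Variable vac : V.
Hypothesis op_linear : forall g c u v, op g (c *: u + v) = c *: op g u + op g v.
Hypothesis op_comm : forall g h v,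
  op g (op h v) = op h (op g v) + combo x op (bracket_two g h) v.
Hypothesis op_kill : forall g, annihilates g -> op g vac = 0.

Definition words_state (ws : seq (Z * seq letter)) v : V :=
  \sum_(cw <- ws) zval K cw.1 *: foldr op v cw.2.

Lemma trie_of_wordsE mul ws t :
  (forall g t, peval x op vac (mul g t) = op g (peval x op vac t)) ->
  peval x op vac (trie_of_words mul ws t) = words_state ws (peval x op vac t).
Proof.
move=> mulE; rewrite (peval_sum x op_linear) big_map; apply: eq_bigr => cw _.
by rewrite (peval_scale x op_linear) mulr1 peval_word.
Qed.

Lemma weight_le_words d ws : words_ok d ws -> weight_le op d (words_state ws vac).
Proof.
elim: ws => [_|[c w] ws IH] /=; first by rewrite /words_state big_nil; exact: (weight_le0 op_linear).
case/andP=> /andP[_ wd] /IH {}IH; rewrite /words_state big_cons; apply: (weight_leD op_linear) => //.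
apply: (weight_leZ op_linear).
have Q : weight_le op (Z.opp (word_mode w)) (foldr op vac w).
  exact: (weight_le_word op_linear op_comm op_kill).
apply: (weight_leW Q); lia.
Qed.

Lemma words_product (Y : V -> V -> V) (mode : seq letter -> Z -> trie) ws d e v :
  (forall X X' v, Y (X + X') v = Y X v + Y X' v) ->
  (forall c X v, Y (c *: X) v = c *: Y X v) ->
  (forall w d v, all creates w -> weight_le op d v ->
     Y (foldr op vac w) v = peval x op v (mode w d)) ->
  words_ok e ws -> weight_le op d v ->
  Y (words_state ws vac) v = peval x op v (psum [seq pscale cw.1 0 (mode cw.2 d) | cw <- ws]).
Proof.
move=> YD YZ Yw ws_ok dv.
rewrite (peval_sum x op_linear) big_map /words_state.
have Y0 : Y 0 v = 0 by apply: (addrI (Y 0 v)); rewrite -YD !addr0.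
elim: ws ws_ok => [_|[c w] ws IH] /=; first by rewrite !big_nil.
case/andP=> /andP[wc _] /IH {}IH; rewrite !big_cons YD IH YZ (Yw _ d) //.
by rewrite (peval_scale x op_linear) mulr1.
Qed.

Local Notation eval := (peval x op vac).
Variables (D : bool -> nat -> V -> V) (T : V -> V).
Hypothesis ptwistedE : forall u j t, eval (ptwisted u j t) = D u j (eval t).
Hypothesis ptranslateE : forall t, eval (ptranslate mul2 t) = T (eval t).

Lemma defect_eval b ws ws' d k1 j1 k2 j2 m a :
  is_pzero (psub (pscale (Zpos 60) 0 (defect ws ws' d k1 j1 k2 j2 (Z.of_nat m) a))
              (ptranslate mul2 b)) ->
  60%:R *: (m%:R *: eval (papply mul2 (mode_trie_of_words ws Z0 d) (trie_of_words mul2 ws' pone))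
    - (k1%:R *: D false j1 (eval a) - k2%:R *: D true j2 (eval a))) = T (eval b).
Proof.
have scaleE n t : eval (pscale (Z.of_nat n) 0 t) = n%:R *: eval t.
  by rewrite (peval_scale x op_linear) mulr1 zval_nat.
have subE s t : eval (psub s t) = eval s - eval t.
  by rewrite (peval_add x op_linear) (peval_scale x op_linear) mulr1 -[zval K _]/(-1) scaleN1r.
move=> /(peval_zero x op vac); rewrite subE ptranslateE => /subr0_eq <-.
have -> t : eval (pscale (Zpos 60) 0 t) = 60%:R *: eval t by exact: (scaleE 60%N).
rewrite /defect; move: (papply mul2 _ _) => P.
move: (ptwistedE false j1 a) (ptwistedE true j2 a).
move: (ptwisted false j1 a) (ptwisted true j2 a) => t t' <- <-.
by rewrite !subE !scaleE.
Qed.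

End Words.

Lemma rescale_identity (C : fieldType) (K : comNzRingType) (emb : {rmorphism C -> K})
    (V : lmodType K) (P D1 D2 S : V) (k1 k2 : nat) (q m c : C) : q != 0 -> m != 0 ->
  emb q *: (emb m *: P - (k1%:R *: D1 - k2%:R *: D2)) = S ->
  emb c *: P = (emb (c / m) *: D1) *+ k1 - (emb (c / m) *: D2) *+ k2 + emb (c / (q * m)) *: S.
Proof.
move=> q0 m0 <-; rewrite scalerA -rmorphM.
have -> : c / (q * m) * q = c / m by field; rewrite q0 m0.
rewrite scalerBr scalerA -rmorphM divfK // scalerBr !scaler_nat !scalerMnr.
by rewrite addrC subrK.
Qed.

Lemma scale_sub_scale (K : comNzRingType) (V : lmodType K) (a c : K) (p q p' q' : V) :
  p' = c *: p -> q' = c *: q -> p' - a *: q' = c *: (p - a *: q).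
Proof. by move=> -> ->; rewrite scalerBr !scalerA mulrC. Qed.

Section Products.
Variable R : realType.
Local Notation C := R[i].
Local Notation A := {poly C}.
Local Notation op2 := (@op2 R).
Local Notation eval := (peval 'X op2 (vac2 R)).
Variable Y : V2 R -> int -> V2 R -> V2 R.
Hypothesis HY : is_state_field_map Y.

Local Notation ws_state ws := (words_state op2 ws (vac2 R)).

Lemma product_eval ws ws' d e : words_ok e ws -> words_ok d ws' ->
  Y (ws_state ws) 0 (ws_state ws') =
  eval (papply mul2 (mode_trie_of_words ws Z0 d) (trie_of_words mul2 ws' pone)).
Proof.
move=> ws_ok ws'_ok.
have vac1 : eval pone = vac2 R by rewrite /= zval1 mulr0 addr0 scale1r.
rewrite (peval_apply (@op2_linear R)); last exact: mul2E.
rewrite (trie_of_wordsE (@op2_linear R)); last exact: mul2E.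
rewrite vac1; apply: (@words_product _ _ _ op2 (vac2 R) (@op2_linear R) (fun X v => Y X 0 v) (fun w d => mode_trie mul_op w Z0 d) ws d e) => //.

- move=> X X' v; exact: (linear_add (fun c X X' => va_linl (sf_vertex_algebra HY) c X X' 0 v)).
- move=> c X v; exact: (linear_scale (fun c X X' => va_linl (sf_vertex_algebra HY) c X X' 0 v)).
- by move=> w d' v wc dv; exact: mode_trie_op2.
exact: (weight_le_words (@op2_linear R) (@op2_comm R) (@op2_kill R)).
Qed.

Lemma Dtw_scale u j c (v : V2 R) : Dtw u j (polyCm R c *: v) = polyCm R c *: Dtw u j v.
Proof.
apply: scale_sub_scale; last exact: actZr.
apply: etrans (partialZ u _ _) _.
have -> : partial_scal u (polyCm R c) = 0 by exact: partial_scalC.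
by apply: etrans (congr1 (+%R^~ _) (scale0r _)) _; exact: add0r.
Qed.

Lemma product_decomposition ws ws' d e k1 j1 k2 j2 m a b c (X X' : V2 R) :
  words_ok e ws -> words_ok d ws' -> (0 < m)%N ->
  is_pzero (psub (pscale (Zpos 60) 0 (defect ws ws' d k1 j1 k2 j2 (Z.of_nat m) a))
              (ptranslate mul2 b)) ->
  Y X 0 X' = polyCm R c *: Y (ws_state ws) 0 (ws_state ws') ->
  let A0 := polyCm R (c / m%:R) *: eval a in
  Y X 0 X' = Dtw ptz j1 A0 *+ k1 - Dtw ptw j2 A0 *+ k2
    + T2 (polyCm R (c / (60%:R * m%:R)) *: eval b).
Proof.
move=> ws_ok ws'_ok m0 chk -> A0; rewrite /A0 !Dtw_scale T2Z.
apply: rescale_identity; rewrite ?pnatr_eq0 -?lt0n //.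
have E := defect_eval (@op2_linear R) (@ptwistedE R) (@ptranslateE R) chk.
have nE n : polyCm R n%:R = n%:R by exact: rmorph_nat.
rewrite !nE (product_eval ws_ok ws'_ok); exact: E.
Qed.

End Products.

(** * The states sigma_1 and sigma_3 *)

Section Sums.
Variables (R : realType) (K : comNzRingType) (emb : {rmorphism R[i] -> K}) (V : lmodType K).

Lemma sum_delta (n : nat) (a : 'I_n) (f : 'I_n -> V) :
  \sum_(b < n) ((a == b)%:R : K) *: f b = f a.
Proof.
rewrite (bigD1 a) //= eqxx scale1r big1 ?addr0 // => b /negbTE.
by rewrite eq_sym => ->; rewrite scale0r.
Qed.

(** Each of the three products of Kronecker symbols eliminates two of the four
summations. *)
Lemma sum_delta_sym (X : 'I_3 -> 'I_3 -> 'I_3 -> 'I_3 -> V) :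
  \sum_(a < 3) \sum_(b < 3) \sum_(c < 3) \sum_(d < 3)
     emb (delta_sym R a b c d) *: X a b c d
  = emb 3^-1 *: \sum_(a < 3) \sum_(b < 3) (X a a b b + X a b a b + X a b b a).
Proof.
rewrite scaler_sumr; apply: eq_bigr => a _.
have E : \sum_(b < 3) \sum_(c < 3) \sum_(d < 3)
     (((a == b) && (c == d))%:R + ((a == c) && (b == d))%:R + ((a == d) && (b == c))%:R : K)
       *: X a b c d
  = \sum_(b < 3) (X a a b b + X a b a b + X a b b a).
  transitivity (\sum_(b < 3) \sum_(c < 3) \sum_(d < 3) ((a == b)%:R * (c == d)%:R : K) *: X a b c d
    + \sum_(b < 3) \sum_(c < 3) \sum_(d < 3) ((a == c)%:R * (b == d)%:R : K) *: X a b c d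
    + \sum_(b < 3) \sum_(c < 3) \sum_(d < 3) ((a == d)%:R * (b == c)%:R : K) *: X a b c d).
    rewrite -!big_split; apply: eq_bigr => b _ /=; rewrite -!big_split; apply: eq_bigr => c _ /=.
    rewrite -!big_split; apply: eq_bigr => d _ /=.
    by rewrite -!natrM !mulnb !scalerDl.
  rewrite !big_split; congr (_ + _ + _).
  - transitivity (\sum_(b < 3) ((a == b)%:R : K) *: \sum_(c < 3) X a b c c); last exact: sum_delta.
    apply: eq_bigr => b _; rewrite scaler_sumr; apply: eq_bigr => c _.
    by under eq_bigr do rewrite -scalerA; rewrite -scaler_sumr sum_delta.
  - apply: eq_bigr => b _.
    transitivity (\sum_(c < 3) ((a == c)%:R : K) *: X a b c b); last exact: sum_delta.
    apply: eq_bigr => c _.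
    by under eq_bigr do rewrite -scalerA; rewrite -scaler_sumr sum_delta.
  - apply: eq_bigr => b _.
    transitivity (\sum_(c < 3) ((b == c)%:R : K) *: X a b c a); last exact: sum_delta.
    apply: eq_bigr => c _.
    by under eq_bigr do rewrite mulrC -scalerA; rewrite -scaler_sumr sum_delta.
rewrite -E scaler_sumr; apply: eq_bigr => b _; rewrite scaler_sumr; apply: eq_bigr => c _.
rewrite scaler_sumr; apply: eq_bigr => d _; rewrite scalerA /delta_sym rmorphM; congr (_ * _ *: _).
by rewrite !rmorphD !rmorph_nat.
Qed.

Lemma sum_fabc (X : 'I_3 -> 'I_3 -> 'I_3 -> V) :
  \sum_(a < 3) \sum_(b < 3) \sum_(c < 3) emb (fabc R a b c) *: X a b c
  = emb (sl2_root R) *: \sum_(t <- epsilon)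
      zval K t.1 *: X (ord_axis t.2.1.1) (ord_axis t.2.1.2) (ord_axis t.2.2).
Proof.
rewrite !sum_axis /fabc /levi_civita /= -/(sl2_root R) !mulr0 !rmorph0 !scale0r.
rewrite ?(add0r, addr0) !big_cons big_nil /= addr0.
have -> : zval K (Zpos xH) = 1 by [].
have -> : zval K (Zneg xH) = - 1 by [].
rewrite !mulrN1 !mulr1 !rmorphN !scaleNr !scale1r !scalerDr !scalerN !addrA.
by rewrite [LHS](ACl (1*4*5*3*6*2)).
Qed.

Lemma sum_axes (f : 'I_3 -> V) : \sum_(a < 3) f a = \sum_(a <- axes) f (ord_axis a).
Proof. by rewrite sum_axis !big_cons big_nil addr0. Qed.

End Sums.

(** The identities hold in any algebra with a family of elements indexed by the
generators, in particular in the free algebra. *)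
Section InvariantStates.
Variables (R : realType) (K : comNzRingType) (emb : {rmorphism R[i] -> K}) (L : lalgType K).
Hypothesis scaler_mulr : forall (c : K) (f g : L), f * (c *: g) = c *: (f * g).
Variable gen0 : symb bool -> L.
Local Notation sg := (lval emb id gen0).
Local Notation r := (sl2_root R).

Definition word_product (w : seq letter) : L := foldr (fun g y => sg g * y) 1 w.

Arguments word_product : simpl never.

Definition words_sum (ws : seq (Z * seq letter)) : L :=
  \sum_(cw <- ws) zval K cw.1 *: word_product cw.2.

Lemma morph_words_sum (W : lmodType K) (ex : L -> W) (op : letter -> W -> W) ws :
  {morph ex : f g / f + g} -> (forall c f, ex (c *: f) = c *: ex f) ->
  (forall g f, ex (sg g * f) = op g (ex f)) ->
  ex (words_sum ws) = words_state op ws (ex 1).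
Proof.
move=> exD exZ exM.
have ex0 : ex 0 = 0 by apply: (addrI (ex 0)); rewrite -exD !addr0.
rewrite /words_sum (big_morph ex exD ex0); apply: eq_bigr => cw _; rewrite exZ; congr (_ *: _).
by elim: (cw.2) => //= g w <-; exact: exM.
Qed.

Definition letter_gen g := gen0 (lsym id g).

Lemma gens_product w : foldr (fun g y => letter_gen g * y) 1 w =
  emb (\prod_(g <- w) (lscal R g)^-1) *: word_product w.
Proof.
elim: w => [|g w IH] /=; first by rewrite big_nil rmorph1 scale1r.
rewrite -[word_product (_ :: _)]/(sg g * word_product w) big_cons rmorphM IH scaler_mulr /lval -!scalerAl !scalerA; congr (_ *: _).
by rewrite mulrAC -rmorphM mulVf ?lscal_neq0 // rmorph1 mul1r.
Qed.

Lemma gen2 g h : letter_gen g * letter_gen h =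
  emb ((lscal R g)^-1 * (lscal R h)^-1) *: word_product [:: g; h].
Proof. by have := gens_product [:: g; h]; rewrite [foldr _ _ _]/= mulr1 !big_cons big_nil mulr1. Qed.

Lemma gen3 g h k : letter_gen g * letter_gen h * letter_gen k =
  emb ((lscal R g)^-1 * (lscal R h)^-1 * (lscal R k)^-1) *: word_product [:: g; h; k].
Proof.
by have := gens_product [:: g; h; k]; rewrite [foldr _ _ _]/= mulr1 !mulrA !big_cons big_nil mulr1 !mulrA.
Qed.

Lemma gen4 g h k l : letter_gen g * letter_gen h * letter_gen k * letter_gen l =
  emb ((lscal R g)^-1 * (lscal R h)^-1 * (lscal R k)^-1 * (lscal R l)^-1)
    *: word_product [:: g; h; k; l].
Proof.
by have := gens_product [:: g; h; k; l]; rewrite [foldr _ _ _]/= mulr1 !mulrA !big_cons big_nil mulr1 !mulrA.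
Qed.

Lemma quadratic_sum u :
  \sum_(a < 3) gen0 (symbI u a 0 (-1)) * gen0 (symbI u a 0 (-1))
  = emb (- 2%:R) *: words_sum (quadratic_words u).
Proof.
rewrite sum_axes /words_sum /quadratic_words big_map scaler_sumr; apply: eq_bigr => a _.
rewrite (gen2 (mode 1 u 0 a) (mode 1 u 0 a)) -[zval K _]/1 scale1r; congr (emb _ *: _).
by rewrite /= !invrK !mulr1 sl2_rootK.
Qed.

Local Notation W2 u n p m q := (\sum_(a <- axes) word_product [:: mode n u p a; mode m u q a]).
Local Notation W3 u := (\sum_(t <- epsilon) zval K t.1 *:
  word_product [:: mode 2 u 0 t.2.1.1; mode 1 u 1 t.2.1.2; mode 1 u 0 t.2.2]).
Local Notation W4 u := (\sum_(a <- axes) \sum_(b <- axes)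
  (word_product [:: mode 1 u 0 a; mode 1 u 0 a; mode 1 u 0 b; mode 1 u 0 b]
   + word_product [:: mode 1 u 0 a; mode 1 u 0 b; mode 1 u 0 a; mode 1 u 0 b]
   + word_product [:: mode 1 u 0 a; mode 1 u 0 b; mode 1 u 0 b; mode 1 u 0 a])).
Local Notation WK u := (\sum_(a <- axes) word_product [:: mode 3 u 0 a; mode 1 u 0 a; Cen u 1]).

Lemma quartic_words_sum u : words_sum (quartic_words u) =
  3%:R *: W4 u + 60%:R *: W3 u - 40%:R *: W2 u 3%N 0%N 1%N 2%N + 60%:R *: W2 u 2%N 2%N 2%N 0%N
  - 20%:R *: W2 u 3%N 1%N 1%N 1%N + 15%:R *: W2 u 2%N 1%N 2%N 1%N - 60%:R *: WK u.
Proof.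
have zE n : zval K (Z.of_nat n) = n%:R by exact: zval_nat.
have zN n : zval K (Z.opp (Z.of_nat n)) = - n%:R by rewrite zvalN zE.
rewrite /words_sum /quartic_words big_cat -!addrA; congr (_ + _).
  rewrite big_flatten big_map scaler_sumr; apply: eq_bigr => a _.
  rewrite big_flatten big_map scaler_sumr; apply: eq_bigr => b _.
  by rewrite !big_cons big_nil /= addr0 (zE 3%N) !scalerDr addrA.
rewrite big_cat; congr (_ + _).
  rewrite big_map scaler_sumr; apply: eq_bigr => t _.
  by rewrite zvalM (zE 60%N) scalerA.
rewrite big_flatten big_map !scaler_sumr -!sumrN -!big_split; apply: eq_bigr => a _.
rewrite !big_cons big_nil /= addr0 (zN 40%N) (zE 60%N) (zN 20%N) (zE 15%N) (zN 60%N).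
by rewrite !scaleNr.
Qed.

(** A product of k currents of orders p_i carries the factor s^k p_1! ... p_k!, and
s^2 = -2, s^4 = 4; for instance (40/9) s^2 2! = -(4/9) 40.  The term with
f^{abc} gets a fourth factor s from the structure constant, and k' = s^2 K^{(1)}. *)
Lemma quartic_sum u :
  \sum_(a < 3) \sum_(b < 3) \sum_(c < 3) \sum_(d < 3)
        emb (delta_sym R a b c d) *:
          (gen0 (symbI u a 0 (-1)) * gen0 (symbI u b 0 (-1)) * gen0 (symbI u c 0 (-1))
             * gen0 (symbI u d 0 (-1)))
    + emb (20%:R / 3%:R) *: (\sum_(a < 3) \sum_(b < 3) \sum_(c < 3)
        emb (fabc R a b c) *: (gen0 (symbI u a 0 (-2)) * gen0 (symbI u b 1 (-1))
             * gen0 (symbI u c 0 (-1))))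
    + emb (40%:R / 9%:R) *: (\sum_(a < 3) gen0 (symbI u a 0 (-3)) * gen0 (symbI u a 2 (-1)))
    - emb (20%:R / 3%:R) *: (\sum_(a < 3) gen0 (symbI u a 2 (-2)) * gen0 (symbI u a 0 (-2)))
    + emb (40%:R / 9%:R) *: (\sum_(a < 3) gen0 (symbI u a 1 (-3)) * gen0 (symbI u a 1 (-1)))
    - emb (10%:R / 3%:R) *: (\sum_(a < 3) gen0 (symbI u a 1 (-2)) * gen0 (symbI u a 1 (-2)))
    - emb (20%:R / 3%:R) *:
        (\sum_(a < 3) gen0 (symbI u a 0 (-3)) * gen0 (symbI u a 0 (-1)) * gen0 (symbK u 1))
  = emb (4%:R / 9%:R) *: words_sum (quartic_words u).
Proof.
have r2 := sl2_rootK R; have r0 := sl2_root_neq0 R.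
(* powers of s, for the words with four factors *)
have r4 : r * r * r * r = 4%:R by rewrite r2 -mulrA r2 mulrNN -natrM.
pose i n := int_of_Z (Z.opp (Z.of_nat n)).
have two n p m q : \sum_(a < 3) gen0 (symbI u a p (i n)) * gen0 (symbI u a q (i m))
    = emb (- 2%:R * (p`! * q`!)%:R) *: W2 u n p m q.
  rewrite sum_axes scaler_sumr; apply: eq_bigr => a _.
  rewrite -[LHS]/(letter_gen (mode n u p a) * letter_gen (mode m u q a)) gen2.
  by congr (emb _ *: _); rewrite /= !invrK mulrACA r2 natrM.
have E1 : \sum_(a < 3) \sum_(b < 3) \sum_(c < 3) \sum_(d < 3)
        emb (delta_sym R a b c d) *:
          (gen0 (symbI u a 0 (i 1)) * gen0 (symbI u b 0 (i 1)) * gen0 (symbI u c 0 (i 1))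
             * gen0 (symbI u d 0 (i 1))) = emb (4%:R / 3%:R) *: W4 u.
  rewrite sum_delta_sym sum_axes [4%:R / 3%:R]mulrC rmorphM -[RHS]scalerA; congr (_ *: _).
  rewrite scaler_sumr; apply: eq_bigr => a _; rewrite sum_axes scaler_sumr; apply: eq_bigr => b _.
  have E c d e f : gen0 (symbI u (ord_axis c) 0 (i 1)) * gen0 (symbI u (ord_axis d) 0 (i 1))
      * gen0 (symbI u (ord_axis e) 0 (i 1)) * gen0 (symbI u (ord_axis f) 0 (i 1))
      = emb 4%:R *: word_product [:: mode 1 u 0 c; mode 1 u 0 d; mode 1 u 0 e; mode 1 u 0 f].
    apply: etrans (gen4 (mode 1 u 0 c) (mode 1 u 0 d) (mode 1 u 0 e) (mode 1 u 0 f)) _.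
    by congr (emb _ *: _); rewrite /= !invrK !mulr1 r4.
  by rewrite !E !scalerDr.
have E2 : \sum_(a < 3) \sum_(b < 3) \sum_(c < 3)
        emb (fabc R a b c) *: (gen0 (symbI u a 0 (i 2)) * gen0 (symbI u b 1 (i 1))
             * gen0 (symbI u c 0 (i 1))) = emb 4%:R *: W3 u.
  have -> : 4%:R = r * (r * r * r) by rewrite mulrC r4.
  rewrite sum_fabc [emb (r * (r * r * r))]rmorphM -[RHS]scalerA; congr (_ *: _).
  rewrite scaler_sumr; apply: eq_bigr => t _; rewrite !scalerA mulrC -scalerA; congr (_ *: _).
  apply: etrans (gen3 (mode 2 u 0 t.2.1.1) (mode 1 u 1 t.2.1.2) (mode 1 u 0 t.2.2)) _.
  by congr (emb _ *: _); rewrite /= !invrK !mulr1.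
have EK : \sum_(a < 3) gen0 (symbI u a 0 (i 3)) * gen0 (symbI u a 0 (i 1)) * gen0 (symbK u 1)
    = emb 4%:R *: WK u.
  rewrite sum_axes scaler_sumr; apply: eq_bigr => a _.
  apply: etrans (gen3 (mode 3 u 0 a) (mode 1 u 0 a) (Cen u 1)) _.
  by congr (emb _ *: _); rewrite /= !invrK !mulr1 expr2 mulrA r4.
apply: etrans (congr1 (fun y => y - _) (congr2 +%R (congr2 +%R (congr2 +%R (congr2 +%R
   (congr2 +%R E1 (congr1 _ E2)) (congr1 _ (two 3%N 0%N 1%N 2%N)))
   (congr1 (fun y => - (_ *: y)) (two 2%N 2%N 2%N 0%N)))
   (congr1 _ (two 3%N 1%N 1%N 1%N))) (congr1 (fun y => - (_ *: y)) (two 2%N 1%N 2%N 1%N)))) _.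
rewrite [X in _ - _ *: X](EK) quartic_words_sum !scalerDr !scalerN.
have nE n (w : L) : n%:R *: w = emb n%:R *: w by rewrite rmorph_nat.
have S x y n (w : L) : x * y = 4%:R / 9%:R * n%:R ->
    emb x *: (emb y *: w) = emb (4%:R / 9%:R) *: (n%:R *: w).
  by move=> E; rewrite nE !scalerA -!rmorphM E.
have SN x y n (w : L) : x * y = - (4%:R / 9%:R * n%:R) ->
    emb x *: (emb y *: w) = - (emb (4%:R / 9%:R) *: (n%:R *: w)).
  by move=> E; rewrite nE !scalerA -!rmorphM E rmorphN scaleNr.
have c02 : (0`! * 2`!)%:R = 2%:R :> R[i] by [].
have c11 : (1`! * 1`!)%:R = 1 :> R[i] by [].
rewrite !c02 !c11; congr (_ + _ + _ + _ + _ + _ - _).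
- by rewrite nE scalerA -rmorphM; congr (emb _ *: _); field.
- by apply: S; field.
- by apply: SN; field.
- by rewrite (SN _ _ 60%N) ?opprK //; field.
- by apply: SN; field.
- by rewrite (SN _ _ 15%N) ?opprK //; field.
by apply: S; field.
Qed.

End InvariantStates.

Section InvariantStatesV2.
Variable R : realType.
Local Notation A := {poly R[i]}.
Local Notation F2 := (free_alg A (symb bool)).
Local Notation state_of ws := (words_state (@op2 R) ws (vac2 R)).

Lemma st_words ws : st (words_sum (polyCm R) (gen A (G := symb bool)) ws) = state_of ws.
Proof.
apply: (@morph_words_sum R A (polyCm R) F2 (@gen A (symb bool)) (V2 R) (@st R)).
- exact: stateD.
- exact: state_scaleE.
by move=> g f; rewrite op2E; exact/esym/actE.
Qed.

Lemma sigma1E u : sigma1 R u = polyCm R (- 2%:R) *: state_of (quadratic_words u).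
Proof.
rewrite -st_words; apply: etrans _ (state_scaleE _ _ _ _); congr (st _).
exact: (quadratic_sum (polyCm R) (@free_algZr A (symb bool)) (@gen A (symb bool)) u).
Qed.

Lemma sigma3E u : sigma3 R u = polyCm R (4%:R / 9%:R) *: state_of (quartic_words u).
Proof.
rewrite -st_words; apply: etrans _ (state_scaleE _ _ _ _); congr (st _).
exact: (quartic_sum (polyCm R) (@free_algZr A (symb bool)) (@gen A (symb bool)) u).
Qed.

End InvariantStatesV2.

(** * Regularity and the theorem *)

Lemma scale_factor (C : fieldType) (K : comNzRingType) (emb : {rmorphism C -> K})
    (V : lmodType K) (c q : C) (u v : V) : q != 0 ->
  emb c *: u - emb (c / q) *: v = emb (c / q) *: (emb q *: u - v).
Proof. by move=> q0; rewrite scalerBr scalerA -rmorphM divfK. Qed.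

Section Regularity.
Variable R : realType.
Local Notation C := R[i].
Local Notation A := {poly C}.
Local Notation op2 := (@op2 R).
Local Notation eval := (peval 'X op2 (vac2 R)).
Local Notation vac1 := (vac (@bracket1 R) (@nonneg_mode unit)).
Local Notation eval1 := (peval (0 : C) (@op1 R) (vac1 : V1 R)).

Lemma mul1E g t : eval1 (mul1 g t) = op1 g (eval1 t).
Proof. by apply: peval_lmul; [exact: op1_linear|exact: op1_comm|exact: op1_kill]. Qed.

Lemma laurent_eval E t n : pole_bounded E t -> all is_pzero (laurent_tail mul1 E t) ->
  n < 0 -> laurent (eval t) n = 0.
Proof.
move=> tE t0 n0.
have op_z g v : @op1 R (letter_to_z g) v = op1 g v by case: g.
have [B H] := @laurent_tail_eval C (V1 R) (V2 R) (@op1 R) op2 vac1 (vac2 R) (@laurent R)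
  (@op1_linear R) op_z (@laurentD R) (@laurentZ R) (@laurent_vac R) (@laurent_op2 R) mul1 mul1E
  E t tE.
have [lt|ge] := ltrP n (- E%:Z); first exact: B.
have [i iE ->] : exists2 i, (i < E)%N & n = i%:Z - E%:Z by exists (absz (n + E%:Z)); lia.
rewrite H //; apply: peval_zero; apply: (all_nthP pzero t0).
by rewrite laurent_tail_size.
Qed.

Lemma regular_mod_translates_eval E a zp c :
  (let t := psub (pscale (Zpos 60) 0 a) (ptranslate mul2 zp) in
   pole_bounded E t && all is_pzero (laurent_tail mul1 E t)) ->
  regular_mod_translates (polyCm R c *: eval a).
Proof.
case/andP=> tE t0; exists (polyCm R (c / 60%:R) *: eval zp) => n n0.
have -> : polyCm R c *: eval a - T2 (polyCm R (c / 60%:R) *: eval zp) =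
    polyCm R (c / 60%:R) *: eval (psub (pscale (Zpos 60) 0 a) (ptranslate mul2 zp)).
  rewrite T2Z psubE ptranslateE (peval_scale 'X (@op2_linear R)) mulr1.
  have -> : zval A (Zpos 60) = polyCm R 60%:R by rewrite rmorph_nat -(zval_nat A 60).
  by apply: scale_factor; rewrite pnatr_eq0.
rewrite laurentZ; apply: etrans (poly_expand_polyC _ _ _) _.
by rewrite (laurent_eval tE t0 n0) scaler0.
Qed.

End Regularity.

Lemma quadratic_words_ok u : words_ok (Zpos 2) (quadratic_words u).
Proof. by case: u. Qed.

Lemma quartic_words_ok u : words_ok (Zpos 4) (quartic_words u).
Proof. by case: u. Qed.

(** The rational factors are restored at this point: the states X and X' are
multiples of the integral ones, and A and B are the corresponding multiples of
the values of a and b. *)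
Lemma certified_decomposition (R : realType) (Y : V2 R -> int -> V2 R -> V2 R)
    ws ws' d e k1 j1 k2 j2 m E a b z c (X X' : V2 R) :
  is_state_field_map Y -> words_ok e ws -> words_ok d ws' ->
  certified ws ws' d k1 j1 k2 j2 (Z.of_nat m) E a b z -> (0 < m)%N ->
  Y X 0 X' = polyCm R c *:
    Y (words_state (@op2 R) ws (vac2 R)) 0 (words_state (@op2 R) ws' (vac2 R)) ->
  exists A B : V2 R,
    Y X 0 X' = Dtw ptz j1 A *+ k1 - Dtw ptw j2 A *+ k2 + T2 B /\ regular_mod_translates A.
Proof.
move=> HY ws_ok ws'_ok /andP[bE zE] m0 XE.
do 2![eexists]; split; first exact: (product_decomposition HY ws_ok ws'_ok m0 bE XE).
exact: regular_mod_translates_eval zE.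
Qed.

Theorem theorem4p5p1 (R : realType) (Y : V2 R -> int -> V2 R -> V2 R)
    (HY : is_state_field_map Y) :
  exists A11 A13 A31 A33 B11 B13 B31 B33 : V2 R,
    [/\ Y (sigma1 R ptz) 0 (sigma1 R ptw)
          = (Dtw ptz 1 A11 - Dtw ptw 1 A11) + T2 B11,
        Y (sigma1 R ptz) 0 (sigma3 R ptw)
          = (Dtw ptz 1 A13 *+ 3 - Dtw ptw 3 A13) + T2 B13,
        Y (sigma3 R ptz) 0 (sigma1 R ptw)
          = (Dtw ptz 3 A31 - Dtw ptw 1 A31 *+ 3) + T2 B31,
        Y (sigma3 R ptz) 0 (sigma3 R ptw)
          = (Dtw ptz 3 A33 *+ 3 - Dtw ptw 3 A33 *+ 3) + T2 B33
      & [/\ regular_mod_translates A11, regular_mod_translates A13,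
            regular_mod_translates A31 & regular_mod_translates A33]].
Proof.
have YZ c X n v : Y (c *: X) n v = c *: Y X n v.
  exact: (linear_scale (fun c X X' => va_linl (sf_vertex_algebra HY) c X X' n v)).
have YvZ c X n v : Y X n (c *: v) = c *: Y X n v.
  exact: (linear_scale (fun c v v' => va_linr (sf_vertex_algebra HY) c X n v v')).
have bilinear b c (X X' : V2 R) :
    Y (polyCm R b *: X) 0 (polyCm R c *: X') = polyCm R (b * c) *: Y X 0 X'.
  by rewrite YZ YvZ rmorphM; exact: scalerA.
have [A11 [B11 [E11 r11]]] := certified_decomposition HY (quadratic_words_ok false)
  (quadratic_words_ok true) certified11 isT (bilinear (- 2%:R) (- 2%:R) _ _).
have [A13 [B13 [E13 r13]]] := certified_decomposition HY (quadratic_words_ok false)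
  (quartic_words_ok true) certified13 isT (bilinear (- 2%:R) (4%:R / 9%:R) _ _).
have [A31 [B31 [E31 r31]]] := certified_decomposition HY (quartic_words_ok false)
  (quadratic_words_ok true) certified31 isT (bilinear (4%:R / 9%:R) (- 2%:R) _ _).
have [A33 [B33 [E33 r33]]] := certified_decomposition HY (quartic_words_ok false)
  (quartic_words_ok true) certified33 isT (bilinear (4%:R / 9%:R) (4%:R / 9%:R) _ _).
rewrite -!sigma1E -!sigma3E in E11 E13 E31 E33.
exists A11, A13, A31, A33, B11, B13, B31, B33.
split; [exact: E11|exact: E13|exact: E31|exact: E33|split].
- exact: r11.
- exact: r13.
- exact: r31.
- exact: r33.
Qed.
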